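(* Let $n\ge1$ and let $(M,\nabla,P)$ be infinitesimally homogeneous with structure group $G=\operatorname{U}(n)\times\{1\}$ and $\mathfrak I_0=0$, with torsion parameters $\tau_1,\tau_2,\tau_3\in\mathbb R$. Then $\tau_1\tau_3=0$, and there exists $\kappa\in\mathbb R$, with $\kappa\tau_1=0$, such that for $X,Y,Z\in H_0$ $$R_0(X,e)=0,\qquad R_0(X,Y)e=0,\qquad R_0(X,Y)Z=\kappa K_{X,Y}Z-\tau_2\tau_3\,\omega_0(X,Y)J_0Z.$$ Conversely, every $(\tau_1,\tau_2,\tau_3,\kappa)\in\mathbb R^4$ satisfying $\tau_1\tau_3=0$ and $\kappa\tau_1=0$ occurs. In particular, if $\tau_1\neq0$, then $\tau_3=\kappa=0$ and $\nabla$ is flat.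
   Context: Let $V$ be a finite-dimensional real vector space and $G\subseteq\operatorname{GL}(V)$ a Lie subgroup with Lie algebra $\mathfrak g\subseteq\mathfrak{gl}(V)$. A $G$-structure on a smooth manifold $M$ with $\dim M=\dim V$ is a principal $G$-subbundle $P$ of the frame bundle $\operatorname{FR}(TM)$; elements $p\in P_x$ are linear isomorphisms $p:V\to T_xM$, and two frames in $P_x$ differ by right composition with an element of $G$. An affine manifold with $G$-structure is a triple $(M,\nabla,P)$ with $\nabla$ an affine connection on $M$ and $P$ a $G$-structure. Put $T(X,Y)=\nabla_XY-\nabla_YX-[X,Y]$ and $R(X,Y)=\nabla_X\nabla_Y-\nabla_Y\nabla_X-\nabla_{[X,Y]}$. Inner torsion: for a local section $s:U\to P$ define $\Lambda^s_x(u)\in\mathfrak{gl}(V)$ by $\nabla_{s(x)u}(s\,w)=s(x)(\Lambda^s_x(u)w)$ for $u,w\in V$, where $s\,w$ is the vector field $x\mapsto s(x)w$. With $\mathfrak g_x=\operatorname{Ad}_p(\mathfrak g)$ for any $p\in P_x$ and $\overline{\operatorname{Ad}}_p:\mathfrak{gl}(V)/\mathfrak g\to\mathfrak{gl}(T_xM)/\mathfrak g_x$ induced by conjugation by $p$, the inner torsion is $\mathfrak I^P_x:T_xM\to\mathfrak{gl}(T_xM)/\mathfrak g_x$, $\mathfrak I^P_x(s(x)u)=\overline{\operatorname{Ad}}_{s(x)}(\Lambda^s_x(u)+\mathfrak g)$ (independent of $s$). $(M,\nabla,P)$ is infinitesimally homogeneous if there are linear maps $T_0:\Lambda^2V\to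 V$, $R_0:\Lambda^2V\to\mathfrak{gl}(V)$, $\mathfrak I_0:V\to\mathfrak{gl}(V)/\mathfrak g$ (the characteristic tensors) with $T_x(pu,pv)=p\,T_0(u,v)$, $R_x(pu,pv)pw=p\,R_0(u,v)w$, $\mathfrak I^P_x(pu)=\overline{\operatorname{Ad}}_p(\mathfrak I_0(u))$ for all $x\in M$, $p\in P_x$, $u,v,w\in V$. Here $V=H_0\oplus\mathbb Re$, where $H_0\simeq\mathbb R^{2n}$ has its standard Euclidean metric $h_0$, standard complex structure $J_0$ and $\omega_0(X,Y)=h_0(J_0X,Y)$. $G=\operatorname{U}(n)\times\{1\}\subset\operatorname{GL}(V)$ acts on $H_0$ by the standard real representation of $\operatorname{U}(n)$ and fixes $e$; $\mathfrak g=\mathfrak u(n)\oplus\{0\}$. The torsion parameters are the unique $\tau_1,\tau_2,\tau_3\in\mathbb R$ with $T_0(X,Y)=\tau_3\,\omega_0(X,Y)e$, $T_0(X,e)=\tau_1X+\tau_2J_0X$ for $X,Y\in H_0$. For $X,Y,Z\in H_0$, $$K_{X,Y}Z=\tfrac14\bigl(h_0(Y,Z)X-h_0(X,Z)Y+\omega_0(Y,Z)J_0X-\omega_0(X,Z)J_0Y-2\omega_0(X,Y)J_0Z\bigr).$$ ''$(\tau_1,\tau_2,\tau_3,\kappa)$ occurs'' means there is an infinitesimally homogeneous $(M,\nabla,P)$ with structure group $G$, $\mathfrak I_0=0$, these torsion parameters, and curvature characteristic tensor given by the displayed formulas. *)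

(* Defs.v *)
From HB Require Import structures.
From mathcomp Require Import all_boot all_order all_algebra.
From mathcomp Require Import sesquilinear.
From mathcomp Require Import all_classical all_reals all_analysis.

Set Implicit Arguments.
Unset Strict Implicit.
Unset Printing Implicit Defensive.

Import Order.TTheory GRing.Theory Num.Theory.
Import numFieldNormedType.Exports.
Local Open Scope classical_set_scope.
Local Open Scope ring_scope.

Section Smooth.
Variables (R : realType) (d : nat) (E : normedModType R).
Implicit Types (U : set 'cV[R]_d) (f : 'cV[R]_d -> E).

(* Used on open sets U only. *)
Fixpoint Ck (k : nat) U f : Prop :=
  if k is k'.+1 then
    (forall z, U z -> differentiable f z) /\
    (forall v, Ck k' U (fun z => 'd f z v))
  else forall z, U z -> {for z, continuous f}.

Definition Cinfty U f := forall k, Ck k U f.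

End Smooth.

(* The atlas is indexed by the points, chart a being a chart about a: this is
   an atlas together with the choice of a preferred chart at each point.
   chart a and chart_inv a are total functions, relevant only on chart_dom a
   and on its image. *)
Record manifold (R : realType) (d : nat) := Manifold {
  mspace :> topologicalType;
  chart_dom : mspace -> set mspace;
  chart : mspace -> mspace -> 'cV[R]_d;
  chart_inv : mspace -> 'cV[R]_d -> mspace;
  manifold_nonempty : [set: mspace] !=set0;
  manifold_hausdorff : hausdorff_space mspace;
  manifold_second_countable : @second_countable mspace;
  chart_dom_center : forall a, chart_dom a a;
  chart_dom_open : forall a, open (chart_dom a);
  chart_image_open : forall a, open (chart a @` chart_dom a);
  chartK : forall a x, chart_dom a x -> chart_inv a (chart a x) = x;
  chart_continuous : forall a x, chart_dom a x -> {for x, continuous (chart a)};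
  chart_inv_continuous : forall a z, (chart a @` chart_dom a) z ->
    {for z, continuous (chart_inv a)};
  transition_smooth : forall a b,
    Cinfty (chart a @` (chart_dom a `&` chart_dom b)) (chart b \o chart_inv a)
}.

Section Calculus.
Variables (R : realType) (d : nat) (M : manifold R d).

(* The tangent space T_x M is 'cV[R]_d, a tangent vector being given by its
   components in the preferred chart at x.  A vector field, possibly only
   meaningful on an open subset, is a total function M -> 'cV[R]_d. *)
Local Notation vfield := (M -> 'cV[R]_d).
Implicit Types (W : set M) (x y a : M) (u v : 'cV[R]_d) (X Y Z : vfield).

(* Components in the chart a of a tangent vector v at y in chart_dom a. *)
Definition dchart a y v : 'cV[R]_d := 'd (chart a \o chart_inv y) (chart y y) v.

Definition local_rep a X : 'cV[R]_d -> 'cV[R]_d :=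
  fun z => dchart a (chart_inv a z) (X (chart_inv a z)).

Definition smooth_fun W (f : M -> R) :=
  forall a, Cinfty (chart a @` (chart_dom a `&` W)) (f \o chart_inv a : _ -> R^o).

Definition smooth_field W X :=
  forall a, Cinfty (chart a @` (chart_dom a `&` W)) (local_rep a X).

Definition smooth_fun_near x f := exists W, [/\ open W, W x & smooth_fun W f].
Definition smooth_field_near x X := exists W, [/\ open W, W x & smooth_field W X].

Definition dirderiv x u (f : M -> R) : R :=
  'd (f \o chart_inv x : _ -> R^o) (chart x x) u.

(* Computed in the preferred chart at x, where X x is its own local
   representative. *)
Definition lie_bracket X Y : vfield := fun x =>
  'd (local_rep x Y) (chart x x) (X x) - 'd (local_rep x X) (chart x x) (Y x).

(* nabla x u Y is the covariant derivative at x of Y in the direction u in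
   T_x M.  The axioms constrain it for Y smooth near x; that it depends only
   on the germ of Y at x follows from the Leibniz rule, which holds for
   functions that are smooth near x, such as the indicator of an open
   neighbourhood of x. *)
Record connection := Connection {
  nabla :> forall x : M, 'cV[R]_d -> vfield -> 'cV[R]_d;
  nabla_linear : forall x Y, smooth_field_near x Y ->
    linear (fun u => nabla x u Y);
  nabla_add : forall x u Y Z, smooth_field_near x Y -> smooth_field_near x Z ->
    nabla x u (fun y => Y y + Z y) = nabla x u Y + nabla x u Z;
  nabla_leibniz : forall x u f Y, smooth_fun_near x f -> smooth_field_near x Y ->
    nabla x u (fun y => f y *: Y y) =
      dirderiv x u f *: Y x + f x *: nabla x u Y;
  nabla_smooth : forall W X Y, open W -> smooth_field W X -> smooth_field W Y ->
    smooth_field W (fun x => nabla x (X x) Y)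
}.

Variable D : connection.

Definition cov X Y : vfield := fun x => D x (X x) Y.

Definition torsion X Y : vfield := fun x =>
  cov X Y x - cov Y X x - lie_bracket X Y x.

Definition curvature X Y Z : vfield := fun x =>
  cov X (cov Y Z) x - cov Y (cov X Z) x - cov (lie_bracket X Y) Z x.

Definition flat := forall x X Y Z, smooth_field_near x X ->
  smooth_field_near x Y -> smooth_field_near x Z -> curvature X Y Z x = 0.

(* A frame V -> T_x M, where V = 'cV[R]_d, is an invertible matrix; P x is the
   set of frames of the G-structure P at x. *)
Implicit Types (s : M -> 'M[R]_d) (P : M -> set 'M[R]_d) (G g : set 'M[R]_d).

Definition local_section P W s :=
  [/\ open W, (forall x, W x -> P x (s x)) &
      forall w, smooth_field W (fun x => s x *m w)].

(* A principal G-subbundle of the frame bundle: each fibre is a G-orbit of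
   frames, and there are smooth local sections around every point. *)
Definition Gstructure G P :=
  [/\ forall x p, P x p -> p \in unitmx,
      forall x p, P x p -> P x = [set p *m a | a in G] &
      forall x, exists W s, W x /\ local_section P W s].

(* Lambda^s_x(u), given by its columns. *)
Definition Lambda s x u : 'M[R]_d := \matrix_(i, j)
  (invmx (s x) *m D x (s x *m u) (fun y => s y *m delta_mx j 0)) i 0.

Definition Ad (p A : 'M[R]_d) := p *m A *m invmx p.

(* A representative in gl(T_x M) of the inner torsion at v in T_x M. *)
Definition inner_torsion s x v : 'M[R]_d :=
  Ad (s x) (Lambda s x (invmx (s x) *m v)).

(* g is the Lie algebra of the structure group.  T_x and R_x are evaluated on
   tangent vectors through arbitrary smooth local extensions of them.
   T0 and R0 are the characteristic tensors, as alternating bilinear maps; I0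
   is a linear lift V -> gl(V) of the third one V -> gl(V)/g, and the equality
   in gl(T_x M)/g_x, where g_x = Ad_p(g), is stated as a congruence. *)
Definition infinitesimally_homogeneous g P
    (T0 : {bilinear 'cV[R]_d -> 'cV[R]_d -> 'cV[R]_d})
    (R0 : {bilinear 'cV[R]_d -> 'cV[R]_d -> 'M[R]_d})
    (I0 : {linear 'cV[R]_d -> 'M[R]_d}) :=
  [/\ forall u, T0 u u = 0 /\ R0 u u = 0,
      forall x p u v X Y, P x p ->
        smooth_field_near x X -> smooth_field_near x Y ->
        X x = p *m u -> Y x = p *m v ->
        torsion X Y x = p *m T0 u v,
      forall x p u v w X Y Z, P x p ->
        smooth_field_near x X -> smooth_field_near x Y ->
        smooth_field_near x Z ->
        X x = p *m u -> Y x = p *m v -> Z x = p *m w ->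
        curvature X Y Z x = p *m (R0 u v *m w) &
      forall x p u W s, P x p -> local_section P W s -> W x ->
        [set Ad p A | A in g] (inner_torsion s x (p *m u) - Ad p (I0 u))].

End Calculus.

Section UnitaryModel.
Variables (R : realType) (n : nat).
Local Notation H0 := 'cV[R]_(n + n).
Local Notation V := 'cV[R]_(n + n + 1).
Implicit Types (X Y Z : H0) (t k : R).

Definition h0 X Y : R := \sum_i X i 0 * Y i 0.
Definition J0 : 'M[R]_(n + n) := block_mx 0 (- 1%:M) 1%:M 0.
Definition omega0 X Y : R := h0 (J0 *m X) Y.

Definition inH X : V := col_mx X 0.
Definition evec : V := col_mx 0 1%:M.

(* The standard real representation identifies U(n) with the orthogonal
   J0-linear endomorphisms of H0. *)
Definition Un : set 'M[R]_(n + n) :=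
  [set A | A^T *m A = 1%:M /\ A *m J0 = J0 *m A].
Definition un : set 'M[R]_(n + n) :=
  [set A | A^T = - A /\ A *m J0 = J0 *m A].

Definition Un1 : set 'M[R]_(n + n + 1) := [set block_mx A 0 0 1%:M | A in Un].
Definition un0 : set 'M[R]_(n + n + 1) := [set block_mx A 0 0 0 | A in un].

Definition K X Y Z : H0 :=
  4^-1 *: (h0 Y Z *: X - h0 X Z *: Y + omega0 Y Z *: (J0 *m X)
           - omega0 X Z *: (J0 *m Y) - (2 * omega0 X Y) *: (J0 *m Z)).

Definition torsion_parameters (T0 : V -> V -> V) t1 t2 t3 :=
  forall X Y, T0 (inH X) (inH Y) = (t3 * omega0 X Y) *: evec /\
              T0 (inH X) evec = inH (t1 *: X + t2 *: (J0 *m X)).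

Definition curvature_formulas (R0 : V -> V -> 'M[R]_(n + n + 1)) t2 t3 k :=
  forall X Y Z,
    [/\ R0 (inH X) evec = 0,
        R0 (inH X) (inH Y) *m evec = 0 &
        R0 (inH X) (inH Y) *m inH Z =
          inH (k *: K X Y Z - (t2 * t3 * omega0 X Y) *: (J0 *m Z))].

Definition occurs t1 t2 t3 k :=
  exists (M : manifold R (n + n + 1)) (D : connection M)
         (P : M -> set 'M[R]_(n + n + 1))
         (T0 : {bilinear V -> V -> V})
         (R0 : {bilinear V -> V -> 'M[R]_(n + n + 1)})
         (I0 : {linear V -> 'M[R]_(n + n + 1)}),
    [/\ Gstructure Un1 P,
        infinitesimally_homogeneous D un0 P T0 R0 I0,
        forall u, un0 (I0 u),
        torsion_parameters T0 t1 t2 t3 &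
        curvature_formulas R0 t2 t3 k].

End UnitaryModel.

(* Main.v *)
Require Import Defs.
From HB Require Import structures.
From mathcomp Require Import all_boot all_order all_algebra.
From mathcomp Require Import sesquilinear ring lra.
From mathcomp Require Import all_classical all_reals all_analysis.

Set Implicit Arguments.
Unset Strict Implicit.
Unset Printing Implicit Defensive.

Import Order.TTheory GRing.Theory Num.Theory.
Import numFieldNormedType.Exports.
Local Open Scope classical_set_scope.
Local Open Scope ring_scope.

(** Constraints.  Let s be a local section of P and E_u the field x |-> s(x) u.
   As I_0 vanishes modulo the Lie algebra, the connection form Lambda of s is
   u(n)-valued, while the torsion and the curvature have the constant components
   T_0 and R_0 in the frame s.  The shape of T_0 makes it u(n)-invariant, so its
   covariant derivatives vanish and the first Bianchi identity for the E_u
   becomes algebraic ([first_bianchi_T0]); sums being cyclic in u, v, w,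
      sum R_0(u, v) w = - sum T_0(u, T_0(v, w)).
   On (X, Y, e) its e-component is t1 t3 = 0, and its H_0-component says that
   R_0(X, e) Y is symmetric in X and Y; since R_0(X, e) is also skew, it is 0.
   On H_0 it says that R_0(X, Y) + t2 t3 omega_0(X, Y) J_0 satisfies the
   identities of a Kaehler curvature tensor.  This tensor is U(n)-equivariant
   because all the frames of P at a point see the same curvature.  As U(n) is
   transitive on spheres ([unitary_transitive]) its holomorphic sectional
   curvature is a constant k, and a Kaehler curvature tensor is determined by
   its holomorphic sectional curvature ([kahler_curvature_polarization]), so it
   is k K.  Now R_0 is u(n)-invariant as well, and the second Bianchi identity
   becomes ([second_bianchi_R0])
      sum R_0(u, T_0(v, w)) = 0,
   which on (X, Y, e) reads 2 t1 R_0(X, Y) = 0: hence k t1 = 0, and R_0 = 0 if t1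
   is nonzero.

   Realization.  Put c = k / 4.  On the open set 1 + c |z|^2 > 0 of H_0 let g be
   the Fubini-Study metric of holomorphic sectional curvature k (complex
   hyperbolic if c < 0, flat if c = 0), Gamma its Levi-Civita connection and
   omega_g its Kaehler form.  The model M is the part of V = H_0 + R e over this
   set.  It carries the gauge
      F (X + b e) = (X - t1 b z) + (b + theta_z(X)) e,    d theta = - t3 omega_g,
   so that e - t1 z plays the role of the unit vertical field and X + theta(X) e
   of the horizontal lift of X.  The connection differentiates the components of
   fields in this gauge with d + L, where L at X + b e acts on H_0 as
   Gamma(X) - t2 b J_0 and kills e.  Torsion and curvature at a point then follow
   from the formulas for an arbitrary gauge ([gauge_torsion], [gauge_curvature]):
   the torsion of L contributes t2, the bracket of the gauge fields contributes
   t1 and t3, and the curvature of g contributes k K; the derivative of z along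
   the vertical field only produces terms with a factor t1 t3 or t1 c, which
   vanish.  The results are T_0 and R_0 with h_0 replaced by g.  The frames of P
   are F followed by a unitary frame of g, which turns g into h_0.  Since g and
   J_0 are parallel for L, every section of P has a u(n)-valued connection form,
   that is, the inner torsion vanishes ([model_Lambda]). *)

(** * Germs and product rules *)

Section Germs.
Variables (R : realType) (V E : normedModType R).
Implicit Types f g : V -> E.

Lemma near_eq_is_diff f g (df : {linear V -> E}) z :
  {near z, f =1 g} -> is_diff z f df -> is_diff z g df.
Proof.
move=> fg dfz; have fgz : f z = g z := nbhs_singleton fg.
have dc : continuous df by rewrite -(@diff_val _ _ _ _ _ _ _ dfz); apply: diff_continuous.
have gE : g \o shift z = cst (g z) + df +o_ 0 id.
  apply/eqaddoP => e e0.
  have /eqaddoP/(_ e e0) := diff_locally (@ex_diff _ _ _ _ _ _ _ dfz).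
  have : \forall h \near 0, f (h + z) = g (h + z).
    by move: fg; rewrite (near_shift 0) /=; apply: filterS => h; rewrite /= subr0.
  apply: filterS2 => h fgh.
  by rewrite !fctE /= fgh fgz (@diff_val _ _ _ _ _ _ _ dfz).
have dE := diff_unique dc gE.
by apply: DiffDef => //; apply/diff_locallyP; rewrite dE.
Qed.

Lemma near_eq_differentiable f g z :
  {near z, f =1 g} -> differentiable f z -> differentiable g z.
Proof. by move=> fg /differentiableP /(near_eq_is_diff fg) []. Qed.

Lemma near_eq_diff f g z : {near z, f =1 g} -> differentiable f z ->
  'd f z = 'd g z :> (V -> E).
Proof. by move=> fg /differentiableP /(near_eq_is_diff fg) []. Qed.

Lemma open_eq_near f g (U : set V) z :
  open U -> U z -> (forall y, U y -> f y = g y) -> {near z, f =1 g}.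
Proof. by move=> oU Uz fg; apply: filterS fg _; exact: open_nbhs_nbhs. Qed.

Lemma near_eq_continuous f g z :
  {near z, f =1 g} -> {for z, continuous f} -> {for z, continuous g}.
Proof.
move=> fg cf; rewrite /prop_for /continuous_at -(nbhs_singleton fg).
exact: cvg_trans (near_eq_cvg fg) cf.
Qed.

End Germs.

Section ScaleRule.
Variables (R : realType) (V E : normedModType R).

(** The product rule for a *: v is the chain rule for this bilinear map. *)
Definition scale_bil (a : R^o) (v : E) : E := a *: v.
Lemma scale_bil_is_bilinear : bilinear_for
  (GRing.Scale.Law.clone _ _ *:%R _) (GRing.Scale.Law.clone _ _ *:%R _) scale_bil.
Proof.
split=> [v|a] b x y; rewrite /scale_bil /=; first by rewrite scalerDl scalerA.
by rewrite scalerDr !scalerA mulrC.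
Qed.
HB.instance Definition _ := bilinear_isBilinear.Build R R^o E E _ _ scale_bil scale_bil_is_bilinear.
Lemma is_diffZ (f : V -> R^o) (A : V -> E) z :
  differentiable f z -> differentiable A z ->
  differentiable (fun y => f y *: A y) z /\
  forall v, 'd (fun y => f y *: A y) z v = 'd f z v *: A z + f z *: 'd A z v.
Proof.
move=> df dA.
have cB : continuous (fun p : R^o * E => scale_bil p.1 p.2) by move=> p; exact: scale_continuous.
have dp := differentiable_pair df dA.
have dB := differentiable_bilin (f z, A z) cB.
split; first exact: (differentiable_comp dp dB).
move=> v; have /(congr1 (@^~ v)) E1 := diff_comp dp dB.
apply: (etrans E1); rewrite /=.
have /(congr1 (@^~ ('d (fun y => (f y, A y)) z v))) E2 := diff_bilin (f z, A z) cB.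
apply: (etrans E2); have /(congr1 (@^~ v)) E3 := diff_pair df dA.
by rewrite E3 /= addrC.
Qed.
End ScaleRule.

Section RegularDiff.
Variables (R : realType) (V : normedModType R).
Implicit Types f g : V -> R^o.

Lemma differentiableM_o f g z : differentiable f z -> differentiable g z ->
  differentiable (fun y => f y * g y : R^o) z.
Proof. by move=> df dg; exact: (is_diffZ df dg).1. Qed.

Lemma diffM_o f g z v : differentiable f z -> differentiable g z ->
  'd (fun y => f y * g y : R^o) z v = f z * 'd g z v + g z * 'd f z v.
Proof.
by move=> df dg; rewrite addrC [g z * _]mulrC; exact: ((is_diffZ df dg).2 v).
Qed.

Lemma differentiableV_o f z : differentiable f z -> f z != 0 ->
  differentiable (fun y => (f y)^-1 : R^o) z.
Proof. by move=> df f0; have := @differentiableV R V f z df f0; exact. Qed.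

Lemma diffV_o f z v : differentiable f z -> f z != 0 ->
  'd (fun y => (f y)^-1 : R^o) z v = - (f z) ^- 2 * 'd f z v.
Proof. by move=> df f0; have := congr1 (@^~ v) (@diffV R V f z df f0); exact. Qed.

Lemma is_diff_sqrt (x : R) : 0 < x ->
  is_diff x (Num.sqrt : R -> R) (fun h => (2 * Num.sqrt x)^-1 * h).
Proof.
move=> x0; have [dx _] := is_derive1_sqrt x0.
apply: DiffDef; first exact/derivable1_diffP.
rewrite (deriv1E dx) derive1E (derive_sqrt x0).
by apply/funext => h; exact: mulrC.
Qed.

Lemma differentiable_sqrt_o f z : differentiable f z -> 0 < f z ->
  differentiable (fun y => Num.sqrt (f y) : R^o) z.
Proof.
move=> df f0; have [ds _] := is_diff_sqrt f0.
by have := @differentiable_comp R V R R f _ z df ds; exact.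
Qed.

Lemma diff_sqrt_o f z v : differentiable f z -> 0 < f z ->
  'd (fun y => Num.sqrt (f y) : R^o) z v = (2 * Num.sqrt (f z))^-1 * 'd f z v.
Proof.
move=> df f0; have [ds dE] := is_diff_sqrt f0.
have := congr1 (@^~ v) (@diff_comp R V R R f _ z df ds).
by rewrite /= dE; exact.
Qed.

End RegularDiff.

Section LinearContinuous.
Variables (R : realType) (m n : nat) (E : normedModType R).

Lemma mx_linear_continuous (L : {linear 'M[R]_(m, n) -> E}) : continuous L.
Proof.
have -> : (L : _ -> E) = fun A => \sum_i \sum_j A i j *: L (delta_mx i j).
  apply/funext => A; rewrite {1}[A]matrix_sum_delta linear_sum.
  by apply: eq_bigr => i _; rewrite linear_sum; apply: eq_bigr => j _; rewrite linearZ.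
have sumC (I : Type) (r : seq I) (F : I -> 'M[R]_(m, n) -> E) :
    (forall i, continuous (F i)) -> continuous (fun A => \sum_(i <- r) F i A).
  move=> cF; elim: r => [|i r IH] A.
    by under eq_fun do rewrite big_nil; exact: cst_continuous.
  by under eq_fun do rewrite big_cons; apply: continuousD; [exact: cF|exact: IH].
apply: (sumC) => i; apply: sumC => j A.
by apply: continuousZr_tmp; exact: coord_continuous.
Qed.

End LinearContinuous.

(** * Functions of class C^k *)

Section CkTheory.
Variables (R : realType) (d : nat).
Local Notation X := 'cV[R]_d.
Implicit Types (U : set X) (k : nat).

Section Generic.
Variable E : normedModType R.
Implicit Types f g : X -> E.

Lemma Ck_differentiable k U f : Ck k.+1 U f -> forall z, U z -> differentiable f z.
Proof. by case. Qed.

Lemma Ck_diff k U f v : Ck k.+1 U f -> Ck k U (fun z => 'd f z v).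
Proof. by move=> [_]; exact. Qed.

Lemma Ck_ext k U f g : open U -> (forall z, U z -> f z = g z) ->
  Ck k U f -> Ck k U g.
Proof.
move=> oU; elim: k f g => [|k IH] f g fg /=.
  by move=> cf z Uz; exact: near_eq_continuous (open_eq_near oU Uz fg) (cf z Uz).
move=> [df ckf]; split=> [z Uz|v].
  exact: near_eq_differentiable (open_eq_near oU Uz fg) (df z Uz).
apply: (IH _ _ _ (ckf v)) => z Uz.
by rewrite (near_eq_diff (open_eq_near oU Uz fg) (df z Uz)).
Qed.

Lemma Ck_sub k U U' f : U' `<=` U -> Ck k U f -> Ck k U' f.
Proof.
move=> sU; elim: k f => [|k IH] f /= => [cf z /sU/cf //|[df ckf]].
by split=> [z /sU/df //|v]; apply: IH.
Qed.

Lemma CkS k U f : Ck k.+1 U f -> Ck k U f.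
Proof.
elim: k f => [|k IH] f [df ckf] => [z Uz|].
  exact/differentiable_continuous/df.
by split=> // v; apply: IH.
Qed.

Lemma Ck_cst k U (a : E) : Ck k U (fun=> a).
Proof.
elim: k a => [|k IH] a /=; first by move=> z _; apply: cst_continuous.
split=> [z _|v]; first exact: differentiable_cst.
by rewrite (_ : (fun _ => _) = fun=> 0) //; apply/funext => z; rewrite diff_cst.
Qed.

Lemma CkD k U f g : open U -> Ck k U f -> Ck k U g -> Ck k U (fun z => f z + g z).
Proof.
move=> oU; elim: k f g => [|k IH] f g /=.
  by move=> cf cg z Uz; apply: continuousD; [exact: cf|exact: cg].
move=> [df ckf] [dg ckg]; split=> [z Uz|v].
  by apply: differentiableD; [exact: df|exact: dg].
apply: Ck_ext oU _ (IH _ _ (ckf v) (ckg v)) => z Uz.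
by rewrite (@diffD _ _ _ f g z (df z Uz) (dg z Uz)).
Qed.

Lemma Ck_sum k U (I : Type) (r : seq I) (F : I -> X -> E) : open U ->
  (forall i, Ck k U (F i)) -> Ck k U (fun z => \sum_(i <- r) F i z).
Proof.
move=> oU cF; elim: r => [|i r IH].
  by under eq_fun do rewrite big_nil; exact: Ck_cst.
by under eq_fun do rewrite big_cons; apply: CkD.
Qed.

End Generic.

Lemma Ck_lin (E F : normedModType R) (L : {linear E -> F}) k U (f : X -> E) :
  continuous L -> open U -> Ck k U f -> Ck k U (fun z => L (f z)).
Proof.
move=> cL oU; elim: k f => [|k IH] f /=.
  by move=> cf z Uz; apply: continuous_comp; [exact: cf|exact: cL].
have dL x : is_diff x L L.
  by apply: DiffDef; [exact: linear_differentiable|exact: diff_lin].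
move=> [df ckf]; split=> [z Uz|v].
  by apply: differentiable_comp; [exact: df|exact: (@ex_diff _ _ _ _ _ _ _ (dL _))].
apply: Ck_ext oU _ (IH _ (ckf v)) => z Uz.
rewrite (diff_comp (df z Uz) (@ex_diff _ _ _ _ _ _ _ (dL (f z)))).
by rewrite (@diff_val _ _ _ _ _ _ _ (dL (f z))).
Qed.

Lemma CkZ (E : normedModType R) k U (f : X -> R^o) (g : X -> E) : open U ->
  Ck k U f -> Ck k U g -> Ck k U (fun z => f z *: g z).
Proof.
move=> oU; elim: k f g => [|k IH] f g.
  by move=> /= cf cg z Uz; apply: continuousZ; [exact: cf|exact: cg].
move=> ckf ckg; have df := Ck_differentiable ckf; have dg := Ck_differentiable ckg.
split=> [z Uz|v]; first exact: (is_diffZ (df z Uz) (dg z Uz)).1.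
apply: (@Ck_ext _ k U (fun z => 'd f z v *: g z + f z *: 'd g z v)) => //.
  by move=> z Uz; rewrite (is_diffZ (df z Uz) (dg z Uz)).2.
exact: (CkD oU (IH _ _ (Ck_diff v ckf) (CkS ckg)) (IH _ _ (CkS ckf) (Ck_diff v ckg))).
Qed.

Lemma Ck_linear (E : normedModType R) (L : {linear X -> E}) k U :
  open U -> Ck k U L.
Proof.
move=> oU; case: k => [|k] /=; first by move=> z _; apply: mx_linear_continuous.
split=> [z _|v]; first exact/linear_differentiable/mx_linear_continuous.
apply: Ck_ext oU _ (Ck_cst k U (L v)) => z _.
by rewrite diff_lin //; exact: mx_linear_continuous.
Qed.

Implicit Types f g : X -> R^o.

Lemma CkM k U f g : open U -> Ck k U f -> Ck k U g ->
  Ck k U (fun z => f z * g z : R^o).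
Proof. exact: CkZ. Qed.

Lemma CkN k U f : open U -> Ck k U f -> Ck k U (fun z => - f z : R^o).
Proof.
move=> oU ckf; apply: Ck_ext oU _ (CkM oU (Ck_cst k U (-1 : R^o)) ckf) => z _.
by rewrite mulN1r.
Qed.

Lemma CkV k U f : open U -> (forall z, U z -> f z != 0) -> Ck k U f ->
  Ck k U (fun z => (f z)^-1 : R^o).
Proof.
move=> oU f0; elim: k => [|k IH].
  by move=> cf z Uz; apply: continuousV; [exact: f0|exact: cf].
move=> ckf; have df := Ck_differentiable ckf; split=> [z Uz|v].
  by apply: differentiableV_o; [exact: df|exact: f0].
have ckV := IH (CkS ckf).
apply: (@Ck_ext _ k U (fun z => - ((f z)^-1 * (f z)^-1) * 'd f z v : R^o)) => //.
  by move=> z Uz; rewrite (diffV_o v (df z Uz) (f0 z Uz)) -expr2 -exprVn.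
exact: (CkM oU (CkN oU (CkM oU ckV ckV)) (Ck_diff v ckf)).
Qed.

Lemma Ck_sqrt k U f : open U -> (forall z, U z -> 0 < f z) -> Ck k U f ->
  Ck k U (fun z => Num.sqrt (f z) : R^o).
Proof.
move=> oU f0; elim: k => [|k IH].
  by move=> cf z Uz; apply: continuous_comp; [exact: cf|exact: sqrt_continuous].
move=> ckf; have df := Ck_differentiable ckf.
split=> [z Uz|v].
  by apply: differentiable_sqrt_o; [exact: df|exact: f0].
apply: (@Ck_ext _ k U (fun z => (2 * Num.sqrt (f z))^-1 * 'd f z v : R^o)) => //.
  by move=> z Uz; rewrite (diff_sqrt_o v (df z Uz) (f0 z Uz)).
apply: (CkM oU _ (Ck_diff v ckf)); apply: (CkV oU).
  by move=> z Uz; rewrite mulf_neq0 ?gt_eqF// sqrtr_gt0 f0.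
exact: (CkM oU (Ck_cst k U (2 : R^o)) (IH (CkS ckf))).
Qed.

Lemma Ck_prod k U (I : Type) (r : seq I) (F : I -> X -> R^o) : open U ->
  (forall i, Ck k U (F i)) -> Ck k U (fun z => \prod_(i <- r) F i z : R^o).
Proof.
move=> oU cF; elim: r => [|i r IH].
  by under eq_fun do rewrite big_nil; exact: Ck_cst.
by under eq_fun do rewrite big_cons; apply: CkM.
Qed.

(** The target R^o makes a matrix entry a function to which Ck applies. *)
Definition mx_coef m n (i : 'I_m) (j : 'I_n) (A : 'M[R]_(m, n)) : R^o := A i j.
Lemma mx_coef_linear m n i j : linear (@mx_coef m n i j).
Proof. by move=> a A B; rewrite /mx_coef !mxE. Qed.
HB.instance Definition _ m n i j :=
  GRing.isLinear.Build R _ _ _ (@mx_coef m n i j) (mx_coef_linear i j).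

Section MatrixValued.
Variables (m n : nat).
Implicit Type A : X -> 'M[R]_(m, n).

Lemma Ck_mxP k U A : open U ->
  (forall i j, Ck k U (fun z => A z i j : R^o)) <-> Ck k U A.
Proof.
move=> oU; split=> [cA|cA i j]; last first.
  by apply: (Ck_lin (L := @mx_coef m n i j)) => //; exact: coord_continuous.
have -> : A = fun z => \sum_i \sum_j A z i j *: delta_mx i j.
  by apply/funext => z; rewrite [LHS]matrix_sum_delta.
apply: Ck_sum => // i; apply: Ck_sum => // j.
pose L (x : R^o) : 'M[R]_(m, n) := x *: delta_mx i j.
have Ll : linear L by move=> a x y; rewrite /L scalerDl scalerA.
pose LL : {linear R^o -> 'M[R]_(m, n)} :=
  HB.pack L (GRing.isLinear.Build R R^o 'M[R]_(m, n) _ L Ll).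
by apply: (Ck_lin (L := LL)) => //; exact: scalel_continuous.
Qed.

Lemma diff_mx A z v i j : differentiable A z ->
  'd (fun y => A y i j : R^o) z v = ('d A z v) i j.
Proof.
move=> dA.
rewrite (@diff_comp _ _ _ _ A (@mx_coef m n i j) z) //=; last exact: differentiable_coord.
by rewrite diff_lin //; exact: coord_continuous.
Qed.

End MatrixValued.

End CkTheory.

(** * Symmetry of second derivatives *)

Section Schwarz.
Variables (R : realType) (X : normedModType R).
Implicit Types (U : set X) (f : X -> R^o).

Lemma is_derive_line f (u w : X) (s : R) : differentiable f (s *: u + w) ->
  is_derive s 1 (fun t : R => f (t *: u + w) : R) ('d f (s *: u + w) u).
Proof.
move=> df.
have dl : is_diff s (fun t : R => t *: u + w) (fun t : R => t *: u).
  by have := is_diffD (is_diff_scalel s u) (is_diff_cst w s); rewrite addr0.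
have dd : differentiable (fun t : R => t *: u + w) s by case: dl.
have dc : differentiable (f \o (fun t : R => t *: u + w)) s.
  exact: differentiable_comp dd df.
have dE := deriveE (1 : R^o) dc.
rewrite (diff_comp dd df) /= (@diff_val _ _ _ _ _ _ _ dl) scale1r in dE.
have dr : derivable (f \o (fun t : R => t *: u + w)) s 1 by exact/derivable1_diffP.
exact: (DeriveDef dr dE).
Qed.

(** The mean value theorem, applied in the direction u and then in v. *)
Lemma mixed_difference f u v z (h : R) : 0 <= h ->
  (forall s t, s \in `[0, h] -> t \in `[0, h] ->
     differentiable f (s *: u + (t *: v + z))) ->
  (forall s t, s \in `[0, h] -> t \in `[0, h] ->
     differentiable (fun y => 'd f y u : R^o) (t *: v + (s *: u + z))) ->
  exists s t, [/\ s \in `[0, h], t \in `[0, h] &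
    f (h *: u + (h *: v + z)) - f (h *: u + z) - (f (h *: v + z) - f z) =
    'd (fun y => 'd f y u : R^o) (t *: v + (s *: u + z)) v * h * h].
Proof.
move=> h0 df ddf.
have h00 : (0 : R) \in `[0, h] by rewrite in_itv /= lexx.
have hh : h \in `[0, h] by rewrite in_itv /= lexx h0.
pose phi (s : R) : R := f (s *: u + (h *: v + z)) - f (s *: u + z).
have dphi s : s \in `[0, h] -> is_derive s 1 phi
    ('d f (s *: u + (h *: v + z)) u - 'd f (s *: u + z) u).
  move=> sh; apply: is_deriveB; apply: is_derive_line; first exact: df.
  by have := df s 0 sh h00; rewrite scale0r add0r.
have [|s sh phiE] := MVT_segment h0 (fun s sh => dphi s (subset_itv_oo_cc sh)).
  by apply: derivable_within_continuous => s sh; case: (dphi s sh).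
pose psi (t : R) : R := 'd f (t *: v + (s *: u + z)) u.
have dpsi t : t \in `[0, h] -> is_derive t 1 psi
    ('d (fun y => 'd f y u : R^o) (t *: v + (s *: u + z)) v).
  by move=> th; exact: (is_derive_line (ddf s t sh th)).
have [|t th psiE] := MVT_segment h0 (fun t th => dpsi t (subset_itv_oo_cc th)).
  by apply: derivable_within_continuous => t th; case: (dpsi t th).
exists s, t; split=> //.
move: phiE psiE; rewrite /phi /psi !scale0r !add0r !subr0.
rewrite (addrCA (s *: u)) => -> ->; by rewrite mulrAC.
Qed.

(** The second difference over a small parallelogram is symmetric in u and v, and
   equals h^2 times a value near z of either mixed second derivative. *)
Lemma schwarz U f u v z : open U -> U z ->
  (forall y, U y -> differentiable f y) ->
  (forall w y, U y -> differentiable (fun y => 'd f y w : R^o) y) ->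
  (forall w w', {for z, continuous (fun y => 'd (fun x => 'd f x w : R^o) y w' : R^o)}) ->
  'd (fun y => 'd f y u : R^o) z v = 'd (fun y => 'd f y v : R^o) z u.
Proof.
move=> oU Uz df ddf cddf; apply/eqP; rewrite -subr_eq0 -normr_le0.
apply/ler_addgt0Pl => e e0; rewrite addr0.
pose A y := 'd (fun x => 'd f x u : R^o) y v; pose B y := 'd (fun x => 'd f x v : R^o) y u.
have e2 : 0 < e / 2 by rewrite divr_gt0.
have nA : \forall y \near z, `|A z - A y| < e / 2.
  by have /cvgrPdist_lt/(_ _ e2) := cddf u v.
have nB : \forall y \near z, `|B z - B y| < e / 2.
  by have /cvgrPdist_lt/(_ _ e2) := cddf v u.
have nU : \forall y \near z, U y by exact: open_nbhs_nbhs.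
have /nbhs_normP[r /= r0 rP] : \forall y \near z,
    [/\ U y, `|A z - A y| < e / 2 & `|B z - B y| < e / 2].
  by near=> y; split; near: y.
pose h : R := r / (`|u| + `|v| + 1).
have uv0 : 0 < `|u| + `|v| + 1 by rewrite ltr_wpDl// addr_ge0.
have h0 : 0 < h by rewrite divr_gt0.
have close s t : s \in `[0, h] -> t \in `[0, h] ->
    [/\ U (s *: u + (t *: v + z)), `|A z - A (s *: u + (t *: v + z))| < e / 2 &
     `|B z - B (s *: u + (t *: v + z))| < e / 2].
  rewrite !in_itv /= => /andP[s0 sh] /andP[t0 th]; apply: rP => /=.
  rewrite addrA opprD addrCA subrr addr0 normrN.
  apply: (le_lt_trans (ler_normD _ _)); rewrite !normrZ !ger0_norm//.
  have -> : r = h * `|u| + h * `|v| + h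
    by rewrite -!mulrDr -[X in _ + X]mulr1 -mulrDr mulfVK ?gt_eqF.
  apply: (@le_lt_trans _ _ (h * `|u| + h * `|v|)); last by rewrite ltrDl.
  by apply: lerD; apply: ler_wpM2r.
have swap s t : s *: u + (t *: v + z) = t *: v + (s *: u + z) by rewrite addrCA.
have [s [t [sh th E1]]] : exists s t, [/\ s \in `[0, h], t \in `[0, h] &
    f (h *: u + (h *: v + z)) - f (h *: u + z) - (f (h *: v + z) - f z) =
    A (s *: u + (t *: v + z)) * h * h].
  have [||s [t [sh th E]]] := @mixed_difference f u v z h (ltW h0).
  - by move=> s t sh th; apply: df; case: (close s t sh th).
  - by move=> s t sh th; apply: ddf; rewrite -swap; case: (close s t sh th).
  by exists s, t; split=> //; rewrite E /A (swap s t).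
have [t' [s' [th' sh' E2]]] : exists t s, [/\ t \in `[0, h], s \in `[0, h] &
    f (h *: v + (h *: u + z)) - f (h *: v + z) - (f (h *: u + z) - f z) =
    B (s *: u + (t *: v + z)) * h * h].
  have [||t' [s' [th' sh' E]]] := @mixed_difference f v u z h (ltW h0).
  - by move=> t' s' th' sh'; apply: df; rewrite -swap; case: (close s' t' sh' th').
  - by move=> t' s' th' sh'; apply: ddf; case: (close s' t' sh' th').
  by exists t', s'.
(* h^2 times either side is the second difference *)
have AB : A (s *: u + (t *: v + z)) = B (s' *: u + (t' *: v + z)).
  have hn : h != 0 by rewrite gt_eqF.
  apply: (mulIf hn); apply: (mulIf hn); rewrite -E1 -E2 -swap.
  by rewrite -!addrA; congr (_ + _); rewrite opprD opprK opprD opprK addrCA.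
rewrite -/(A z) -/(B z).
have -> : A z - B z = (A z - A (s *: u + (t *: v + z))) -
    (B z - B (s' *: u + (t' *: v + z))) by rewrite AB opprB addrA subrK.
apply: (le_trans (ler_normB _ _)); rewrite [leRHS]splitr.
by apply: lerD; apply: ltW; [case: (close s t sh th)|case: (close s' t' sh' th')].
Unshelve. all: by end_near.
Qed.

End Schwarz.

(** * Matrix-valued functions *)

Section CkMatrix.
Variables (R : realType) (d : nat).
Local Notation X := 'cV[R]_d.
Implicit Types (U : set X) (k : nat).

Lemma Ck_mulmx m n p k U (A : X -> 'M[R]_(m, n)) (B : X -> 'M[R]_(n, p)) :
  open U -> Ck k U A -> Ck k U B -> Ck k U (fun z => A z *m B z).
Proof.
move=> oU /(Ck_mxP k _ oU) cA /(Ck_mxP k _ oU) cB; apply/(Ck_mxP k _ oU) => i j.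
apply: Ck_ext oU _ (Ck_sum (index_enum _) oU (fun l => CkM oU (cA i l) (cB l j))).
by move=> z _; rewrite mxE.
Qed.

Lemma Ck_det n k U (A : X -> 'M[R]_n) : open U ->
  Ck k U A -> Ck k U (fun z => \det (A z) : R^o).
Proof.
move=> oU /(Ck_mxP k _ oU) cA; apply: Ck_sum => // s; apply: CkM => //.
  exact: Ck_cst.
by apply: Ck_prod.
Qed.

(** Cramer's rule expresses the inverse through determinants. *)
Lemma Ck_invmx n k U (A : X -> 'M[R]_n) : open U ->
  (forall z, U z -> A z \in unitmx) -> Ck k U A -> Ck k U (fun z => invmx (A z)).
Proof.
move=> oU uA cA; have /(Ck_mxP k _ oU) cAij := cA.
have cV : Ck k U (fun z => (\det (A z))^-1 : R^o).
  apply: (CkV oU) (Ck_det oU cA) => z Uz.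
  by have := uA z Uz; rewrite unitmxE unitfE.
have cadj : Ck k U (fun z => \adj (A z)).
  apply/(Ck_mxP k _ oU) => i j.
  apply: (@Ck_ext _ _ _ k U (fun z => (-1) ^+ (j + i) * \det (row' j (col' i (A z))) : R^o)) => //.
    by move=> z _; rewrite mxE.
  apply: (CkM oU (Ck_cst k U _)); apply: (Ck_det oU); apply/(Ck_mxP k _ oU) => a b.
  by apply: Ck_ext oU _ (cAij (lift j a) (lift i b)) => z _; rewrite !mxE.
by apply: Ck_ext oU _ (CkZ oU cV cadj) => z Uz; rewrite /invmx uA.
Qed.

End CkMatrix.

Section SumRules.
Variables (R : realType) (V E : normedModType R).

Lemma differentiable_bigsum (I : Type) (r : seq I) (F : I -> V -> E) z :
  (forall i, differentiable (F i) z) ->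
  differentiable (fun y => \sum_(i <- r) F i y) z.
Proof.
move=> dF; elim: r => [|i r IH].
  by under eq_fun do rewrite big_nil; exact: differentiable_cst.
by under eq_fun do rewrite big_cons; exact: differentiableD (dF i) IH.
Qed.

Lemma diff_bigsum (I : Type) (r : seq I) (F : I -> V -> E) z v :
  (forall i, differentiable (F i) z) ->
  'd (fun y => \sum_(i <- r) F i y) z v = \sum_(i <- r) 'd (F i) z v.
Proof.
move=> dF; elim: r => [|i r IH].
  by under eq_fun do rewrite big_nil; rewrite big_nil (@diff_cst _ V E 0 z).
under eq_fun do rewrite big_cons; rewrite big_cons -IH.
by rewrite (@diffD _ V E (F i) _ z (dF i) (differentiable_bigsum r dF)).
Qed.

End SumRules.

Section MatrixProductRules.
Variables (R : realType) (d : nat).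
Local Notation X := 'cV[R]_d.

Lemma differentiable_mxP m n (A : X -> 'M[R]_(m, n)) z :
  (forall i j, differentiable (fun y => A y i j : R^o) z) <-> differentiable A z.
Proof.
split=> [dA|dA i j]; last first.
  exact: (differentiable_comp dA (differentiable_coord (A z) i j)).
have -> : A = fun z => \sum_i \sum_j A z i j *: delta_mx i j.
  by apply/funext => y; rewrite [LHS]matrix_sum_delta.
apply: differentiable_bigsum => i; apply: differentiable_bigsum => j.
exact: differentiableZl (dA i j).
Qed.

Lemma is_diff_mulmx m n p (A : X -> 'M[R]_(m, n)) (B : X -> 'M[R]_(n, p)) z :
  differentiable A z -> differentiable B z ->
  differentiable (fun y => A y *m B y) z /\
  forall v, 'd (fun y => A y *m B y) z v = 'd A z v *m B z + A z *m 'd B z v.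
Proof.
move=> dA dB; have /differentiable_mxP dAij := dA; have /differentiable_mxP dBij := dB.
have ABE i j : (fun y => (A y *m B y) i j : R^o) = fun y => \sum_l A y i l * B y l j.
  by apply/funext => y; rewrite mxE.
have dl i j l : differentiable (fun y => A y i l * B y l j : R^o) z.
  exact: differentiableM_o.
have dAB : differentiable (fun y => A y *m B y) z.
  by apply/differentiable_mxP => i j; rewrite ABE; exact: differentiable_bigsum.
split=> // v; apply/matrixP => i j; rewrite -(diff_mx _ _ _ dAB) ABE !mxE.
rewrite (diff_bigsum _ _ (dl i j)) -big_split; apply: eq_bigr => l _ /=.
rewrite (diffM_o v (dAij i l) (dBij l j)) (diff_mx v i l dA) (diff_mx v l j dB).
by rewrite addrC [B z l j * _]mulrC.
Qed.

End MatrixProductRules.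

Section DiffAlongField.
Variables (R : realType) (d : nat) (E : normedModType R).
Local Notation X := 'cV[R]_d.

Lemma linear_coordE (L : {linear X -> E}) v :
  L v = \sum_i v i 0 *: L (delta_mx i 0).
Proof.
rewrite {1}(matrix_sum_delta v) linear_sum.
by apply: eq_bigr => i _; rewrite big_ord1 linearZ.
Qed.

Implicit Types (A : X -> {linear X -> E}) (f : X -> E) (g : X -> X).

(** Evaluating a variable linear map A along a variable vector g is a finite sum
   of products g_i A(e_i) in coordinates. *)
Lemma is_diff_linapp A g z :
  differentiable g z -> (forall v, differentiable (fun y => A y v) z) ->
  differentiable (fun y => A y (g y)) z /\
  forall v, 'd (fun y => A y (g y)) z v = 'd (fun y => A y (g z)) z v + A z ('d g z v).
Proof.
move=> dg dA; have /differentiable_mxP dgij := dg.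
pose F i y := g y i 0 *: A y (delta_mx i 0).
pose G i y := g z i 0 *: A y (delta_mx i 0).
have dF i := is_diffZ (dgij i 0) (dA (delta_mx i 0)).
have dFi i : differentiable (F i) z := (dF i).1.
have dGi i : differentiable (G i) z := differentiableZ _ (dA _).
have gE : (fun y => A y (g y)) = fun y => \sum_i F i y.
  by apply/funext => y; exact: linear_coordE.
have cE : (fun y => A y (g z)) = fun y => \sum_i G i y.
  by apply/funext => y; exact: linear_coordE.
rewrite gE cE; split=> [|v]; first exact: (differentiable_bigsum (index_enum _) dFi).
have E1 := diff_bigsum (index_enum _) v dFi; have E2 := diff_bigsum (index_enum _) v dGi.
apply: (etrans E1); apply: esym; apply: (etrans (congr1 (+%R^~ _) E2)).
apply: (etrans (congr1 (+%R _) (linear_coordE (A z) ('d g z v)))).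
rewrite -big_split; apply: eq_bigr => i _.
have /(congr1 (@^~ v)) E3 := diffZ (g z i 0) (dA (delta_mx i 0)).
apply: (etrans _ (esym ((dF i).2 v))); apply: (etrans (congr1 (+%R^~ _) E3)).
by rewrite /= addrC -(diff_mx v i 0 dg).
Qed.

Lemma Ck_linapp k (U : set X) A g : open U ->
  (forall v, Ck k U (fun y => A y v)) -> Ck k U g -> Ck k U (fun z => A z (g z)).
Proof.
move=> oU cA /(Ck_mxP k _ oU) cg.
pose F i z := (g z i 0 : R^o) *: A z (delta_mx i 0).
have cF i : Ck k U (F i) by exact: (CkZ oU (cg i 0) (cA _)).
apply: Ck_ext oU _ (Ck_sum (index_enum _) oU cF) => z Uz.
exact/esym/linear_coordE.
Qed.

Lemma is_diff_dapp f g z :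
  differentiable g z -> (forall v, differentiable (fun y => 'd f y v) z) ->
  differentiable (fun y => 'd f y (g y)) z /\
  forall v, 'd (fun y => 'd f y (g y)) z v =
    'd (fun y => 'd f y (g z)) z v + 'd f z ('d g z v).
Proof. exact: (@is_diff_linapp (fun y => 'd f y)). Qed.

Lemma Ck_dapp k (U : set X) f g : open U ->
  Ck k.+1 U f -> Ck k U g -> Ck k U (fun z => 'd f z (g z)).
Proof.
move=> oU cf; apply: (@Ck_linapp k U (fun y => 'd f y) g oU) => v.
exact: Ck_diff.
Qed.

End DiffAlongField.

Lemma schwarz_mx (R : realType) (d m n : nat) (U : set 'cV[R]_d)
    (f : 'cV[R]_d -> 'M[R]_(m, n)) u v z : open U -> U z -> Ck 2 U f ->
  'd (fun y => 'd f y u) z v = 'd (fun y => 'd f y v) z u.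
Proof.
move=> oU Uz cf; apply/matrixP => i j.
have /(Ck_mxP _ _ oU)/(_ i j) cij := cf.
have d1 w := Ck_differentiable (Ck_diff w cf) Uz.
have E w w' : ('d (fun y => 'd f y w) z w') i j =
    'd (fun y => 'd (fun p => f p i j : R^o) y w : R^o) z w'.
  rewrite -(diff_mx w' i j (d1 w)).
  have nE : {near z, (fun y => ('d f y w) i j : R^o) =1
      fun y => 'd (fun p => f p i j : R^o) y w}.
    apply: (open_eq_near oU Uz) => y Uy.
    by rewrite (diff_mx w i j (Ck_differentiable cf Uy)).
  have /differentiable_mxP/(_ i j) dd := d1 w.
  exact: (congr1 (@^~ w') (near_eq_diff nE dd)).
rewrite !E; apply: (schwarz _ _ oU Uz) => [y Uy|w y Uy|w w'].
- exact: Ck_differentiable cij y Uy.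
- exact: (Ck_differentiable (Ck_diff w cij)).
- exact: (Ck_diff w' (Ck_diff w cij)).
Qed.

Section LinearMaps.
Variables (R : realType) (d : nat) (E : normedModType R) (f : 'cV[R]_d -> E).
Hypothesis lf : linear f.

Lemma is_diff_of_linear p : is_diff p f f.
Proof.
pose L : {linear 'cV[R]_d -> E} := HB.pack f (GRing.isLinear.Build R 'cV[R]_d E _ f lf).
have cL : continuous L := @mx_linear_continuous R d 1 E L.
have dL : differentiable L p by exact: linear_differentiable.
by apply: DiffDef; [exact: dL|exact: (diff_lin p cL)].
Qed.

Lemma Ck_of_linear k (A : set 'cV[R]_d) : open A -> Ck k A f.
Proof.
pose L : {linear 'cV[R]_d -> E} := HB.pack f (GRing.isLinear.Build R 'cV[R]_d E _ f lf).
exact: (@Ck_linear R d E L).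
Qed.

End LinearMaps.

Section MoreRules.
Variables (R : realType) (d : nat).
Local Notation V := 'cV[R]_d.

Lemma is_diff_linear_comp m m' k k' (L : {linear 'M[R]_(m, m') -> 'M[R]_(k, k')})
    (f : V -> 'M[R]_(m, m')) (p : V) :
  differentiable f p ->
  differentiable (fun z => L (f z)) p /\ forall v, 'd (fun z => L (f z)) p v = L ('d f p v).
Proof.
move=> df; have cL : continuous L := @mx_linear_continuous R m m' _ L.
have dL : differentiable L (f p) by exact: linear_differentiable.
split=> [|v]; first exact: (differentiable_comp df dL).
apply: (etrans (congr1 (@^~ v) (diff_comp df dL))).
exact: (congr1 (@^~ ('d f p v)) (diff_lin (f p) cL)).
Qed.

(** Differentiates algebraic identities that hold on an open set. *)
Lemma diff_eq_cst (E : normedModType R) (A : set V) (f : V -> E) (a : E) (p w : V) :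
  open A -> A p -> (forall z, A z -> f z = a) -> 'd f p w = 0.
Proof.
move=> oA Ap fa; have nE : {near p, cst a =1 f}.
  by apply: (open_eq_near oA Ap) => z /fa ->.
have := congr1 (@^~ w) (near_eq_diff nE (differentiable_cst a p)).
by move=> <-; exact: (congr1 (@^~ w) (diff_cst a p)).
Qed.

End MoreRules.

(** * Kaehler curvature tensors *)

Section KahlerCurvatureTensor.
Variables (R : realFieldType) (V : zmodType) (J : V -> V) (q : V -> V -> V -> V -> R).

Definition kahler_curvature_tensor :=
  [/\ [/\ forall X X' Y Z W, q (X + X') Y Z W = q X Y Z W + q X' Y Z W,
          forall X Y Z W, q Y X Z W = - q X Y Z W &
          forall X Y Z W, q X Y W Z = - q X Y Z W],
      forall X Y Z W, q X Y Z W + q Y Z X W + q Z X Y W = 0 &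
      forall X Y Z W, q X Y (J Z) (J W) = q X Y Z W].

Hypotheses (JJ : forall X, J (J X) = - X) (JD : forall X Y, J (X + Y) = J X + J Y).
Hypothesis qK : kahler_curvature_tensor.

Let qD1 X X' Y Z W : q (X + X') Y Z W = q X Y Z W + q X' Y Z W.
Proof. by have [[]] := qK. Qed.
Let q12 X Y Z W : q Y X Z W = - q X Y Z W.
Proof. by have [[]] := qK. Qed.
Let q34 X Y Z W : q X Y W Z = - q X Y Z W.
Proof. by have [[]] := qK. Qed.
Let qB X Y Z W : q X Y Z W + q Y Z X W + q Z X Y W = 0.
Proof. by have [] := qK. Qed.
Let qJ X Y Z W : q X Y (J Z) (J W) = q X Y Z W.
Proof. by have [] := qK. Qed.

(** A combination of the four Bianchi identities that keep one of X, Y, Z, W in the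
   last slot. *)
Lemma curvature_pair_sym X Y Z W : q X Y Z W = q Z W X Y.
Proof.
have := qB X Y Z W; have := qB Y Z W X; have := qB Z W X Y; have := qB W X Y Z.
have := q34 X Y Z W; have := q34 Y Z X W; have := q12 Z X W Y; have := q34 Z X Y W.
have := q34 Z W Y X; have := q12 W Y X Z; have := q34 W Y Z X; have := q34 W X Z Y.
lra.
Qed.

Let qD2 X Y Y' Z W : q X (Y + Y') Z W = q X Y Z W + q X Y' Z W.
Proof. by rewrite q12 qD1 opprD -!q12. Qed.
Let qD3 X Y Z Z' W : q X Y (Z + Z') W = q X Y Z W + q X Y Z' W.
Proof. by rewrite curvature_pair_sym qD1 -!(curvature_pair_sym X Y). Qed.
Let qD4 X Y Z W W' : q X Y Z (W + W') = q X Y Z W + q X Y Z W'.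
Proof. by rewrite curvature_pair_sym qD2 -!(curvature_pair_sym X Y). Qed.

Let qN1 X Y Z W : q (- X) Y Z W = - q X Y Z W.
Proof.
have q0 : q 0 Y Z W = 0 by have := qD1 0 0 Y Z W; rewrite addr0; lra.
by have := qD1 X (- X) Y Z W; rewrite subrr q0; lra.
Qed.
Let qN2 X Y Z W : q X (- Y) Z W = - q X Y Z W.
Proof. by rewrite q12 qN1 -q12. Qed.
Let qN3 X Y Z W : q X Y (- Z) W = - q X Y Z W.
Proof. by rewrite curvature_pair_sym qN1 -(curvature_pair_sym X Y). Qed.
Let qN4 X Y Z W : q X Y Z (- W) = - q X Y Z W.
Proof. by rewrite curvature_pair_sym qN2 -(curvature_pair_sym X Y). Qed.

Let qJ12 X Y Z W : q (J X) (J Y) Z W = q X Y Z W.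
Proof. by rewrite curvature_pair_sym qJ -curvature_pair_sym. Qed.

(** The term of bidegree (2, 2) of the quartic form q (X, JX, X, JX) gives
   q (X, JX, Y, JY) + 2 q (X, JY, X, JY) = 0; the Bianchi identity turns this
   into 3 sec (X, JY) + sec (X, Y) = 0, and exchanging Y with JY kills sec. *)
Lemma kahler_curvature_polarization :
  (forall X, q X (J X) X (J X) = 0) -> forall X Y Z W, q X Y Z W = 0.
Proof.
move=> hol.
have JN X : J (- X) = - J X.
  have J00 : J 0 = 0 by apply: (@addrI _ (J 0)); rewrite -JD !addr0.
  by apply/eqP; rewrite -addr_eq0 -JD addNr J00.
have mixed X Y : q X (J X) Y (J Y) + 2 * q X (J Y) X (J Y) = 0.
  have := hol (X + Y); have := hol (X - Y); have := hol X; have := hol Y.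
  rewrite !JD JN !(qD1, qD2, qD3, qD4) !(qN1, qN2, qN3, qN4).
  have e1 : q Y (J X) Y (J X) = q X (J Y) X (J Y).
    by rewrite -qJ12 -qJ JJ !(qN2, qN4) q12 q34 !opprK.
  have e2 : q Y (J X) X (J Y) = q X (J Y) X (J Y).
    by rewrite -qJ12 JJ qN2 q12 opprK.
  have e3 : q X (J Y) Y (J X) = q X (J Y) X (J Y) by rewrite curvature_pair_sym e2.
  have e4 : q Y (J Y) X (J X) = q X (J X) Y (J Y) by rewrite curvature_pair_sym.
  rewrite e1 e2 e3 e4; lra.
have sec3 X Y : 3 * q X (J Y) X (J Y) + q X Y X Y = 0.
  have := mixed X Y; have := qB X (J X) Y (J Y).
  have e1 : q (J X) Y X (J Y) = - q X (J Y) X (J Y).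
    by rewrite -qJ12 JJ qN1.
  have e2 : q Y X (J X) (J Y) = - q X Y X Y by rewrite qJ q12.
  rewrite e1 e2; lra.
have sec X Y : q X Y X Y = 0.
  have := sec3 X Y; have := sec3 X (J Y); rewrite JJ !(qN2, qN4) opprK; lra.
have sec' X Y Z : q X Y Z Y = 0.
  have := sec (X + Z) Y; rewrite !(qD1, qD3) !sec (curvature_pair_sym Z Y X Y); lra.
have alt X Y Z W : q X Y Z W = - q X W Z Y.
  have := sec' X (Y + W) Z; rewrite !(qD2, qD4) !sec'; lra.
move=> X Y Z W.
have := qB X Y Z W; have := alt X Y Z W; have := alt Y Z X W.
have := q12 X Z Y W; have := q34 X W Y Z; have := curvature_pair_sym X W Y Z.
have := curvature_pair_sym Y Z X W; have := q12 Y W X Z; have := alt X Z Y W.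
have := q34 X Y Z W; have := curvature_pair_sym Y W X Z; have := q34 X Z Y W.
have := q12 Z X Y W; have := q34 X W Z Y.
lra.
Qed.

End KahlerCurvatureTensor.

(** * The hermitian space H_0 *)

Section HermitianSpace.
Variables (R : realType) (n : nat).
Local Notation H := 'cV[R]_(n + n).
Local Notation J := (J0 R n).
Local Notation h := (@h0 R n).
Local Notation om := (@omega0 R n).
Implicit Types (X Y Z W : H) (a b : R).

Lemma h0E X Y : h X Y = (X^T *m Y) 0 0.
Proof. by rewrite mxE; apply: eq_bigr => i _; rewrite mxE. Qed.

Lemma h0C X Y : h X Y = h Y X.
Proof. by apply: eq_bigr => i _; rewrite mulrC. Qed.

Lemma h0Dl X Y Z : h (X + Y) Z = h X Z + h Y Z.
Proof. by rewrite -big_split; apply: eq_bigr => i _; rewrite mxE mulrDl. Qed.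

Lemma h0Zl a X Y : h (a *: X) Y = a * h X Y.
Proof. by rewrite mulr_sumr; apply: eq_bigr => i _; rewrite mxE mulrA. Qed.

Lemma h0Nl X Y : h (- X) Y = - h X Y.
Proof. by rewrite -scaleN1r h0Zl mulN1r. Qed.

Lemma h0Bl X Y Z : h (X - Y) Z = h X Z - h Y Z.
Proof. by rewrite h0Dl h0Nl. Qed.

Lemma h0Dr X Y Z : h Z (X + Y) = h Z X + h Z Y.
Proof. by rewrite !(h0C Z) h0Dl. Qed.

Lemma h0Zr a X Y : h Y (a *: X) = a * h Y X.
Proof. by rewrite !(h0C Y) h0Zl. Qed.

Lemma h0Nr X Y : h Y (- X) = - h Y X.
Proof. by rewrite !(h0C Y) h0Nl. Qed.

Lemma h0Br X Y Z : h Z (X - Y) = h Z X - h Z Y.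
Proof. by rewrite h0Dr h0Nr. Qed.

Lemma h00l X : h 0 X = 0.
Proof. by rewrite -(scale0r 0) h0Zl mul0r. Qed.

Lemma h00r X : h X 0 = 0.
Proof. by rewrite h0C h00l. Qed.

Lemma h0_ge0 X : 0 <= h X X.
Proof. by apply: sumr_ge0 => i _; rewrite -expr2 sqr_ge0. Qed.

Lemma h0_eq0 X : h X X = 0 -> X = 0.
Proof.
move=> /eqP; rewrite psumr_eq0 => [/allP X0|i _]; last by rewrite -expr2 sqr_ge0.
apply/colP => i; rewrite mxE; have := X0 i (mem_index_enum _).
by rewrite -expr2 sqrf_eq0 => /eqP.
Qed.

Lemma h0_inj X Y : (forall Z, h X Z = h Y Z) -> X = Y.
Proof.
by move=> XY; apply/eqP; rewrite -subr_eq0; apply/eqP/h0_eq0; rewrite h0Bl XY subrr.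
Qed.

Lemma h0_trmx (A : 'M[R]_(n + n)) X Y : h (A *m X) Y = h X (A^T *m Y).
Proof. by rewrite !h0E trmx_mul mulmxA. Qed.

Lemma h0_delta (A : 'M[R]_(n + n)) i j : h (delta_mx i 0) (A *m delta_mx j 0) = A i j.
Proof.
rewrite -colE /h0 (bigD1 i) //= !mxE !eqxx mul1r big1 ?addr0// => k ki.
by rewrite mxE (negPf ki) mul0r.
Qed.

Lemma J0J0 : J *m J = - 1%:M.
Proof.
rewrite mulmx_block !mul0mx !mulmx0 !mul1mx !mulmx1 !add0r !addr0.
by rewrite (scalar_mx_block n n (1 : R)) opp_block_mx !oppr0.
Qed.

Lemma tr_J0 : J^T = - J.
Proof.
by rewrite tr_block_mx opp_block_mx linearN /= !trmx0 !trmx1 opprK oppr0.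
Qed.

Lemma J0K X : J *m (J *m X) = - X.
Proof. by rewrite mulmxA J0J0 mulNmx mul1mx. Qed.

Lemma h0Jl X Y : h (J *m X) Y = - h X (J *m Y).
Proof. by rewrite h0_trmx tr_J0 mulNmx h0Nr. Qed.

Lemma h0JJ X Y : h (J *m X) (J *m Y) = h X Y.
Proof. by rewrite h0Jl J0K h0Nr opprK. Qed.

Lemma omega0E X Y : om X Y = h (J *m X) Y. Proof. by []. Qed.

Lemma omega0Dl X Y Z : om (X + Y) Z = om X Z + om Y Z.
Proof. by rewrite /omega0 mulmxDr h0Dl. Qed.

Lemma omega0Zl a X Y : om (a *: X) Y = a * om X Y.
Proof. by rewrite /omega0 -scalemxAr h0Zl. Qed.

Lemma omega0Nl X Y : om (- X) Y = - om X Y.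
Proof. by rewrite /omega0 mulmxN h0Nl. Qed.

Lemma omega0Dr X Y Z : om X (Y + Z) = om X Y + om X Z.
Proof. exact: h0Dr. Qed.

Lemma omega0Zr a X Y : om X (a *: Y) = a * om X Y.
Proof. exact: h0Zr. Qed.

Lemma omega0C X Y : om Y X = - om X Y.
Proof. by rewrite /omega0 h0Jl h0C. Qed.

Lemma h0XJX X : h X (J *m X) = 0.
Proof. by have := h0Jl X X; rewrite h0C; lra. Qed.

Lemma omega0XX X : om X X = 0.
Proof. by rewrite /omega0 h0C h0XJX. Qed.

(** Vectors of equal length are exchanged by the complex quasi-reflection
   w |-> w - <w, v> / <X, v> v with v = X - Y, for the hermitian product <,>;
   it is unitary because |v|^2 = 2 Re <X, v> when |X| = |Y|. *)
Lemma unitary_transitive X Y : h X X = h Y Y ->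
  exists2 A, @Un R n A & A *m X = Y.
Proof.
move=> XY; have [->|nXY] := eqVneq X Y.
  by exists 1%:M; rewrite ?mul1mx//; split; rewrite ?trmx1 ?mul1mx ?mulmx1.
have [v vXY] : exists v, v = X - Y by exists (X - Y).
pose dr := h X v; pose di := h (J *m X) v.
have vv : h v v = 2 * dr.
  by rewrite /dr vXY !h0Br !h0Bl -XY (h0C Y X); lra.
have v0 : h v v != 0.
  by apply: contraNneq nXY => /h0_eq0 /eqP; rewrite vXY subr_eq0.
pose N := dr ^+ 2 + di ^+ 2.
have dr0 : dr != 0 by apply: contra_neq v0 => E; rewrite vv E mulr0.
have N0 : N != 0.
  by rewrite gt_eqF// ltr_wpDr ?sqr_ge0// lt0r sqrf_eq0 dr0 sqr_ge0.
pose A : 'M[R]_(n + n) := 1%:M - N^-1 *: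
  (v *m (dr *: v^T + di *: (v^T *m J)) + J *m v *m (di *: v^T - dr *: (v^T *m J))).
have AE W : A *m W = W - N^-1 *: ((h W v * dr + h (J *m W) v * di) *: v +
                       (h W v * di - h (J *m W) v * dr) *: (J *m v)).
  have vE Z : v^T *m Z = (h Z v)%:M.
    by apply/matrixP => i j; rewrite !ord1 !mxE eqxx mulr1n h0C h0E !mxE.
  have e1 : (dr *: v^T + di *: (v^T *m J)) *m W =
      (h W v * dr + h (J *m W) v * di)%:M.
    rewrite mulmxDl -!scalemxAl -mulmxA !vE !scale_scalar_mx -raddfD /=.
    by rewrite [dr * _]mulrC [di * _]mulrC.
  have e2 : (di *: v^T - dr *: (v^T *m J)) *m W =
      (h W v * di - h (J *m W) v * dr)%:M.
    rewrite mulmxBl -!scalemxAl -mulmxA !vE !scale_scalar_mx -raddfB /=.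
    by rewrite [dr * _]mulrC [di * _]mulrC.
  by rewrite mulmxBl mul1mx -scalemxAl mulmxDl -!(mulmxA _ _ W) e1 e2 !mul_mx_scalar.
exists A; last first.
  rewrite AE -!/dr -!/di [di * dr]mulrC subrr scale0r addr0 scalerA.
  by rewrite -!expr2 mulVf // scale1r vXY opprB addrC subrK.
split; last first.
  apply/matrixP => i j; suff E W : A *m J *m W = J *m A *m W.
    by have := congr1 (fun B : H => B i 0) (E (delta_mx j 0)); rewrite -!colE !mxE.
  rewrite -!mulmxA !AE mulmxBr -scalemxAr mulmxDr -!scalemxAr !J0K h0Nl.
  congr (_ - _ *: _); rewrite addrC; congr (_ + _).
    by congr (_ *: _); ring.
  by rewrite scalerN -scaleNr; congr (_ *: _); ring.
have iso W W' : h (A *m W) (A *m W') = h W W'.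
  rewrite !AE !(h0Dl, h0Nl, h0Zl) !(h0Dr, h0Nr, h0Zr) h0JJ (h0C (J *m v) v).
  rewrite h0XJX (h0C v W') (h0C (J *m v) W') vv.
  have e Z : h Z (J *m v) = - h (J *m Z) v by rewrite h0Jl opprK.
  rewrite !e; move: N0; rewrite /N.
  by move=> ab; field.
apply/matrixP => i j.
by rewrite -!h0_delta -mulmxA -h0_trmx iso mul1mx.
Qed.

End HermitianSpace.

(** * Unitary invariant curvature tensors *)

Section ConstantHolomorphicCurvature.
Variables (R : realType) (n : nat).
Local Notation H := 'cV[R]_(n + n).
Local Notation J := (J0 R n).
Local Notation h := (@h0 R n).
Local Notation om := (@omega0 R n).
Implicit Types (X Y Z W : H) (A : 'M[R]_(n + n)).

Lemma h0_K X Y Z W : h (K X Y Z) W = 4^-1 *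
  (h Y Z * h X W - h X Z * h Y W + om Y Z * om X W - om X Z * om Y W
   - 2 * om X Y * om Z W).
Proof. by rewrite /K h0Zl !h0Dl !h0Nl !h0Zl. Qed.

Lemma omega0J X Y : om X (J *m Y) = h X Y.
Proof. by rewrite /omega0 h0JJ. Qed.

Lemma omega0Jl X Y : om (J *m X) Y = - h X Y.
Proof. by rewrite /omega0 J0K h0Nl. Qed.

Lemma h0Jr X Y : h X (J *m Y) = - om X Y.
Proof. by rewrite /omega0 h0Jl opprK. Qed.

Lemma K_kahler : kahler_curvature_tensor (mulmx J) (fun X Y Z W => h (K X Y Z) W).
Proof.
split; [split|..].
- by move=> X X' Y Z W; rewrite !h0_K !(h0Dl, omega0Dl); ring.
- by move=> X Y Z W; rewrite !h0_K (omega0C X Y); ring.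
- by move=> X Y Z W; rewrite !h0_K (omega0C Z W); ring.
- move=> X Y Z W; rewrite !h0_K (h0C Y X) (h0C Z X) (h0C Z Y).
  by rewrite (omega0C X Y) (omega0C X Z) (omega0C Y Z); ring.
- move=> X Y Z W; rewrite !h0_K !omega0J !h0Jr -(omega0E Z W); ring.
Qed.

(** K is, up to a factor, the only U(n)-equivariant Kaehler curvature tensor: the quartic form
   q (X, JX, X, JX) is U(n)-invariant, hence a multiple of |X|^4. *)
Lemma unitary_kahler_curvature (Q : H -> H -> 'M[R]_(n + n)) : (1 <= n)%N ->
  kahler_curvature_tensor (mulmx J) (fun X Y Z W => h (Q X Y *m Z) W) ->
  (forall a X Y, Q (a *: X) Y = a *: Q X Y) ->
  (forall A X Y Z, @Un R n A -> Q (A *m X) (A *m Y) *m (A *m Z) = A *m (Q X Y *m Z)) ->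
  exists k, forall X Y Z, Q X Y *m Z = k *: K X Y Z.
Proof.
move=> n1 qK QZ Qeq; have [[_ q12 _] _ _] := qK.
have lt0 : (0 < n + n)%N by rewrite addn_gt0 n1.
pose X0 : H := delta_mx (Ordinal lt0) 0.
pose hol X := h (Q X (J *m X) *m X) (J *m X).
have X01 : h X0 X0 = 1.
  by rewrite -[X in h _ X]mul1mx h0_delta mxE eqxx.
have QZr a X Y Z W : h (Q X (a *: Y) *m Z) W = a * h (Q X Y *m Z) W.
  by rewrite -[LHS]opprK -q12 QZ -scalemxAl h0Zl q12 mulrN opprK.
have holZ a X : hol (a *: X) = a ^+ 4 * hol X.
  rewrite /hol -!scalemxAr !h0Zl h0Zr QZr QZ -scalemxAl h0Zl; ring.
have holE X : hol X = h X X ^+ 2 * hol X0.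
  have [|A UA AX] := @unitary_transitive R n X (Num.sqrt (h X X) *: X0).
    by rewrite h0Zl h0Zr X01 mulr1 -expr2 sqr_sqrtr // h0_ge0.
  have AA Z W : h (A *m Z) (A *m W) = h Z W.
    by have [AtA _] := UA; rewrite h0_trmx mulmxA AtA mul1mx.
  have AJ Z : A *m (J *m Z) = J *m (A *m Z).
    by have [_ AJ] := UA; rewrite !mulmxA AJ.
  rewrite /hol -AA -Qeq // !AJ -/(hol (A *m X)) AX holZ.
  by rewrite -[4%N]/(2 * 2)%N exprM sqr_sqrtr // h0_ge0.
(* the holomorphic sectional quartic form of K is - |X|^4 *)
exists (- hol X0) => X Y Z; apply: h0_inj => W; rewrite h0Zl.
have [[qD _ q34] qB qJ] := qK; have [[kD k12 k34] kB kJ] := K_kahler.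
pose D X Y Z W := h (Q X Y *m Z) W + hol X0 * h (K X Y Z) W.
suff D0 : D X Y Z W = 0 by have := D0; rewrite /D; lra.
apply: (@kahler_curvature_polarization R H (mulmx J) D).
- by move=> ?; rewrite J0K.
- by move=> ? ?; rewrite mulmxDr.
- split; [split|..].
  + by move=> *; rewrite /D qD kD; ring.
  + by move=> *; rewrite /D q12 k12; ring.
  + by move=> *; rewrite /D q34 k34; ring.
  + move=> a b c e; have := qB a b c e; have := kB a b c e; rewrite /D => k0 q0.
    transitivity (0 + hol X0 * 0); last by ring.
    by rewrite -{1}q0 -k0; ring.
  + by move=> *; rewrite /D qJ kJ.
- move=> V; rewrite /D -/(hol V) holE h0_K !omega0J omega0Jl h0JJ (h0C (J *m V) V).
  by rewrite h0XJX; field.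
Qed.

End ConstantHolomorphicCurvature.

(** * Vector fields and brackets on a manifold *)

Section ManifoldCalculus.
Variables (R : realType) (d : nat) (M : manifold R d).
Local Notation vfield := (M -> 'cV[R]_d).
Local Notation O a W := (chart a @` (chart_dom a `&` W)).
Implicit Types (W : set M) (x y a b : M) (u v : 'cV[R]_d) (X Y Z : vfield).

Lemma chart_imageP a W z : O a W z ->
  [/\ chart_dom a (chart_inv a z), W (chart_inv a z) & chart a (chart_inv a z) = z].
Proof. by case=> x [ax Wx] <-; rewrite chartK. Qed.

Lemma chart_imageI a W y : chart_dom a y -> W y -> O a W (chart a y).
Proof. by move=> ay Wy; exists y. Qed.

Lemma chart_image_sub a W W' : W `<=` W' -> O a W `<=` O a W'.
Proof. by move=> sW; apply: image_subset => y [ay /sW]. Qed.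

Lemma open_chart_image a W : open W -> open (O a W).
Proof.
move=> oW; rewrite openE => z [x [ax Wx] xz]; rewrite /interior.
have az : (chart a @` chart_dom a) z by exists x.
have n1 : nbhs z (chart a @` chart_dom a).
  by apply: open_nbhs_nbhs; split=> //; exact: chart_image_open.
have n2 : nbhs z (chart_inv a @^-1` W).
  apply: (chart_inv_continuous az); rewrite -xz chartK //.
  exact: open_nbhs_nbhs.
apply: filterS2 n1 n2 => _ [y ay <-] /=; rewrite chartK // => Wy.
by exists y.
Qed.

Lemma transition_Cinfty a b : Cinfty (O a (chart_dom b)) (chart b \o chart_inv a).
Proof. exact: transition_smooth. Qed.

Lemma transition_differentiable a b y : chart_dom a y -> chart_dom b y ->
  differentiable (chart b \o chart_inv a) (chart a y).
Proof.
move=> ay yb; have := @transition_Cinfty a b 1%N.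
by move=> /Ck_differentiable; apply; exact: chart_imageI.
Qed.

(** Change of charts: z |-> f(z) in the chart b is its expression in the chart a
   after a transition map. *)
Lemma chain_chart (E : normedModType R) (f : M -> E) a b y :
  chart_dom a y -> chart_dom b y -> differentiable (f \o chart_inv a) (chart a y) ->
  differentiable (f \o chart_inv b) (chart b y) /\
  forall u, 'd (f \o chart_inv b) (chart b y) u =
    'd (f \o chart_inv a) (chart a y) ('d (chart a \o chart_inv b) (chart b y) u).
Proof.
move=> ay yb df.
have dt := transition_differentiable yb ay.
have e : (chart a \o chart_inv b) (chart b y) = chart a y by rewrite /= chartK.
have df' := df; rewrite -e in df'.
have dc := differentiable_comp dt df'.
have oO : open (O b (chart_dom a)) by apply: open_chart_image; exact: chart_dom_open.
have nE : {near chart b y, (f \o chart_inv a) \o (chart a \o chart_inv b) =1 f \o chart_inv b}.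
  apply: (open_eq_near oO) => [|_ [x [bx ax] <-]]; first exact: chart_imageI.
  by rewrite /= chartK // chartK.
split=> [|u]; first exact: near_eq_differentiable nE dc.
have /(congr1 (@^~ u)) E1 := near_eq_diff nE dc.
have /(congr1 (@^~ u)) E2 := diff_comp dt df'.
by apply: (etrans (esym E1)); rewrite e in E2.
Qed.

Lemma diff_chart_id a y v : chart_dom a y -> 'd (chart a \o chart_inv a) (chart a y) v = v.
Proof.
move=> ay; have di : is_diff (chart a y) id id := is_diff_id (chart a y).
have oO : open (chart a @` chart_dom a) by exact: chart_image_open.
have nE : {near chart a y, id =1 chart a \o chart_inv a}.
  by apply: (open_eq_near oO) => [|_ [x ax <-]]; [exists y|rewrite /= chartK].
by rewrite -(near_eq_diff nE) ?(@diff_val _ _ _ _ _ _ _ di).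
Qed.

Lemma transitionK a b y v : chart_dom a y -> chart_dom b y ->
  'd (chart b \o chart_inv a) (chart a y) ('d (chart a \o chart_inv b) (chart b y) v) = v.
Proof.
move=> ay yb; have [_ <-] := chain_chart ay yb (transition_differentiable ay yb).
exact: diff_chart_id.
Qed.

Lemma local_rep_center X y : local_rep y X (chart y y) = X y.
Proof.
rewrite /local_rep chartK; last exact: chart_dom_center.
by rewrite /dchart diff_chart_id //; exact: chart_dom_center.
Qed.

Lemma smooth_fun_sub W W' f : W' `<=` W -> smooth_fun W f -> smooth_fun W' (f : M -> R).
Proof. by move=> sW sf a k; apply: Ck_sub (sf a k); exact: chart_image_sub. Qed.

Lemma smooth_fun_ext W (f g : M -> R) : open W -> (forall y, W y -> f y = g y) ->
  smooth_fun W f -> smooth_fun W g.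
Proof.
move=> oW fg sf a k; apply: Ck_ext (sf a k); first exact: open_chart_image.
by move=> z /chart_imageP[_ /fg].
Qed.

Lemma smooth_fun_cst W c : smooth_fun W (fun=> c : R).
Proof. by move=> a k; apply: Ck_cst. Qed.

Lemma smooth_funD W f g : open W -> smooth_fun W f -> smooth_fun W g ->
  smooth_fun W (fun y => f y + g y : R).
Proof. by move=> oW sf sg a k; apply: CkD (sf a k) (sg a k); exact: open_chart_image. Qed.

Lemma smooth_funM W f g : open W -> smooth_fun W f -> smooth_fun W g ->
  smooth_fun W (fun y => f y * g y : R).
Proof. by move=> oW sf sg a k; apply: CkM (sf a k) (sg a k); exact: open_chart_image. Qed.

Lemma smooth_fun_sum W (I : Type) (r : seq I) (F : I -> M -> R) : open W ->
  (forall i, smooth_fun W (F i)) -> smooth_fun W (fun y => \sum_(i <- r) F i y).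
Proof.
move=> oW sF; elim: r => [|i r IH].
  by under eq_fun do rewrite big_nil; exact: smooth_fun_cst.
by under eq_fun do rewrite big_cons; apply: smooth_funD.
Qed.

Lemma smooth_chart_coord x i : smooth_fun (chart_dom x) (fun y => chart x y i 0).
Proof.
move=> a k; have oO : open (O a (chart_dom x)).
  by apply: open_chart_image; exact: chart_dom_open.
by have /(Ck_mxP k _ oO) := @transition_Cinfty a x k; exact.
Qed.

Lemma smooth_field_sub W W' X : W' `<=` W -> smooth_field W X -> smooth_field W' X.
Proof. by move=> sW sX a k; apply: Ck_sub (sX a k); exact: chart_image_sub. Qed.

Lemma smooth_field_ext W X Y : open W -> (forall y, W y -> X y = Y y) ->
  smooth_field W X -> smooth_field W Y.
Proof.
move=> oW XY sX a k; apply: Ck_ext (sX a k); first exact: open_chart_image.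
by move=> z /chart_imageP[_ /XY E _]; rewrite /local_rep E.
Qed.

Lemma smooth_fieldD W X Y : open W -> smooth_field W X -> smooth_field W Y ->
  smooth_field W (fun y => X y + Y y).
Proof.
move=> oW sX sY a k; have oO := open_chart_image (a := a) oW.
apply: Ck_ext (CkD oO (sX a k) (sY a k)) => // z _.
by rewrite /local_rep /dchart linearD.
Qed.

Lemma smooth_fieldZ W f X : open W -> smooth_fun W f -> smooth_field W X ->
  smooth_field W (fun y => f y *: X y).
Proof.
move=> oW sf sX a k; have oO := open_chart_image (a := a) oW.
apply: Ck_ext (CkZ oO (sf a k) (sX a k)) => // z _.
by rewrite /local_rep /dchart linearZ.
Qed.

Lemma smooth_field_sum W (I : Type) (r : seq I) (F : I -> vfield) : open W ->
  (forall i, smooth_field W (F i)) -> smooth_field W (fun y => \sum_(i <- r) F i y).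
Proof.
move=> oW sF; elim: r => [|i r IH].
  under eq_fun do rewrite big_nil; move=> a k.
  have oO := open_chart_image (a := a) oW.
  apply: Ck_ext (Ck_cst k _ 0) => // z _.
  by rewrite /local_rep /dchart linear0.
by under eq_fun do rewrite big_cons; apply: smooth_fieldD.
Qed.

(** The vector field X as a derivation; its action separates fields, which reduces
   identities between brackets to identities between derivations. *)
Definition along X (f : M -> R) : M -> R := fun y => dirderiv y (X y) f.

Implicit Types f g : M -> R.

Lemma smooth_fun_differentiable W f a y : open W -> smooth_fun W f ->
  chart_dom a y -> W y -> differentiable (f \o chart_inv a : _ -> R^o) (chart a y).
Proof.
by move=> oW sf ay Wy; apply: (Ck_differentiable (sf a 1%N)); exact: chart_imageI.
Qed.

Lemma dirderivE W f a y u : open W -> smooth_fun W f -> W y -> chart_dom a y ->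
  dirderiv y u f = 'd (f \o chart_inv a : _ -> R^o) (chart a y) (dchart a y u).
Proof.
move=> oW sf Wy ay.
have df := smooth_fun_differentiable oW sf ay Wy.
exact: (@chain_chart R^o f a y y ay (chart_dom_center y) df).2.
Qed.

Lemma dirderiv_ext W f g y u : open W -> W y -> (forall x, W x -> f x = g x) ->
  smooth_fun W f -> dirderiv y u f = dirderiv y u g.
Proof.
move=> oW Wy fg sf.
have oO : open (O y W) by exact: open_chart_image.
have dy := chart_dom_center y.
have nE : {near chart y y, (f \o chart_inv y : _ -> R^o) =1 g \o chart_inv y}.
  apply: (open_eq_near oO) => [|z /chart_imageP[_ /fg]//]; exact: chart_imageI.
exact: (congr1 (@^~ u) (near_eq_diff nE (smooth_fun_differentiable oW sf dy Wy))).
Qed.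

Lemma dirderivD W f g y u : open W -> W y -> smooth_fun W f -> smooth_fun W g ->
  dirderiv y u (fun x => f x + g x) = dirderiv y u f + dirderiv y u g.
Proof.
move=> oW Wy sf sg; have dy := chart_dom_center y.
have df := smooth_fun_differentiable oW sf dy Wy.
have dg := smooth_fun_differentiable oW sg dy Wy.
exact: (congr1 (@^~ u) (diffD df dg)).
Qed.

Lemma dirderivM W f g y u : open W -> W y -> smooth_fun W f -> smooth_fun W g ->
  dirderiv y u (fun x => f x * g x) = dirderiv y u f * g y + f y * dirderiv y u g.
Proof.
move=> oW Wy sf sg; have dy := chart_dom_center y.
have df := smooth_fun_differentiable oW sf dy Wy.
have dg := smooth_fun_differentiable oW sg dy Wy.
rewrite addrC [dirderiv y u f * _]mulrC.
by apply: (etrans (diffM_o u df dg)); rewrite /= chartK.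
Qed.

Lemma dirderiv_cst (c : R) y u : dirderiv y u (fun=> c) = 0.
Proof. by rewrite /dirderiv (_ : _ \o _ = cst c) // diff_cst. Qed.

Lemma dirderiv_sum W (I : Type) (r : seq I) (F : I -> M -> R) y u :
  open W -> W y -> (forall i, smooth_fun W (F i)) ->
  dirderiv y u (fun x => \sum_(i <- r) F i x) = \sum_(i <- r) dirderiv y u (F i).
Proof.
move=> oW Wy sF; elim: r => [|i r IH].
  by under eq_fun do rewrite big_nil; rewrite big_nil dirderiv_cst.
under eq_fun do rewrite big_cons; rewrite big_cons -IH.
by rewrite (dirderivD _ oW Wy (sF i)) //; exact: smooth_fun_sum.
Qed.

Lemma dirderivZ W (c : R) f y u : open W -> W y -> smooth_fun W f ->
  dirderiv y u (fun x => c * f x) = c * dirderiv y u f.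
Proof.
move=> oW Wy sf; rewrite (dirderivM u oW Wy (smooth_fun_cst W c) sf).
by rewrite dirderiv_cst mul0r add0r.
Qed.

(** The derivative of f along X can be computed in any chart, not only in the
   preferred chart at the point. *)
Lemma along_rep W X f a z : open W -> smooth_fun W f -> O a W z ->
  (along X f \o chart_inv a) z =
  'd (f \o chart_inv a : _ -> R^o) z (local_rep a X z).
Proof.
move=> oW sf /chart_imageP[ay Wy zE]; rewrite /along /=.
by rewrite (dirderivE _ oW sf Wy ay) zE.
Qed.

Lemma along_smooth W X f : open W -> smooth_field W X -> smooth_fun W f ->
  smooth_fun W (along X f).
Proof.
move=> oW sX sf a k; have oO := open_chart_image (a := a) oW.
apply: Ck_ext (Ck_dapp oO (sf a k.+1) (sX a k)) => // z Oz.
by rewrite (along_rep X oW sf Oz).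
Qed.

Lemma smooth_field_differentiable W X a z : open W -> smooth_field W X ->
  O a W z -> differentiable (local_rep a X) z.
Proof. by move=> oW sX; exact: (Ck_differentiable (sX a 1%N)). Qed.

(** The formula for the Lie bracket, in an arbitrary chart. *)
Definition bracket_rep a X Y z :=
  'd (local_rep a Y) z (local_rep a X z) - 'd (local_rep a X) z (local_rep a Y z).

(** The second derivatives of f cancel by symmetry. *)
Lemma bracket_repE W X Y f a z : open W -> smooth_field W X -> smooth_field W Y ->
  smooth_fun W f -> O a W z ->
  'd (f \o chart_inv a : _ -> R^o) z (bracket_rep a X Y z) =
  along X (along Y f) (chart_inv a z) - along Y (along X f) (chart_inv a z).
Proof.
move=> oW sX sY sf Oz; have oO := open_chart_image (a := a) oW.
pose F := f \o chart_inv a : _ -> R^o.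
have ddF v (y : 'cV[R]_d) : O a W y -> differentiable (fun p => 'd F p v : R^o) y.
  exact: (Ck_differentiable (Ck_diff v (sf a 2%N))).
have second Z Z' : smooth_field W Z -> smooth_field W Z' ->
    along Z' (along Z f) (chart_inv a z) =
    'd (fun p => 'd F p (local_rep a Z z) : R^o) z (local_rep a Z' z) +
    'd F z ('d (local_rep a Z) z (local_rep a Z' z)).
  move=> sZ sZ'; apply: (etrans (along_rep Z' oW (along_smooth oW sZ sf) Oz)).
  have dZ := smooth_field_differentiable oW sZ Oz.
  have [dF <-] := is_diff_dapp dZ (fun v => ddF v z Oz).
  have nE : {near z, (fun p => 'd F p (local_rep a Z p) : R^o) =1 along Z f \o chart_inv a}.
    by apply: (open_eq_near oO Oz) => y Oy; rewrite (along_rep Z oW sf Oy).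
  by have /(congr1 (@^~ (local_rep a Z' z))) := near_eq_diff nE dF => ->.
have sym : 'd (fun p => 'd F p (local_rep a Y z) : R^o) z (local_rep a X z) =
    'd (fun p => 'd F p (local_rep a X z) : R^o) z (local_rep a Y z).
  apply: (schwarz _ _ oO Oz) => [y Oy|//|w w'].
    exact: (Ck_differentiable (sf a 1%N)).
  exact: (Ck_diff w' (Ck_diff w (sf a 2%N))).
apply: (etrans (linearB ('d F z) _ _)).
rewrite (second Y X sY sX) (second X Y sX sY) opprD addrACA.
have alg (p q r : R) : p = q -> r = p - q + r by move=> ->; rewrite subrr add0r.
exact: alg sym.
Qed.

Lemma lie_bracketE X Y y : lie_bracket X Y y = bracket_rep y X Y (chart y y).
Proof. by rewrite /bracket_rep !local_rep_center. Qed.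

Lemma dirderiv_bracket W X Y f y : open W -> smooth_field W X -> smooth_field W Y ->
  smooth_fun W f -> W y ->
  dirderiv y (lie_bracket X Y y) f = along X (along Y f) y - along Y (along X f) y.
Proof.
move=> oW sX sY sf Wy; have dy := chart_dom_center y.
rewrite lie_bracketE /dirderiv (bracket_repE oW sX sY sf); last exact: chart_imageI.
by rewrite chartK.
Qed.

(** The coordinate functions of a chart recover the components of a tangent vector;
   they are the test functions that separate vectors. *)
Lemma diff_chart_coord a y v i : chart_dom a y ->
  'd ((fun x => chart a x i 0) \o chart_inv a : _ -> R^o) (chart a y) v = v i 0.
Proof.
move=> ay; rewrite -[in RHS](diff_chart_id v ay).
exact: (diff_mx v i 0 (transition_differentiable ay ay)).
Qed.

(** The bracket does not depend on the chart in which it is computed, as its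
   derivation does not. *)
Lemma local_rep_bracket W X Y a z : open W -> smooth_field W X -> smooth_field W Y ->
  O a W z -> local_rep a (lie_bracket X Y) z = bracket_rep a X Y z.
Proof.
move=> oW sX sY Oz; have [ay Wy zE] := chart_imageP Oz.
set y := chart_inv a z in ay Wy zE.
apply/colP => i; pose f x := chart a x i 0.
pose W' := W `&` chart_dom a.
have oW' : open W' by apply: openI => //; exact: chart_dom_open.
have W'y : W' y by [].
have sX' := smooth_field_sub (@subIsetl _ W (chart_dom a)) sX.
have sY' := smooth_field_sub (@subIsetl _ W (chart_dom a)) sY.
have sf : smooth_fun W' f.
  exact: smooth_fun_sub (@subIsetr _ W (chart_dom a)) (smooth_chart_coord a i).
have Oz' : O a W' z by rewrite -zE; exact: chart_imageI.
have E1 := bracket_repE oW' sX' sY' sf Oz'.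
have E2 := dirderiv_bracket oW' sX' sY' sf W'y.
rewrite (dirderivE _ oW' sf W'y ay) (diff_chart_coord _ i ay) in E2.
rewrite -zE (diff_chart_coord _ i ay) in E1.
rewrite -[in RHS]zE E1 -[in RHS]/y zE -/y -E2.
by [].
Qed.

Lemma bracket_smooth W X Y : open W -> smooth_field W X -> smooth_field W Y ->
  smooth_field W (lie_bracket X Y).
Proof.
move=> oW sX sY a k; have oO := open_chart_image (a := a) oW.
have cb : Ck k (O a W) (bracket_rep a X Y).
  rewrite /bracket_rep; have -> : (fun z => 'd (local_rep a Y) z (local_rep a X z) -
    'd (local_rep a X) z (local_rep a Y z)) = fun z => 'd (local_rep a Y) z (local_rep a X z) +
    (-1 : R^o) *: 'd (local_rep a X) z (local_rep a Y z).
    by apply/funext => z; rewrite scaleN1r.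
  apply: (CkD oO (Ck_dapp oO (sY a k.+1) (sX a k))).
  exact: (CkZ oO (Ck_cst k _ (-1 : R^o)) (Ck_dapp oO (sX a k.+1) (sY a k))).
by apply: Ck_ext cb => // z Oz; rewrite (local_rep_bracket oW sX sY Oz).
Qed.

(** On coordinate functions the left-hand side acts as the Jacobi sum of commutators
   of derivations. *)
Lemma jacobi W X Y Z x : open W -> W x ->
  smooth_field W X -> smooth_field W Y -> smooth_field W Z ->
  lie_bracket X (lie_bracket Y Z) x + lie_bracket Y (lie_bracket Z X) x +
  lie_bracket Z (lie_bracket X Y) x = 0.
Proof.
move=> oW Wx sX sY sZ; apply/colP => i; rewrite [RHS]mxE.
have dx := chart_dom_center x; pose f y := chart x y i 0.
pose W' := W `&` chart_dom x.
have oW' : open W' by apply: openI => //; exact: chart_dom_open.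
have W'x : W' x by [].
have sub T : smooth_field W T -> smooth_field W' T.
  exact: smooth_field_sub (@subIsetl _ W (chart_dom x)).
have sf : smooth_fun W' f.
  exact: smooth_fun_sub (@subIsetr _ W (chart_dom x)) (smooth_chart_coord x i).
have bE A B C : smooth_field W' A -> smooth_field W' B -> smooth_field W' C ->
    lie_bracket A (lie_bracket B C) x i 0 =
    along A (along B (along C f)) x - along A (along C (along B f)) x -
    (along B (along C (along A f)) x - along C (along B (along A f)) x).
  move=> sA sB sC; have sBC := bracket_smooth oW' sB sC.
  rewrite -(diff_chart_coord (lie_bracket A (lie_bracket B C) x) i dx).
  rewrite -[LHS]/(dirderiv x _ f) (dirderiv_bracket oW' sA sBC sf W'x).
  congr (_ - _); last first.
    exact: (dirderiv_bracket oW' sB sC (along_smooth oW' sA sf) W'x).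
  have sm T U : smooth_field W' T -> smooth_field W' U -> smooth_fun W' (along T (along U f)).
    by move=> sT sU; do 2 apply: along_smooth => //.
  rewrite {1}/along -mulN1r -(dirderivZ (-1) _ oW' W'x (sm C B sC sB)).
  have sN : smooth_fun W' (fun y => -1 * along C (along B f) y).
    exact: (smooth_funM oW' (smooth_fun_cst W' (-1)) (sm C B sC sB)).
  rewrite -(dirderivD _ oW' W'x (sm B C sB sC) sN).
  apply: (dirderiv_ext _ oW' W'x) => [y W'y|]; last exact: along_smooth.
  by rewrite /along (dirderiv_bracket oW' sB sC sf W'y) mulN1r.
have [sX' sY' sZ'] : [/\ smooth_field W' X, smooth_field W' Y & smooth_field W' Z].
  by split; exact: sub.
have addE (A B C : 'cV[R]_d) : (A + B + C) i 0 = A i 0 + B i 0 + C i 0.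
  by rewrite !mxE.
apply: (etrans (addE _ _ _)).
rewrite (bE X Y Z sX' sY' sZ') (bE Y Z X sY' sZ' sX') (bE Z X Y sZ' sX' sY').
have alg (p1 p2 p3 p4 p5 p6 : R) : p1 - p2 - (p3 - p4) + (p3 - p5 - (p6 - p2)) +
  (p6 - p4 - (p1 - p5)) = 0 by ring.
exact: alg.
Qed.

End ManifoldCalculus.

(** * Connections and the Bianchi identities *)

Section ConnectionCalculus.
Variables (R : realType) (d : nat) (M : manifold R d) (D : connection M).
Local Notation vfield := (M -> 'cV[R]_d).
Implicit Types (W : set M) (x y : M) (u v w : 'cV[R]_d) (X Y Z : vfield).

Lemma smooth_field_nearW W x X : open W -> W x -> smooth_field W X -> smooth_field_near x X.
Proof. by move=> oW Wx sX; exists W. Qed.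

Lemma smooth_fun_nearW W x (f : M -> R) : open W -> W x -> smooth_fun W f ->
  smooth_fun_near x f.
Proof. by move=> oW Wx sf; exists W. Qed.

(** Multiplying by the indicator of W leaves both sides of the Leibniz rule
   with the same extra term. *)
Lemma nabla_local W x u Y Y' : open W -> W x -> smooth_field W Y ->
  (forall y, W y -> Y y = Y' y) -> D x u Y = D x u Y'.
Proof.
move=> oW Wx sY YY'; have sY' := smooth_field_ext oW YY' sY.
pose f y : R := if pselect (W y) then 1 else 0.
have f1 y : W y -> f y = 1 by rewrite /f; case: pselect.
have f0 y : ~ W y -> f y = 0 by rewrite /f; case: pselect.
have sf : smooth_fun W f.
  by apply: smooth_fun_ext oW _ (smooth_fun_cst W 1) => y /f1.
have fYY' : (fun y => f y *: Y y) = (fun y => f y *: Y' y).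
  apply/funext => y; have [/YY' -> //|nWy] := pselect (W y).
  by rewrite f0 // !scale0r.
have nf := smooth_fun_nearW oW Wx sf.
have := nabla_leibniz D u nf (smooth_field_nearW oW Wx sY).
rewrite fYY' (nabla_leibniz D u nf (smooth_field_nearW oW Wx sY')) f1 // !scale1r.
by rewrite (YY' _ Wx) => /addrI.
Qed.

Lemma smooth_field0 W : open W -> smooth_field W (fun=> 0 : 'cV[R]_d).
Proof.
move=> oW a k; apply: Ck_ext (open_chart_image (a := a) oW) _ (Ck_cst k _ 0) => z _.
by rewrite /local_rep /dchart linear0.
Qed.

Lemma nabla0 x u : D x u (fun=> 0) = 0.
Proof.
have s0 : smooth_field_near x (fun=> 0 : 'cV[R]_d).
  by exists setT; split=> //; [exact: openT|exact/smooth_field0/openT].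
have := nabla_add D u s0 s0; rewrite addr0 => E.
by apply: (@addrI _ (D x u (fun=> 0))); rewrite addr0 -E.
Qed.

Lemma nablaZ W x u (c : R) Y : open W -> W x -> smooth_field W Y ->
  D x u (fun y => c *: Y y) = c *: D x u Y.
Proof.
move=> oW Wx sY.
rewrite (nabla_leibniz D u (smooth_fun_nearW oW Wx (smooth_fun_cst W c))).
  by rewrite dirderiv_cst scale0r add0r.
exact: smooth_field_nearW sY.
Qed.

Lemma nablaB W x u Y Z : open W -> W x -> smooth_field W Y -> smooth_field W Z ->
  D x u (fun y => Y y - Z y) = D x u Y - D x u Z.
Proof.
move=> oW Wx sY sZ.
have sN : smooth_field W (fun y => (-1) *: Z y).
  exact: (smooth_fieldZ oW (smooth_fun_cst W (-1)) sZ).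
have -> : (fun y => Y y - Z y) = (fun y => Y y + (-1) *: Z y).
  by apply/funext => y; rewrite scaleN1r.
rewrite (nabla_add D u (smooth_field_nearW oW Wx sY) (smooth_field_nearW oW Wx sN)).
by rewrite (nablaZ _ _ oW Wx sZ) scaleN1r.
Qed.

Lemma nabla_sum W x u (I : Type) (r : seq I) (f : I -> M -> R) (E : I -> vfield) :
  open W -> W x -> (forall i, smooth_fun W (f i)) -> (forall i, smooth_field W (E i)) ->
  D x u (fun y => \sum_(i <- r) f i y *: E i y) =
  \sum_(i <- r) (dirderiv x u (f i) *: E i x + f i x *: D x u (E i)).
Proof.
move=> oW Wx sf sE; have sfE i : smooth_field W (fun y => f i y *: E i y).
  exact: smooth_fieldZ.
elim: r => [|i r IH].
  by under eq_fun do rewrite big_nil; rewrite big_nil nabla0.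
under eq_fun do rewrite big_cons; rewrite big_cons -IH.
have sS : smooth_field W (fun y => \sum_(i <- r) f i y *: E i y).
  exact: (smooth_field_sum r oW sfE).
rewrite (nabla_add D u (smooth_field_nearW oW Wx (sfE i)) (smooth_field_nearW oW Wx sS)).
congr (_ + _); exact: (nabla_leibniz D u (smooth_fun_nearW oW Wx (sf i))
  (smooth_field_nearW oW Wx (sE i))).
Qed.

Lemma nablaDl W x u v Y : open W -> W x -> smooth_field W Y ->
  D x (u + v) Y = D x u Y + D x v Y.
Proof.
move=> oW Wx sY.
have := nabla_linear D (smooth_field_nearW oW Wx sY) 1 u v.
by rewrite !scale1r.
Qed.

Lemma nabla0l W x Y : open W -> W x -> smooth_field W Y -> D x 0 Y = 0.
Proof.
move=> oW Wx sY; have := nablaDl 0 0 oW Wx sY; rewrite addr0 => E.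
by apply: (@addrI _ (D x 0 Y)); rewrite addr0 -E.
Qed.

Lemma cov_smooth W X Y : open W -> smooth_field W X -> smooth_field W Y ->
  smooth_field W (cov D X Y).
Proof. exact: nabla_smooth. Qed.

Lemma smooth_fieldB W X Y : open W -> smooth_field W X -> smooth_field W Y ->
  smooth_field W (fun y => X y - Y y).
Proof.
move=> oW sX sY.
have -> : (fun y => X y - Y y) = (fun y => X y + (-1) *: Y y).
  by apply/funext => y; rewrite scaleN1r.
exact: (smooth_fieldD oW sX (smooth_fieldZ oW (smooth_fun_cst W (-1)) sY)).
Qed.

Lemma torsion_smooth W X Y : open W -> smooth_field W X -> smooth_field W Y ->
  smooth_field W (torsion D X Y).
Proof.
move=> oW sX sY; apply: smooth_fieldB (bracket_smooth oW sX sY) => //.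
by apply: smooth_fieldB => //; apply: cov_smooth.
Qed.

Lemma curvature_smooth W X Y Z : open W ->
  smooth_field W X -> smooth_field W Y -> smooth_field W Z ->
  smooth_field W (curvature D X Y Z).
Proof.
move=> oW sX sY sZ; apply: smooth_fieldB => //.
  by apply: smooth_fieldB => //; do 2 apply: cov_smooth => //.
by apply: cov_smooth => //; apply: bracket_smooth.
Qed.

Section Bianchi.
Variables (W : set M) (x : M) (X Y Z : vfield).
Hypotheses (oW : open W) (Wx : W x).
Hypotheses (sX : smooth_field W X) (sY : smooth_field W Y) (sZ : smooth_field W Z).

(** Grouping the second covariant derivatives by their outer field leaves the
   covariant derivative of the torsion and the cyclic sum of the iterated
   brackets, which vanishes. *)
Lemma first_bianchi :
  curvature D X Y Z x + curvature D Y Z X x + curvature D Z X Y x =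
  torsion D X (lie_bracket Y Z) x + torsion D Y (lie_bracket Z X) x +
  torsion D Z (lie_bracket X Y) x +
  (cov D X (torsion D Y Z) x + cov D Y (torsion D Z X) x + cov D Z (torsion D X Y) x).
Proof.
have cT A B C : smooth_field W A -> smooth_field W B -> smooth_field W C ->
    cov D A (torsion D B C) x =
    cov D A (cov D B C) x - cov D A (cov D C B) x - cov D A (lie_bracket B C) x.
  move=> sA sB sC; have sBC := cov_smooth oW sB sC; have sCB := cov_smooth oW sC sB.
  rewrite {1}/cov (nablaB _ oW Wx (smooth_fieldB oW sBC sCB) (bracket_smooth oW sB sC)).
  by rewrite (nablaB _ oW Wx sBC sCB).
rewrite (cT X Y Z) // (cT Y Z X) // (cT Z X Y) //.
have := jacobi oW Wx sX sY sZ; rewrite /torsion /curvature.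
set j1 := lie_bracket X _ x; set j2 := lie_bracket Y _ x; set j3 := lie_bracket Z _ x.
have alg (a1 a2 a3 b1 b2 b3 c1 c2 c3 d1 d2 d3 i1 i2 i3 : 'cV[R]_d) :
    i1 + i2 + i3 = 0 ->
    a1 - b1 - c1 + (a2 - b2 - c2) + (a3 - b3 - c3) =
    d1 - c2 - i1 + (d2 - c3 - i2) + (d3 - c1 - i3) +
    (a1 - b3 - d1 + (a2 - b1 - d2) + (a3 - b2 - d3)).
  by move=> /colP i0; apply/colP => i; have := i0 i; rewrite !mxE; lra.
exact: alg.
Qed.

(** The third covariant derivatives of U and the terms along a single bracket cancel
   in pairs; what remains is the derivative of U along the Jacobi sum. *)
Lemma second_bianchi U : smooth_field W U ->
  cov D X (curvature D Y Z U) x - curvature D Y Z (cov D X U) x +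
    curvature D X (lie_bracket Y Z) U x +
  (cov D Y (curvature D Z X U) x - curvature D Z X (cov D Y U) x +
    curvature D Y (lie_bracket Z X) U x) +
  (cov D Z (curvature D X Y U) x - curvature D X Y (cov D Z U) x +
    curvature D Z (lie_bracket X Y) U x) = 0.
Proof.
move=> sU.
have cR A B C : smooth_field W A -> smooth_field W B -> smooth_field W C ->
    cov D A (curvature D B C U) x = cov D A (cov D B (cov D C U)) x -
    cov D A (cov D C (cov D B U)) x - cov D A (cov D (lie_bracket B C) U) x.
  move=> sA sB sC; have sCU := cov_smooth oW sC sU; have sBU := cov_smooth oW sB sU.
  have sBCU := cov_smooth oW sB sCU; have sCBU := cov_smooth oW sC sBU.
  have sbU := cov_smooth oW (bracket_smooth oW sB sC) sU.
  rewrite {1}/cov (nablaB _ oW Wx (smooth_fieldB oW sBCU sCBU) sbU).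
  by rewrite (nablaB _ oW Wx sBCU sCBU).
rewrite (cR X Y Z) // (cR Y Z X) // (cR Z X Y) // /curvature.
have J0 : cov D (lie_bracket X (lie_bracket Y Z)) U x +
    cov D (lie_bracket Y (lie_bracket Z X)) U x +
    cov D (lie_bracket Z (lie_bracket X Y)) U x = 0.
  by rewrite /cov -!(nablaDl _ _ oW Wx sU) (jacobi oW Wx sX sY sZ) (nabla0l oW Wx sU).
have alg (p1 p2 p3 p4 p5 p6 q1 q2 q3 r1 r2 r3 i1 i2 i3 : 'cV[R]_d) :
    i1 + i2 + i3 = 0 ->
    p1 - p2 - q1 - (p3 - p5 - r1) + (q1 - r1 - i1) +
    (p3 - p4 - q2 - (p6 - p2 - r2) + (q2 - r2 - i2)) +
    (p6 - p5 - q3 - (p1 - p4 - r3) + (q3 - r3 - i3)) = 0.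
  by move=> /colP i0; apply/colP => i; have := i0 i; rewrite !mxE; lra.
exact: alg.
Qed.

End Bianchi.
End ConnectionCalculus.

(** * Connection form and curvature in a local frame *)

Section LocalFrame.
Variables (R : realType) (d : nat) (M : manifold R d) (D : connection M).
Variables (W : set M) (s : M -> 'M[R]_d).
Hypotheses (oW : open W) (us : forall y, W y -> s y \in unitmx).
Hypothesis ss : forall w, smooth_field W (fun y => s y *m w).
Implicit Types (x y : M) (u v w : 'cV[R]_d) (X Y Z : M -> 'cV[R]_d).

Definition dirderivmx m n x u (A : M -> 'M[R]_(m, n)) : 'M[R]_(m, n) :=
  \matrix_(i, j) dirderiv x u (fun y => A y i j).

Definition frame_coef Y y : 'cV[R]_d := invmx (s y) *m Y y.

Lemma frame_coefK Y y : W y -> s y *m frame_coef Y y = Y y.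
Proof. by move=> Wy; rewrite /frame_coef mulmxA mulmxV ?us // mul1mx. Qed.

Lemma mulmx_coords (A : 'M[R]_d) v : A *m v = \sum_j v j 0 *: (A *m delta_mx j 0).
Proof. exact: (linear_coordE (mulmx A) v). Qed.

Lemma mulmx_ext (A B : 'M[R]_d) : (forall v : 'cV[R]_d, A *m v = B *m v) -> A = B.
Proof.
move=> AB; apply/matrixP => i j.
by have := congr1 (fun C : 'cV[R]_d => C i 0) (AB (delta_mx j 0)); rewrite -!colE !mxE.
Qed.

(** The coefficients are obtained by inverting the matrix that represents the frame in
   a chart, which is smooth with its inverse. *)
Lemma smooth_frame_coef Y i : smooth_field W Y -> smooth_fun W (fun y => frame_coef Y y i 0).
Proof.
move=> sY a k; have oO := open_chart_image (a := a) oW.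
pose S z : 'M[R]_d := \matrix_(i, j) local_rep a (fun y => s y *m delta_mx j 0) z i 0.
have SE z v : S z *m v = dchart a (chart_inv a z) (s (chart_inv a z) *m v).
  rewrite [in RHS]mulmx_coords /dchart linear_sum mulmx_coords.
  apply: eq_bigr => j _; rewrite linearZ /=; congr (_ *: _).
  by rewrite -colE; apply/colP => l; rewrite !mxE.
have cS : Ck k (chart a @` (chart_dom a `&` W)) S.
  apply/(Ck_mxP k _ oO) => l j; have /(Ck_mxP k _ oO)/(_ l 0) := ss (delta_mx j 0) a k.
  by apply: Ck_ext oO _ => z _; rewrite mxE.
have uS z : (chart a @` (chart_dom a `&` W)) z -> S z \in unitmx.
  move=> /chart_imageP[ay Wy zE]; set y := chart_inv a z in ay Wy zE.
  pose L : 'M[R]_d := \matrix_(i, j) ('d (chart y \o chart_inv a) (chart a y) (delta_mx j 0)) i 0.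
  have LE v : L *m v = 'd (chart y \o chart_inv a) (chart a y) v.
    rewrite mulmx_coords [RHS](linear_coordE ('d (chart y \o chart_inv a) (chart a y)) v).
    by apply: eq_bigr => j _; congr (_ *: _); rewrite -colE; apply/colP => l; rewrite !mxE.
  suff /mulmx1_unit[] : (invmx (s y) *m L) *m S z = 1%:M by [].
  apply: mulmx_ext => v; rewrite mul1mx.
  rewrite -!mulmxA SE LE -/y transitionK //; last exact: chart_dom_center.
  by rewrite mulmxA mulVmx ?us // mul1mx.
have cV := Ck_invmx oO uS cS.
have /(Ck_mxP k _ oO)/(_ i 0) := Ck_mulmx oO cV (sY a k).
apply: Ck_ext oO _ => z Oz.
have [_ Wy _] := chart_imageP Oz; rewrite /= /local_rep -{1}(frame_coefK Y Wy) -SE.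
by rewrite mulmxA mulVmx ?uS // mul1mx.
Qed.

Lemma Lambda_col x v j : W x ->
  s x *m (Lambda D s x v *m delta_mx j 0) = D x (s x *m v) (fun y => s y *m delta_mx j 0).
Proof.
move=> Wx; have -> : Lambda D s x v *m delta_mx j 0 =
    invmx (s x) *m D x (s x *m v) (fun y => s y *m delta_mx j 0).
  by rewrite -colE; apply/colP => i; rewrite !mxE.
by rewrite mulmxA mulmxV ?us // mul1mx.
Qed.

Lemma smooth_Lambda v i j : smooth_fun W (fun y => Lambda D s y v i j).
Proof.
have := smooth_frame_coef i (cov_smooth D oW (ss v) (ss (delta_mx j 0))).
by apply: smooth_fun_ext => // y _; rewrite [RHS]mxE.
Qed.

(** The connection in the frame s is d + Lambda. *)
Lemma nabla_frame x v (c : M -> 'cV[R]_d) : W x ->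
  (forall i, smooth_fun W (fun y => c y i 0)) ->
  D x (s x *m v) (fun y => s y *m c y) =
  s x *m (dirderivmx x (s x *m v) c + Lambda D s x v *m c x).
Proof.
move=> Wx sc; have -> : (fun y => s y *m c y) =
    fun y => \sum_j c y j 0 *: (s y *m delta_mx j 0).
  by apply/funext => y; exact: mulmx_coords.
rewrite (nabla_sum D _ (index_enum _) oW Wx sc (fun j => ss (delta_mx j 0))).
rewrite mulmxDr big_split /=; congr (_ + _).
  by rewrite [RHS]mulmx_coords; apply: eq_bigr => j _; rewrite mxE.
rewrite (mulmx_coords (Lambda D s x v)) mulmx_sumr; apply: eq_bigr => j _.
by rewrite -scalemxAr Lambda_col.
Qed.

Lemma dirderivmx_cst m n x u (A : 'M[R]_(m, n)) : dirderivmx x u (fun=> A) = 0.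
Proof. by apply/matrixP => i j; rewrite !mxE dirderiv_cst. Qed.

Lemma nabla_frame_cst x v w : W x ->
  D x (s x *m v) (fun y => s y *m w) = s x *m (Lambda D s x v *m w).
Proof.
move=> Wx; rewrite nabla_frame // ?dirderivmx_cst ?add0r // => i.
exact: smooth_fun_cst.
Qed.

Lemma smooth_funZ_sum m n p (A : M -> 'M[R]_(m, n)) (B : 'M[R]_(n, p)) i j :
  (forall i j, smooth_fun W (fun y => A y i j)) -> smooth_fun W (fun y => (A y *m B) i j).
Proof.
move=> sA; have -> : (fun y => (A y *m B) i j) = fun y => \sum_l A y i l * B l j.
  by apply/funext => y; rewrite mxE.
by apply: smooth_fun_sum => // l; apply: smooth_funM => //; exact: smooth_fun_cst.
Qed.

Lemma dirderivmx_mulr m n p x u (A : M -> 'M[R]_(m, n)) (B : 'M[R]_(n, p)) : W x ->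
  (forall i j, smooth_fun W (fun y => A y i j)) ->
  dirderivmx x u (fun y => A y *m B) = dirderivmx x u A *m B.
Proof.
move=> Wx sA; apply/matrixP => i j; rewrite !mxE.
have -> : (fun y => (A y *m B) i j) = fun y => \sum_l B l j * A y i l.
  by apply/funext => y; rewrite mxE; apply: eq_bigr => l _; rewrite mulrC.
rewrite (dirderiv_sum _ _ oW Wx) => [|l]; last first.
  by apply: smooth_funM => //; exact: smooth_fun_cst.
by apply: eq_bigr => l _; rewrite (dirderivZ _ _ oW Wx (sA i l)) mxE mulrC.
Qed.

Lemma dirderivmx_mull m n p x u (A : M -> 'M[R]_(m, n)) (B : 'M[R]_(p, m)) : W x ->
  (forall i j, smooth_fun W (fun y => A y i j)) ->
  dirderivmx x u (fun y => B *m A y) = B *m dirderivmx x u A.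
Proof.
move=> Wx sA; apply/matrixP => i j; rewrite !mxE.
have -> : (fun y => (B *m A y) i j) = fun y => \sum_l B i l * A y l j.
  by apply/funext => y; rewrite mxE.
rewrite (dirderiv_sum _ _ oW Wx) => [|l]; last first.
  by apply: smooth_funM => //; exact: smooth_fun_cst.
by apply: eq_bigr => l _; rewrite (dirderivZ _ _ oW Wx (sA l j)) mxE.
Qed.

Lemma dirderivmx_ext m n x u (A B : M -> 'M[R]_(m, n)) : W x ->
  (forall y, W y -> A y = B y) -> (forall i j, smooth_fun W (fun y => A y i j)) ->
  dirderivmx x u A = dirderivmx x u B.
Proof.
move=> Wx AB sA; apply/matrixP => i j; rewrite !mxE.
by apply: (dirderiv_ext _ oW Wx) (sA i j) => y /AB ->.
Qed.

(** The structure equation for the curvature in the frame s. *)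
Lemma curvature_frame x u v w : W x ->
  curvature D (fun y => s y *m u) (fun y => s y *m v) (fun y => s y *m w) x =
  s x *m ((dirderivmx x (s x *m u) (fun y => Lambda D s y v) -
           dirderivmx x (s x *m v) (fun y => Lambda D s y u) +
           Lambda D s x u *m Lambda D s x v - Lambda D s x v *m Lambda D s x u -
           Lambda D s x (frame_coef (lie_bracket (fun y => s y *m u) (fun y => s y *m v)) x)) *m w).
Proof.
move=> Wx.
pose E u y := s y *m u.
have sLw u' i : smooth_fun W (fun y => (Lambda D s y u' *m w) i 0).
  by apply: smooth_funZ_sum => *; exact: smooth_Lambda.
have covE t u' : cov D (E t) (cov D (E u') (E w)) x = s x *m
    ((dirderivmx x (s x *m t) (fun y => Lambda D s y u') +
      Lambda D s x t *m Lambda D s x u') *m w).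
  have sc : smooth_field W (cov D (E u') (E w)) by exact: (cov_smooth D oW (ss u') (ss w)).
  rewrite {1}/cov (nabla_local D _ oW Wx sc (fun y Wy => nabla_frame_cst u' w Wy)).
  rewrite (nabla_frame t Wx (sLw u')) dirderivmx_mulr //; last by move=> *; exact: smooth_Lambda.
  by rewrite mulmxA -mulmxDl.
have sb := bracket_smooth oW (ss u) (ss v).
have covb : cov D (lie_bracket (E u) (E v)) (E w) x =
    s x *m (Lambda D s x (frame_coef (lie_bracket (E u) (E v)) x) *m w).
  by rewrite /cov -{1}(frame_coefK (lie_bracket (E u) (E v)) Wx) nabla_frame_cst.
rewrite /curvature -![fun y => s y *m _]/(E _) !covE covb -!mulmxBr; congr (_ *m _).
rewrite -!mulmxBl; congr (_ *m _); rewrite opprD !addrA.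
congr (_ - _ - _); by rewrite -!addrA; congr (_ + _); rewrite addrC.
Qed.

End LocalFrame.

(** * The Lie algebra u(n) + 0 acting on H_0 + R e *)

Section UnitaryAlgebra.
Variables (R : realType) (n : nat).
Local Notation H := 'cV[R]_(n + n).
Local Notation V := 'cV[R]_(n + n + 1).
Local Notation J := (J0 R n).
Local Notation h := (@h0 R n).
Local Notation om := (@omega0 R n).
Local Notation e := (evec R n).
Implicit Types (X Y Z W : H) (u v w : V) (a b c : R) (A B : 'M[R]_(n + n + 1)).

Lemma inHD X Y : inH (X + Y) = inH X + inH Y.
Proof. by rewrite /inH add_col_mx addr0. Qed.

Lemma inHZ a X : inH (a *: X) = a *: inH X.
Proof. by rewrite /inH scale_col_mx scaler0. Qed.

Lemma inHN X : inH (- X) = - inH X.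
Proof. by rewrite -scaleN1r inHZ scaleN1r. Qed.

Lemma inHB X Y : inH (X - Y) = inH X - inH Y.
Proof. by rewrite inHD inHN. Qed.

Lemma inH0 : inH (0 : H) = 0.
Proof. by rewrite -(scale0r 0) inHZ scale0r. Qed.

Definition hpart u : H := usubmx u.
Definition epart u : R := dsubmx u 0 0.

Lemma hpartK u : u = inH (hpart u) + epart u *: e.
Proof.
rewrite /inH /evec scale_col_mx scaler0 add_col_mx addr0 add0r -[LHS]vsubmxK.
congr col_mx; apply/matrixP => i j; rewrite !ord1 [in RHS]mxE [in RHS]mxE.
by rewrite eqxx mulr1.
Qed.

Lemma hpart_inH X a : hpart (inH X + a *: e) = X.
Proof. by rewrite /hpart /inH /evec scale_col_mx scaler0 add_col_mx addr0 col_mxKu. Qed.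

Lemma epart_inH X a : epart (inH X + a *: e) = a.
Proof.
by rewrite /epart /inH /evec scale_col_mx add_col_mx add0r col_mxKd !mxE mulr1.
Qed.

Lemma inH_e_inj X Y a b : inH X + a *: e = inH Y + b *: e -> X = Y /\ a = b.
Proof.
by move=> E; split; [rewrite -(hpart_inH X a) E hpart_inH|rewrite -(epart_inH X a) E epart_inH].
Qed.

Lemma inH_inj X Y : inH X = inH Y -> X = Y.
Proof. by rewrite -[inH X]addr0 -[inH Y]addr0 -(scale0r e) => /inH_e_inj[]. Qed.

Lemma block_inH (A : 'M[R]_(n + n)) (z : 'M[R]_1) X : block_mx A 0 0 z *m inH X = inH (A *m X).
Proof. by rewrite /inH mul_block_col !mulmx0 mul0mx !addr0. Qed.

Lemma block0_e (A : 'M[R]_(n + n)) : block_mx A 0 0 0 *m e = 0 :> V.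
Proof. by rewrite /evec mul_block_col !mulmx0 !mul0mx !addr0 col_mx0. Qed.

Lemma block1_e (A : 'M[R]_(n + n)) : block_mx A 0 0 1%:M *m e = e :> V.
Proof. by rewrite /evec mul_block_col !mulmx0 !mul0mx mul1mx !add0r. Qed.

Definition J0V : 'M[R]_(n + n + 1) := block_mx J 0 0 0.

(** The linear equations that cut out u(n) + 0 in gl(V). *)
Lemma un0P A : un0 A <-> [/\ A^T = - A, A *m J0V = J0V *m A & A *m e = 0].
Proof.
split=> [[B [skB BJ] <-]|[skA AJ Ae]].
  split; last exact: block0_e.
    by rewrite tr_block_mx skB !trmx0 opp_block_mx !oppr0.
  by rewrite /J0V !mulmx_block !mulmx0 !mul0mx !addr0 BJ.
have EA := submxK A.
have [ur0 dr0] : ursubmx A = 0 /\ drsubmx A = 0.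
  have := Ae; rewrite -{1}EA /evec mul_block_col !mulmx0 !mulmx1 !add0r => /eqP.
  by rewrite col_mx_eq0 => /andP[/eqP-> /eqP->].
rewrite ur0 dr0 in EA.
have := skA; rewrite -EA tr_block_mx opp_block_mx => /eq_block_mx[ul _ dl0 _].
have {}dl0 : dlsubmx A = 0 by apply: oppr_inj; rewrite -dl0 trmx0 oppr0.
rewrite dl0 in EA *; exists (ulsubmx A) => //; split=> //.
have := AJ; rewrite -EA /J0V !mulmx_block !mulmx0 !mul0mx !addr0.
by move=> /eq_block_mx[? _ _ _]; rewrite EA.
Qed.

Lemma un0D A B : un0 A -> un0 B -> un0 (A + B).
Proof.
move=> /un0P[A1 A2 A3] /un0P[B1 B2 B3]; apply/un0P; split.
- by rewrite linearD /= A1 B1 opprD.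
- by rewrite mulmxDl A2 B2 mulmxDr.
- by rewrite mulmxDl A3 B3 addr0.
Qed.

Lemma un0N A : un0 A -> un0 (- A).
Proof.
move=> /un0P[A1 A2 A3]; apply/un0P; split.
- by rewrite linearN /= A1.
- by rewrite mulNmx A2 mulmxN.
- by rewrite mulNmx A3 oppr0.
Qed.

Lemma un0_comm A B : un0 A -> un0 B -> un0 (A *m B - B *m A).
Proof.
move=> /un0P[A1 A2 A3] /un0P[B1 B2 B3]; apply/un0P; split.
- by rewrite linearB /= !trmx_mul A1 B1 !mulNmx !mulmxN !opprK opprB.
- by rewrite mulmxBl mulmxBr -!mulmxA A2 B2 !mulmxA A2 B2.
- by rewrite mulmxBl -!mulmxA A3 B3 !mulmx0 subrr.
Qed.

Lemma un_h0 (A : 'M[R]_(n + n)) X Y : un A -> h (A *m X) Y = - h X (A *m Y).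
Proof. by case=> skA _; rewrite h0_trmx skA mulNmx h0Nr. Qed.

Lemma un_omega0 (A : 'M[R]_(n + n)) X Y : un A -> om (A *m X) Y = - om X (A *m Y).
Proof. by move=> uA; have [_ AJ] := uA; rewrite /omega0 mulmxA -AJ -mulmxA un_h0. Qed.

Lemma un_K (A : 'M[R]_(n + n)) X Y Z : un A ->
  A *m K X Y Z = K (A *m X) Y Z + K X (A *m Y) Z + K X Y (A *m Z).
Proof.
move=> uA; apply: h0_inj => W; rewrite un_h0 // !h0Dl !h0_K.
have hA S T : h S (A *m T) = - h (A *m S) T by rewrite un_h0 // opprK.
have oA S T : om S (A *m T) = - om (A *m S) T by rewrite un_omega0 // opprK.
by rewrite !hA !oA; ring.
Qed.

Lemma Un_h0 (A : 'M[R]_(n + n)) X Y : Un A -> h (A *m X) (A *m Y) = h X Y.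
Proof. by case=> AtA _; rewrite h0_trmx mulmxA AtA mul1mx. Qed.

Lemma Un_omega0 (A : 'M[R]_(n + n)) X Y : Un A -> om (A *m X) (A *m Y) = om X Y.
Proof. by move=> UA; have [_ AJ] := UA; rewrite /omega0 mulmxA -AJ -mulmxA Un_h0. Qed.

Lemma K_J X Y Z : K X (J *m Y) Z = - K (J *m X) Y Z.
Proof.
apply: h0_inj => W; rewrite h0Nl !h0_K !omega0J !h0Jl !omega0Jl !h0Jr.
by ring.
Qed.

End UnitaryAlgebra.

(** * The constraints on torsion and curvature *)

Section Constraints.
Variables (R : realType) (n : nat).
Hypothesis n_ge1 : (1 <= n)%N.
Local Notation d := (n + n + 1)%N.
Local Notation H := 'cV[R]_(n + n).
Local Notation V := 'cV[R]_d.
Local Notation J := (J0 R n).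
Local Notation h := (@h0 R n).
Local Notation om := (@omega0 R n).
Local Notation e := (evec R n).
Variables (M : manifold R d) (D : connection M) (P : M -> set 'M[R]_d).
Variables (T0 : {bilinear V -> V -> V}) (R0 : {bilinear V -> V -> 'M[R]_d}).
Variables (I0 : {linear V -> 'M[R]_d}) (t1 t2 t3 : R).
Hypotheses (PG : Gstructure (@Un1 R n) P)
  (hom : infinitesimally_homogeneous D (@un0 R n) P T0 R0 I0)
  (I00 : forall u, un0 (I0 u)) (T0t : torsion_parameters T0 t1 t2 t3).
Implicit Types (X Y Z : H) (u v w z : V) (x y : M).

Let T0C u v : T0 v u = - T0 u v.
Proof.
have [T0R0 _ _ _] := hom; have := (T0R0 (u + v)).1.
rewrite linearDl !linearDr /= (T0R0 u).1 (T0R0 v).1 addr0 add0r => /eqP.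
by rewrite addrC addr_eq0 => /eqP.
Qed.

Let R0C u v : R0 v u = - R0 u v.
Proof.
have [T0R0 _ _ _] := hom; have := (T0R0 (u + v)).2.
rewrite linearDl !linearDr /= (T0R0 u).2 (T0R0 v).2 addr0 add0r => /eqP.
by rewrite addrC addr_eq0 => /eqP.
Qed.

Let T0e : T0 e e = 0. Proof. by have [T0R0 _ _ _] := hom; have [] := T0R0 e. Qed.
Let R0e : R0 e e = 0. Proof. by have [T0R0 _ _ _] := hom; have [] := T0R0 e. Qed.

Let T0HH X Y : T0 (inH X) (inH Y) = (t3 * om X Y) *: e.
Proof. by have [] := T0t X Y. Qed.
Let T0He X : T0 (inH X) e = inH (t1 *: X + t2 *: (J *m X)).
Proof. by have [] := T0t X 0. Qed.

Let T0_expand X Y (a b : R) : T0 (inH X + a *: e) (inH Y + b *: e) =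
  inH (b *: (t1 *: X + t2 *: (J *m X)) - a *: (t1 *: Y + t2 *: (J *m Y))) +
  (t3 * om X Y) *: e.
Proof.
rewrite linearDl !linearDr !linearZl_LR !linearZr_LR /= T0e T0HH T0He.
rewrite (T0C (inH Y) e) T0He !scaler0 addr0 inHB !inHZ scalerN.
by rewrite -addrA addrC.
Qed.

(** T0 is invariant under the Lie algebra u(n), since h0, omega0 and J0 are. *)
Let T0_un0 (A : 'M[R]_d) u v : un0 A -> A *m T0 u v = T0 (A *m u) v + T0 u (A *m v).
Proof.
case=> B uB <-; have BJ X : B *m (J *m X) = J *m (B *m X).
  by have [_ BJ] := uB; rewrite !mulmxA BJ.
rewrite (hpartK u) (hpartK v); move: (hpart u) (epart u) (hpart v) (epart v) => X a Y b.
have AE Z (c : R) : block_mx B 0 0 0 *m (inH Z + c *: e) = inH (B *m Z) + 0 *: e.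
  by rewrite mulmxDr block_inH -scalemxAr block0_e scaler0 scale0r.
rewrite !AE !T0_expand !AE mulmxBr -!scalemxAr !mulmxDr -!scalemxAr !BJ !scale0r subr0.
rewrite sub0r addr0 addrACA -scalerDl -mulrDr un_omega0 // addNr mulr0 scale0r addr0.
by rewrite -inHD.
Qed.

(** What the algebra below needs of M: a point and a frame field around it. *)
Lemma point_and_section : exists x W s, [/\ W x, local_section P W s,
  open W & forall y, W y -> s y \in unitmx].
Proof.
have [x _] := manifold_nonempty M; have [Pu _ Ps] := PG.
have [W [s [Wx sP]]] := Ps x; exists x, W, s.
by have [oW Psy _] := sP; split=> // y Wy; apply: Pu (Psy y Wy).
Qed.

Section AtPoint.
Variables (x : M) (W : set M) (s : M -> 'M[R]_d).
Hypotheses (Wx : W x) (sP : local_section P W s) (oW : open W).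
Hypothesis us : forall y, W y -> s y \in unitmx.
Local Notation E u := (fun y => s y *m u).
Local Notation L := (Lambda D s x).

Let Ps y : W y -> P y (s y). Proof. by have [_ + _] := sP; apply. Qed.
Let sE w : smooth_field W (E w). Proof. by have [_ _] := sP; apply. Qed.
Let near_E w y : W y -> smooth_field_near y (E w).
Proof. by move=> Wy; exact: smooth_field_nearW oW Wy (sE w). Qed.
Let s_inj y (u v : V) : W y -> s y *m u = s y *m v -> u = v.
Proof.
by move=> Wy /(congr1 (mulmx (invmx (s y)))); rewrite !mulmxA mulVmx ?us // !mul1mx.
Qed.

(** The inner torsion of s at s(x) u is the class of Lambda(u); as I0 u also lies in
   the Lie algebra, so does Lambda(u). *)
Lemma Lambda_un0 y v : W y -> un0 (Lambda D s y v).
Proof.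
move=> Wy; have [_ _ _ inner] := hom.
have [A gA] := inner y (s y) v W s (Ps Wy) sP Wy.
rewrite /inner_torsion mulmxA mulVmx ?us // mul1mx -mulmxBl -mulmxBr => E.
have -> : Lambda D s y v = A + I0 v.
  apply/eqP; rewrite -subr_eq; apply/eqP; symmetry.
  have [uV Vu] := (mulmxV (us Wy), mulVmx (us Wy)).
  move: E => /(congr1 (fun B => invmx (s y) *m B *m s y)).
  by rewrite /Ad !mulmxA Vu !mul1mx -!mulmxA Vu !mulmx1.
by apply: un0D => //; exact: I00.
Qed.

Lemma torsion_frame u v y : W y -> torsion D (E u) (E v) y = s y *m T0 u v.
Proof.
by move=> Wy; have [_ tor _ _] := hom; apply: tor (Ps Wy) _ _ _ _ => //; exact: near_E.
Qed.

Lemma curvature_frameR u v w y : W y -> curvature D (E u) (E v) (E w) y = s y *m (R0 u v *m w).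
Proof.
move=> Wy; have [_ _ cur _] := hom.
by apply: cur (Ps Wy) _ _ _ _ _ _ => //; exact: near_E.
Qed.

(** The torsion is T0, and the covariant derivatives of the E u are given by Lambda. *)
Lemma bracket_frame u v : lie_bracket (E u) (E v) x = s x *m (L u *m v - L v *m u - T0 u v).
Proof.
have := torsion_frame u v Wx; rewrite /torsion /cov !(nabla_frame_cst D oW us sE) // => E.
rewrite mulmxBr -E mulmxBr.
have alg (a b c : V) : c = a - b - (a - b - c) by apply/colP => i; rewrite !mxE; ring.
exact: alg.
Qed.

(** The structure equation writes R0 u v as a combination of Lambda, of brackets of
   its values and of its derivatives; differentiation preserves the linear equations
   of the Lie algebra. *)
Lemma R0_un0 u v : un0 (R0 u v).
Proof.
have smL v' i j := smooth_Lambda D oW us sE v' i j.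
have -> : R0 u v = dirderivmx x (s x *m u) (fun y => Lambda D s y v) -
    dirderivmx x (s x *m v) (fun y => Lambda D s y u) + (L u *m L v - L v *m L u) -
    L (frame_coef s (lie_bracket (E u) (E v)) x).
  apply: mulmx_ext => w; apply: (s_inj Wx).
  rewrite -(curvature_frameR u v w Wx) (curvature_frame D oW us sE u v w Wx).
  by rewrite !addrA.
have dun0 t v' : un0 (dirderivmx x t (fun y => Lambda D s y v')).
  have Lun y : W y -> un0 (Lambda D s y v') by exact: Lambda_un0.
  have Lu y (Wy : W y) := (un0P (Lambda D s y v')).1 (Lun y Wy).
  have sm := smL v'; apply/un0P; split.
  - apply/matrixP => i j; rewrite !mxE -mulN1r -(dirderivZ _ _ oW Wx (sm i j)).
    apply: (dirderiv_ext _ oW Wx) (sm j i) => y Wy.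
    have [/matrixP/(_ i j) skL _ _] := Lu y Wy.
    by rewrite mulN1r; move: skL; rewrite [LHS]mxE [RHS]mxE.
  - rewrite -(dirderivmx_mulr oW _ _ Wx sm) -(dirderivmx_mull oW _ _ Wx sm).
    apply: (dirderivmx_ext oW _ Wx) => [y Wy|i j]; first by have [] := Lu y Wy.
    exact: (smooth_funZ_sum oW).
  - rewrite -(dirderivmx_mulr oW _ _ Wx sm) -(dirderivmx_cst x t 0).
    apply: (dirderivmx_ext oW _ Wx) => [y Wy|i j]; first by have [] := Lu y Wy.
    exact: (smooth_funZ_sum oW).
apply: un0D; last by apply: un0N; exact: Lambda_un0.
apply: un0D; first by apply: un0D => //; exact: un0N.
by apply: un0_comm; exact: Lambda_un0.
Qed.

Let torsion_bracket u v w : torsion D (E u) (lie_bracket (E v) (E w)) x =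
  s x *m T0 u (L v *m w - L w *m v - T0 v w).
Proof.
have [_ tor _ _] := hom; apply: tor (Ps Wx) _ _ _ _ => //; first exact: near_E.
  by apply: smooth_field_nearW oW Wx _; exact: bracket_smooth.
exact: bracket_frame.
Qed.

Let cov_torsion u v w : cov D (E u) (torsion D (E v) (E w)) x = s x *m (L u *m T0 v w).
Proof.
rewrite /cov (nabla_local D _ oW Wx (torsion_smooth D oW (sE v) (sE w))
  (fun y Wy => torsion_frame v w Wy)).
exact: (nabla_frame_cst D oW us sE).
Qed.

(** The covariant derivatives of the torsion amount to the action of Lambda on T0,
   which is trivial as T0 is invariant; only the quadratic terms remain. *)
Lemma first_bianchi_T0 u v w : R0 u v *m w + R0 v w *m u + R0 w u *m v =
  - (T0 u (T0 v w) + T0 v (T0 w u) + T0 w (T0 u v)).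
Proof.
have := first_bianchi D oW Wx (sE u) (sE v) (sE w).
rewrite !curvature_frameR // !torsion_bracket !cov_torsion -!mulmxDr => /(s_inj Wx) ->.
rewrite !(T0_un0 _ _ (Lambda_un0 _ Wx)) !linearB /=.
rewrite (T0C w (L u *m v)) (T0C u (L v *m w)) (T0C v (L w *m u)).
have alg (a1 a2 a3 b1 b2 b3 c1 c2 c3 : V) :
    a1 - b1 - c1 + (a2 - b2 - c2) + (a3 - b3 - c3) +
    (- a3 + b2 + (- a1 + b3) + (- a2 + b1)) = - (c1 + c2 + c3).
  by apply/colP => i; rewrite !mxE; ring.
exact: alg.
Qed.

(** When R0 is invariant under u(n) the covariant derivatives of the curvature
   cancel, which leaves a purely algebraic form of the second Bianchi identity. *)
Lemma second_bianchi_R0 u v w :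
  (forall A u v, un0 A -> A *m R0 u v - R0 u v *m A = R0 (A *m u) v + R0 u (A *m v)) ->
  R0 u (T0 v w) + R0 v (T0 w u) + R0 w (T0 u v) = 0.
Proof.
move=> R0inv; apply: mulmx_ext => z; rewrite mul0mx.
have cR a b c : cov D (E a) (curvature D (E b) (E c) (E z)) x =
    s x *m (L a *m (R0 b c *m z)).
  rewrite /cov (nabla_local D _ oW Wx (curvature_smooth D oW (sE b) (sE c) (sE z))
    (fun y Wy => curvature_frameR b c z Wy)).
  exact: (nabla_frame_cst D oW us sE).
have [_ _ cur _] := hom.
have nX a : smooth_field_near x (E a) by exact: near_E.
have Rc a b c : curvature D (E b) (E c) (cov D (E a) (E z)) x =
    s x *m (R0 b c *m (L a *m z)).
  apply: (cur _ (s x)) => //; first exact: Ps.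
    by apply: smooth_field_nearW oW Wx _; exact: (cov_smooth D oW (sE a) (sE z)).
  exact: (nabla_frame_cst D oW us sE).
have Rb a b c : curvature D (E a) (lie_bracket (E b) (E c)) (E z) x =
    s x *m (R0 a (L b *m c - L c *m b - T0 b c) *m z).
  apply: (cur _ (s x)) => //; first exact: Ps.
    by apply: smooth_field_nearW oW Wx _; exact: (bracket_smooth oW (sE b) (sE c)).
  exact: bracket_frame.
have := second_bianchi D oW Wx (sE u) (sE v) (sE w) (sE z).
rewrite !cR !Rc !Rb -!mulmxBr -!mulmxDr => E0.
have {}E0 := s_inj Wx (etrans E0 (esym (mulmx0 _ (s x)))).
have inv a b c : L a *m (R0 b c *m z) - R0 b c *m (L a *m z) =
    (R0 (L a *m b) c + R0 b (L a *m c)) *m z.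
  by rewrite !mulmxA -mulmxBl R0inv //; exact: Lambda_un0.
have R0B a b c f : R0 a (b - c - f) = R0 a b - R0 a c - R0 a f by rewrite !linearB.
rewrite !inv !R0B -!mulmxDl in E0.
rewrite -[RHS]oppr0 -{}E0 -mulNmx; congr (_ *m z).
rewrite (R0C w (L u *m v)) (R0C u (L v *m w)) (R0C v (L w *m u)).
have alg (a1 a2 a3 b1 b2 b3 c1 c2 c3 : 'M[R]_d) :
    c1 + c2 + c3 = - (- a3 + b2 + (a1 - b1 - c1) + (- a1 + b3 + (a2 - b2 - c2)) +
      (- a2 + b1 + (a3 - b3 - c3))).
  by apply/matrixP => i j; rewrite !mxE; ring.
exact: alg.
Qed.

(** The frames s x and s x a of P at x give the same tensor R0. *)
Lemma R0_equivariant (A : 'M[R]_(n + n)) X Y Z : Un A ->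
  R0 (inH (A *m X)) (inH (A *m Y)) *m inH (A *m Z) =
  block_mx A 0 0 1%:M *m (R0 (inH X) (inH Y) *m inH Z).
Proof.
move=> UA; pose a : 'M[R]_d := block_mx A 0 0 1%:M.
have aH T : a *m inH T = inH (A *m T) by exact: block_inH.
have Pa : P x (s x *m a).
  have [_ /(_ _ _ (Ps Wx)) -> _] := PG; exists a => //; by exists A.
have [_ _ cur _] := hom; apply: (s_inj Wx).
have nX t : smooth_field_near x (E t) by exact: near_E.
rewrite -(curvature_frameR _ _ _ Wx) mulmxA.
by apply: (cur x _ _ _ _ _ _ _ Pa) => //; rewrite -mulmxA aH.
Qed.

Let C X : 'M[R]_(n + n) := ulsubmx (R0 (inH X) e).
Let Q X Y : 'M[R]_(n + n) := ulsubmx (R0 (inH X) (inH Y)).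

Let un_block (B : 'M[R]_d) : @un0 R n B ->
  B = block_mx (ulsubmx B) 0 0 0 /\ @un R n (ulsubmx B).
Proof. by case=> B' uB <-; rewrite block_mxKul. Qed.

Let CE X : R0 (inH X) e = block_mx (C X) 0 0 0.
Proof. by have [] := un_block (R0_un0 (inH X) e). Qed.
Let C_un X : un (C X).
Proof. by have [] := un_block (R0_un0 (inH X) e). Qed.
Let QE X Y : R0 (inH X) (inH Y) = block_mx (Q X Y) 0 0 0.
Proof. by have [] := un_block (R0_un0 (inH X) (inH Y)). Qed.
Let Q_un X Y : un (Q X Y).
Proof. by have [] := un_block (R0_un0 (inH X) (inH Y)). Qed.

(** Both components of the first Bianchi identity on (X, Y, e). *)
Let bianchi_HHe X Y : C Y *m X - C X *m Y = 0 /\ t1 * t3 * om X Y = 0.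
Proof.
have := first_bianchi_T0 (inH X) (inH Y) e.
rewrite (R0C (inH X) e) QE !CE block0_e add0r block_inH mulNmx block_inH.
rewrite (T0C (inH X) e) !T0He linearN /= !T0HH linearZr_LR /= T0e scaler0 addr0.
rewrite -inHB -[LHS]addr0 -(scale0r e) -scalerBl -scaleNr -[RHS]add0r -inH0.
move=> /inH_e_inj[-> E]; split=> //.
move: E; rewrite !(omega0E _ (_ + _)) !h0Dr !h0Zr !h0JJ (h0C Y X) -!omega0E (omega0C X Y).
by lra.
Qed.

(** h (C X *m Y) Z is symmetric in X, Y and skew in Y, Z; a trilinear form with both
   symmetries vanishes. *)
Lemma R0_He0 X : R0 (inH X) e = 0.
Proof.
rewrite CE; suff C0 Y : C X *m Y = 0.
  have -> : C X = 0 by apply: mulmx_ext => Z; rewrite C0 mul0mx.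
  by rewrite block_mx0.
have sym S T : C S *m T = C T *m S.
  by have [/eqP + _] := bianchi_HHe T S; rewrite subr_eq0 => /eqP ->.
have sk S T T' : h (C S *m T) T' = - h (C S *m T') T.
  by rewrite un_h0 // h0C.
apply: h0_inj => Z; rewrite h00l.
have := sk X Y Z; have := sk Y X Z; have := sk Z X Y.
rewrite (sym Y X) (sym Z X) (sym Z Y) (sk Y Z X) (sym Y X); lra.
Qed.

Let H_nonzero : {X : H | h X X != 0}.
Proof.
have lt0 : (0 < n + n)%N by rewrite addn_gt0 n_ge1.
exists (delta_mx (Ordinal lt0) 0).
by rewrite -[X in h _ X]mul1mx h0_delta mxE eqxx oner_eq0.
Qed.

(** omega0 is nonzero since n is positive. *)
Lemma t1t3_eq0 : t1 * t3 = 0.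
Proof.
have [X hX] := H_nonzero; have [_] := bianchi_HHe X (J *m X).
by rewrite omega0J => /eqP; rewrite mulf_eq0 (negPf hX) orbF => /eqP.
Qed.

(** The right-hand side is the cyclic sum of - t2 t3 omega0(X, Y) J Z, so adding
   t2 t3 omega0 J to Q restores the Bianchi identity of a Kaehler curvature tensor. *)
Let bianchi_HHH X Y Z : Q X Y *m Z + Q Y Z *m X + Q Z X *m Y =
  - (t2 * t3) *: (om Y Z *: (J *m X) + om Z X *: (J *m Y) + om X Y *: (J *m Z)).
Proof.
apply: inH_inj; have := first_bianchi_T0 (inH X) (inH Y) (inH Z).
rewrite !QE !block_inH !T0HH !linearZr_LR /= !T0He -!inHZ -!inHD -inHN => ->.
congr inH; apply/colP => i; rewrite !mxE; have := t1t3_eq0 => tt.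
have e13 a b : t3 * a * (t1 * b) = 0 by rewrite mulrACA [t3 * t1]mulrC tt mul0r.
by rewrite !mulrDr !e13; ring.
Qed.

Lemma R0_formula : exists k, forall X Y Z, R0 (inH X) (inH Y) *m inH Z =
  inH (k *: K X Y Z - (t2 * t3 * om X Y) *: (J *m Z)).
Proof.
pose Q' X Y : 'M[R]_(n + n) := Q X Y + (t2 * t3 * om X Y) *: J.
have Q'E X Y Z : Q' X Y *m Z = Q X Y *m Z + (t2 * t3 * om X Y) *: (J *m Z).
  by rewrite mulmxDl scalemxAl.
have QD S T U : Q (S + T) U = Q S U + Q T U.
  by rewrite /Q inHD linearDl; apply/matrixP => i j; rewrite !mxE.
have QZ a S T : Q (a *: S) T = a *: Q S T.
  by rewrite /Q inHZ linearZl_LR; apply/matrixP => i j; rewrite !mxE.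
have QC S T : Q T S = - Q S T by rewrite /Q (R0C (inH S)); apply/matrixP => i j; rewrite !mxE.
have [|a X Y|A X Y Z UA|k kE] := @unitary_kahler_curvature R n Q' n_ge1.
- split; [split|..].
  + by move=> X X' Y Z W'; rewrite !Q'E QD omega0Dl mulmxDl !h0Dl !h0Zl; ring.
  + by move=> X Y Z W'; rewrite !Q'E QC (omega0C X Y) mulNmx !h0Dl h0Nl !h0Zl; ring.
  + move=> X Y Z W'; rewrite !Q'E !h0Dl !h0Zl un_h0 // (h0C W') h0Jl (h0C W'); ring.
  + move=> X Y Z W'; rewrite -!h0Dl !Q'E -(h00l W'); congr (h _ W').
    have alg (a b c S1 S2 S3 : H) (k p q r : R) :
        a + b + c = - k *: (q *: S1 + r *: S2 + p *: S3) ->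
        a + (k * p) *: S3 + (b + (k * q) *: S1) + (c + (k * r) *: S2) = 0.
      by move=> /colP E0; apply/colP => i; have := E0 i; rewrite !mxE; lra.
    exact: alg (bianchi_HHH X Y Z).
  + move=> X Y Z W'; rewrite !Q'E !h0Dl !h0Zl h0JJ.
    have [_ QJ] := Q_un X Y; by rewrite mulmxA QJ -mulmxA h0JJ.
- by rewrite /Q' QZ omega0Zl scalerDr scalerA; congr (_ + _ *: _); ring.
- rewrite !Q'E Un_omega0 // mulmxDr -scalemxAr; have [_ AJ] := UA.
  rewrite (mulmxA J) -AJ -mulmxA; congr (_ + _); apply: inH_inj.
  by have := R0_equivariant X Y Z UA; rewrite !QE !block_inH.
exists k => X Y Z; rewrite QE block_inH; congr inH.
by rewrite -kE Q'E addrK.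
Qed.

Let R0_expand X Y (a b : R) : R0 (inH X + a *: e) (inH Y + b *: e) = R0 (inH X) (inH Y).
Proof.
rewrite linearDl !linearDr !linearZl_LR !linearZr_LR /= R0e R0_He0 (R0C (inH Y) e) R0_He0.
by rewrite oppr0 !scaler0 !addr0.
Qed.

(** R0 is built from the invariant tensors h0, omega0, J0. *)
Lemma R0_un0_invariant (A : 'M[R]_d) u v : un0 A ->
  A *m R0 u v - R0 u v *m A = R0 (A *m u) v + R0 u (A *m v).
Proof.
have [k kE] := R0_formula.
case=> B uB <-; have BJ X : B *m (J *m X) = J *m (B *m X).
  by have [_ BJ] := uB; rewrite !mulmxA BJ.
rewrite (hpartK u) (hpartK v); move: (hpart u) (epart u) (hpart v) (epart v) => X a Y b.
have AE Z (c : R) : block_mx B 0 0 0 *m (inH Z + c *: e) = inH (B *m Z) + 0 *: e.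
  by rewrite mulmxDr block_inH -scalemxAr block0_e scaler0 scale0r.
rewrite !AE !R0_expand; apply: mulmx_ext => w.
rewrite (hpartK w) mulmxBl mulmxDl -!mulmxA AE scale0r addr0.
have Re S T Z (c : R) : R0 (inH S) (inH T) *m (inH Z + c *: e) = R0 (inH S) (inH T) *m inH Z.
  by rewrite mulmxDr -scalemxAr QE block0_e scaler0 addr0.
rewrite !Re !kE block_inH -inHB -inHD; congr inH.
rewrite mulmxBr -(scalemxAr k) -(scalemxAr (t2 * t3 * _)) (un_K X Y _ uB) BJ un_omega0 //.
move: (K _ _ _) (K _ _ _) (K _ _ _) => K1 K2 K3.
by apply/colP => i; rewrite !mxE; ring.
Qed.

(** The second Bianchi identity on (X, Y, e) is 2 t1 R0(X, Y) +
   t2 (R0(X, J Y) + R0(J X, Y)) = 0, and the term in t2 vanishes as K and omega0 are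
   of type (1, 1). *)
Lemma curvature_vanishing k :
  (forall X Y Z, R0 (inH X) (inH Y) *m inH Z =
    inH (k *: K X Y Z - (t2 * t3 * om X Y) *: (J *m Z))) ->
  k * t1 = 0 /\ (t1 != 0 -> [/\ t3 = 0, k = 0 & forall u v, R0 u v = 0]).
Proof.
move=> kE.
have R0J X Y : R0 (inH X) (inH (J *m Y)) + R0 (inH (J *m X)) (inH Y) = 0.
  apply: mulmx_ext => w; rewrite mul0mx (hpartK w) mulmxDl !mulmxDr -!scalemxAr !QE !block0_e.
  rewrite !scaler0 !addr0 -!QE !kE -inHD -[RHS]inH0; congr inH.
  rewrite K_J omega0J omega0Jl; apply/colP => i; rewrite !mxE; ring.
have t1R X Y : t1 *: R0 (inH X) (inH Y) = 0.
  have := second_bianchi_R0 (inH X) (inH Y) e R0_un0_invariant.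
  rewrite (T0C (inH X) e) !T0He T0HH linearZr_LR /= R0e scaler0 addr0 linearN /=.
  rewrite (R0C (inH (t1 *: X + _))) opprK !inHD !inHZ linearDl linearDr.
  rewrite !linearZl_LR !linearZr_LR /= addrACA -!scalerDr R0J scaler0 addr0.
  by rewrite -mulr2n -scaler_nat scalerA => /eqP; rewrite scaler_eq0 => /orP[|/eqP->//];
    rewrite ?scaler0 // mulf_eq0 pnatr_eq0 orbF => /eqP ->; rewrite scale0r.
have tt := t1t3_eq0.
have kt1 : k * t1 = 0.
  have [X hX] := H_nonzero.
  have /(congr1 (mulmx^~ (inH X))) := t1R X (J *m X).
  rewrite -scalemxAl kE mul0mx -inHZ -[RHS]inH0 => /inH_inj /(congr1 (h (J *m X))).
  rewrite h00r (h0Zr t1) h0Br (h0Zr k) (h0Zr (t2 * t3 * _)) (h0C _ (K _ _ _)) h0_K.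
  rewrite !omega0J omega0Jl h0JJ (h0C (J *m X) X).
  rewrite h0XJX => E; have : k * t1 * h X X ^+ 2 = (t1 * t3) * - (t2 * h X X ^+ 2) by lra.
  rewrite tt mul0r => /eqP; rewrite mulf_eq0 expf_eq0 (negPf hX) andbF orbF => /eqP //.
split=> // t1n.
have R00 X Y : R0 (inH X) (inH Y) = 0.
  by have /eqP := t1R X Y; rewrite scaler_eq0 (negPf t1n) => /eqP.
split.
- by move: tt => /eqP; rewrite mulf_eq0 (negPf t1n) => /eqP.
- by move: kt1 => /eqP; rewrite mulf_eq0 (negPf t1n) orbF => /eqP.
- by move=> u v; rewrite (hpartK u) (hpartK v) R0_expand R00.
Qed.

End AtPoint.

Lemma infinitesimally_homogeneous_constraints :
  t1 * t3 = 0 /\ exists k, [/\ k * t1 = 0, curvature_formulas R0 t2 t3 k &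
    t1 != 0 -> [/\ t3 = 0, k = 0 & flat D]].
Proof.
have [x [W [s [Wx sP oW us]]]] := point_and_section.
split; first exact: (t1t3_eq0 Wx sP oW us).
have [k kE] := R0_formula Wx sP oW us; exists k.
have [kt1 flatR] := curvature_vanishing Wx sP oW us kE; split=> //.
  move=> X Y Z; split=> //; first exact: (R0_He0 Wx sP oW us).
  by have [B _ <-] := R0_un0 Wx sP oW us (inH X) (inH Y); rewrite block0_e.
move=> /flatR[t30 k0 R00]; split=> // y X Y Z sX sY sZ.
have [Pu _ Ps] := PG; have [W' [s' [W'y [_ P' _]]]] := Ps y.
have Py := P' y W'y; have pu := Pu _ _ Py; have [_ _ cur _] := hom.
have pK v : v = s' y *m (invmx (s' y) *m v) by rewrite mulmxA mulmxV // mul1mx.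
rewrite (cur _ _ _ _ _ _ _ _ Py sX sY sZ (pK _) (pK _) (pK _)).
by rewrite R00 mul0mx mulmx0.
Qed.

End Constraints.

(** * Open subsets of R^d as manifolds *)

Section OpenSubsetManifold.
Variables (R : realType) (d : nat).

(** The balls with rational centres and radii 1 / (n + 1) form a countable basis. *)
Lemma cV_second_countable : @second_countable 'cV[R]_d.
Proof.
pose r (n : nat) : R := n.+1%:R^-1.
have r0 n : 0 < r n by rewrite invr_gt0 ltr0n.
pose f (c : 'cV[rat]_d * nat) : set 'cV[R]_d := ball (map_mx ratr c.1 : 'cV[R]_d) (r c.2).
exists (f @` setT); first exact: card_le_trans (card_image_le _ _) (countableP _).
split=> [_ [c _ <-]|x V /nbhs_ballP[_/posnumP[e] eV]]; first exact: ball_open.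
have [//|N] := @ltr_add_invr R 0 (e%:num / 2) _; rewrite add0r -/(r N) => Ne.
have q i : {q : rat | `|x i 0 - ratr q| < r N}.
  apply: cid; have lt : x i 0 - r N < x i 0 + r N by rewrite ltrD2l gtrN.
  have [q /[!in_itv]/= /andP[q1 q2]] := rat_in_itvoo lt.
  by exists q; rewrite ltr_norml; lra.
pose c : 'cV[rat]_d := \col_i sval (q i).
have cx : ball (map_mx ratr c : 'cV[R]_d) (r N) x.
  split; first exact: r0.
  by move=> i j; rewrite !mxE !ord1 /ball /= distrC; exact: svalP (q i).
exists (f (c, N)); first by split=> //; exists (c, N).
move=> z cz; apply: eV; rewrite [_%:num]splitr.
apply: (@ball_triangle _ _ (map_mx ratr c : 'cV[R]_d)).
  exact/(le_ball (ltW Ne))/ball_sym.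
exact: (le_ball (ltW Ne)).
Qed.

Variables (U : set 'cV[R]_d) (z0 : 'cV[R]_d).
Hypotheses (oU : open U) (Uz0 : U z0).

(** The inverse of the inclusion of U, extended to the whole space by a constant. *)
Definition point_of (z : 'cV[R]_d) : U :=
  if pselect (U z) is left Uz then SigSub (mem_set Uz) else SigSub (mem_set Uz0).

Lemma val_point_of z : U z -> val (point_of z) = z.
Proof. by rewrite /point_of; case: pselect. Qed.

Lemma point_of_val (x : U) : point_of (val x) = x.
Proof. by apply: val_inj; rewrite val_point_of //; exact: set_valP. Qed.

Lemma val_open_continuous : continuous (val : U -> 'cV[R]_d).
Proof. exact: initial_continuous. Qed.

Lemma open_subset_hausdorff : hausdorff_space U.
Proof.
move=> p q pq; apply: val_inj; apply: (@norm_hausdorff R 'cV[R]_d) => A B pA qB.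
have [y [Ay By]] := pq _ _ (val_open_continuous pA) (val_open_continuous qB).
by exists (val y).
Qed.

Lemma open_subset_second_countable : @second_countable U.
Proof.
have [B cB [Bo Bb]] := cV_second_countable.
exists ((fun A => (val : U -> _) @^-1` A) @` B).
  exact: card_le_trans (card_image_le _ _) cB.
split=> [_ [A /Bo oA <-]|x V]; first by exists A.
rewrite nbhsE => -[V' [[A oA AV'] V'x] V'V].
have /Bb[C /= [BC Cx] CA] : nbhs (val x) A by apply: open_nbhs_nbhs; split=> //; rewrite -AV' in V'x.
exists (val @^-1` C) => /=; first by split=> //; exists C.
by move=> y /CA Ay; apply: V'V; rewrite -AV'.
Qed.

Lemma point_of_continuous z : U z -> {for z, continuous point_of}.
Proof.
move=> Uz A; rewrite nbhsE => -[V' [[B oB BV'] V'z] V'A].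
have Bz : B z by rewrite -(val_point_of Uz); rewrite -BV' in V'z.
have nU : nbhs z U by exact: open_nbhs_nbhs.
have nB : nbhs z B by exact: open_nbhs_nbhs.
apply: filterS2 nU nB => y Uy By; apply: V'A; rewrite -BV' /preimage /=.
by rewrite -(val_point_of Uy) in By.
Qed.

Lemma val_image (A : set U) : [set val x | x in A] = U `&` (point_of @^-1` A).
Proof.
apply/seteqP; split=> [_ [x Ax <-]|z [Uz Az]] /=.
  by rewrite point_of_val; split=> //; exact: set_valP.
by exists (point_of z); rewrite ?val_point_of.
Qed.

Lemma Ck_id k (A : set 'cV[R]_d) : open A -> Ck k A (fun z => z).
Proof. move=> oA; exact: (@Ck_linear R d _ idfun k A oA). Qed.

(** U is a single chart, preferred at each of its points; z0 witnesses that it is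
   nonempty. *)
Definition open_manifold : manifold R d.
Proof.
apply: (@Manifold R d U (fun=> setT) (fun=> val) (fun=> point_of)).
- by exists (point_of z0).
- exact: open_subset_hausdorff.
- exact: open_subset_second_countable.
- by [].
- by move=> _; exact: openT.
- by move=> _; rewrite val_image preimage_setT setIT.
- by move=> _ x _; exact: point_of_val.
- by move=> _ x _; exact: val_open_continuous.
- by move=> _ z; rewrite val_image => -[Uz _]; exact: point_of_continuous.
- move=> _ _ k; rewrite setIT val_image preimage_setT setIT.
  by apply: Ck_ext oU _ (Ck_id k oU) => z Uz; rewrite /= val_point_of.
Defined.

Local Notation M := open_manifold.

(** A field on M as a function on the ambient space, meaningful on U. *)
Definition rep (X : M -> 'cV[R]_d) : 'cV[R]_d -> 'cV[R]_d := fun z => X (point_of z).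
Definition coord (x : M) : 'cV[R]_d := val (x : U).

Lemma pt_in x : U (coord x). Proof. exact: set_valP. Qed.

Lemma rep_pt X x : rep X (coord x) = X x. Proof. by rewrite /rep /coord point_of_val. Qed.

(** All transition maps are the identity, so that tangent vectors have the same
   components at every point. *)
Lemma dchart_open (a y : M) v : dchart a y v = v.
Proof.
rewrite /dchart; have Uy := pt_in y.
have di : is_diff (coord y) id id := is_diff_id (coord y).
have nE : {near coord y, id =1 (val : U -> _) \o point_of}.
  by apply: (open_eq_near oU) => // z Uz; rewrite /= val_point_of.
have [_ E] := near_eq_is_diff (df := idfun) nE di.
by have := congr1 (@^~ v) E.
Qed.

Lemma local_rep_open (a : M) X : local_rep a X = rep X.
Proof. by apply/funext => z; rewrite /local_rep dchart_open. Qed.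

Definition region (W : set M) : set 'cV[R]_d := U `&` (point_of @^-1` W).

Lemma chart_region (a : M) W : [set chart a x | x in chart_dom a `&` W] = region W.
Proof. by rewrite setTI; exact: val_image. Qed.

Lemma region_open W : open W -> open (region W).
Proof.
move=> oW; have [x _] := manifold_nonempty M; rewrite -(chart_region x).
exact: open_chart_image.
Qed.

Lemma region_pt W x : W x -> region W (coord x).
Proof. by move=> Wx; split; [exact: pt_in|rewrite /= /coord point_of_val]. Qed.

Lemma smooth_fieldP W X : smooth_field W X <-> Cinfty (region W) (rep X).
Proof.
split=> [sX k|sX a k]; last by rewrite chart_region local_rep_open; exact: sX.
have [x _] := manifold_nonempty M.
by have := sX x k; rewrite chart_region local_rep_open.
Qed.

Lemma lie_bracket_open X Y x :
  lie_bracket X Y x = 'd (rep Y) (coord x) (X x) - 'd (rep X) (coord x) (Y x).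
Proof. by rewrite /lie_bracket !local_rep_open. Qed.

Lemma smooth_funP W f : smooth_fun W f -> Cinfty (region W) (f \o point_of : _ -> R^o).
Proof.
move=> sf k; have [x _] := manifold_nonempty M.
by have := sf x k; rewrite chart_region.
Qed.

End OpenSubsetManifold.

(** * Connections described by a gauge *)

Section GaugeConnection.
Variables (R : realType) (d : nat) (U : set 'cV[R]_d) (z0 : 'cV[R]_d).
Hypotheses (oU : open U) (Uz0 : U z0).
Local Notation X := 'cV[R]_d.
Local Notation M := (open_manifold oU Uz0).
Local Notation rep := (rep (oU := oU) (Uz0 := Uz0)).
Local Notation region := (region (oU := oU) (Uz0 := Uz0)).
Local Notation pt := (coord (oU := oU) (Uz0 := Uz0)).
Variables (F Finv : X -> 'M[R]_d) (L : X -> {linear X -> 'M[R]_d}).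
Hypotheses (cF : Cinfty U F) (cFinv : Cinfty U Finv).
Hypothesis cL : forall v, Cinfty U (fun z => L z v).
Hypothesis FK : forall z, U z -> Finv z *m F z = 1%:M.
Implicit Types (x : M) (Y Z : M -> X) (W : set M) (u v w : X).

Let FK' z : U z -> F z *m Finv z = 1%:M. Proof. by move=> /FK /mulmx1C. Qed.

Definition gauge_rep Y : X -> X := fun z => Finv z *m rep Y z.

(** The gauge F turns components into vectors; the components of Y are differentiated
   with d + L. *)
Definition gauge_nabla x u Y : X := F (pt x) *m
  ('d (gauge_rep Y) (pt x) u + L (pt x) (Finv (pt x) *m u) *m gauge_rep Y (pt x)).

Let region_sub W : region W `<=` U. Proof. by move=> z []. Qed.

Lemma Ck_region (E : normedModType R) k W (f : X -> E) : Ck k U f -> Ck k (region W) f.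
Proof. exact: Ck_sub. Qed.

Lemma gauge_rep_smooth W Y : open W -> smooth_field W Y -> Cinfty (region W) (gauge_rep Y).
Proof.
move=> oW /smooth_fieldP sY k; have oO := region_open oW.
rewrite /gauge_rep; apply: (Ck_mulmx oO _ (sY k)); exact: Ck_region.
Qed.

Lemma gauge_rep_differentiable W Y z : open W -> smooth_field W Y -> region W z ->
  differentiable (gauge_rep Y) z.
Proof. by move=> oW sY; exact: (Ck_differentiable (gauge_rep_smooth oW sY 1%N)). Qed.

Lemma gauge_linear x Y : smooth_field_near x Y -> linear (fun u => gauge_nabla x u Y).
Proof.
move=> _ k u v; rewrite /gauge_nabla !linearP /= mulmxDl -scalemxAl.
by rewrite addrACA -scalerDr mulmxDr -scalemxAr.
Qed.

Lemma gauge_add x u Y Z : smooth_field_near x Y -> smooth_field_near x Z ->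
  gauge_nabla x u (fun y => Y y + Z y) = gauge_nabla x u Y + gauge_nabla x u Z.
Proof.
move=> [W [oW Wx sY]] [W' [oW' Wx' sZ]].
have dY := gauge_rep_differentiable oW sY (region_pt Wx).
have dZ := gauge_rep_differentiable oW' sZ (region_pt Wx').
have E : gauge_rep (fun y => Y y + Z y) = gauge_rep Y + gauge_rep Z.
  by apply/funext => z; rewrite /gauge_rep /rep mulmxDr.
rewrite /gauge_nabla E -mulmxDr; congr (_ *m _).
apply: (etrans (congr1 (+%R^~ _) (congr1 (@^~ u) (diffD dY dZ)))).
by apply: (etrans (congr1 (+%R _) (mulmxDr _ _ _))); exact: addrACA.
Qed.

Lemma gauge_leibniz x u (f : M -> R) Y : smooth_fun_near x f -> smooth_field_near x Y ->
  gauge_nabla x u (fun y => f y *: Y y) =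
    dirderiv x u f *: Y x + f x *: gauge_nabla x u Y.
Proof.
move=> [W [oW Wx sf]] [W' [oW' Wx' sY]].
have dY := gauge_rep_differentiable oW' sY (region_pt Wx').
pose g := (f \o point_of Uz0) : X -> R^o.
have dg : differentiable g (pt x).
  exact: (Ck_differentiable (smooth_funP sf 1%N) (region_pt Wx)).
have E : gauge_rep (fun y => f y *: Y y) = fun z => g z *: gauge_rep Y z.
  by apply/funext => z; rewrite /gauge_rep /rep -scalemxAr.
rewrite /gauge_nabla E.
apply: (etrans (congr1 (fun t => F _ *m (t + _)) ((is_diffZ dg dY).2 u))).
have gx : g (pt x) = f x by rewrite /g /= /coord point_of_val.
have gYx : F (pt x) *m gauge_rep Y (pt x) = Y x.
  by rewrite /gauge_rep mulmxA FK' ?mul1mx ?rep_pt //; exact: pt_in.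
rewrite gx -[dirderiv x u f]/('d g (pt x) u) -gYx.
move: ('d g (pt x) u) ('d (gauge_rep Y) (pt x) u) (gauge_rep Y (pt x)) (f x) => a b c q.
by rewrite -scalemxAr -addrA -scalerDr mulmxDr -!scalemxAr.
Qed.

Lemma gauge_nabla_rep Y Z z : U z -> rep (fun x => gauge_nabla x (Y x) Z) z =
  F z *m ('d (gauge_rep Z) z (rep Y z) + L z (gauge_rep Y z) *m gauge_rep Z z).
Proof. by move=> Uz; rewrite {1}/rep /gauge_nabla /coord val_point_of. Qed.

Lemma gauge_smooth W Y Z : open W -> smooth_field W Y -> smooth_field W Z ->
  smooth_field W (fun x => gauge_nabla x (Y x) Z).
Proof.
move=> oW sY sZ; have oO := region_open oW; apply/smooth_fieldP => k.
have cY := gauge_rep_smooth oW sY; have cZ := gauge_rep_smooth oW sZ.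
apply: (Ck_ext oO (fun z Oz => esym (gauge_nabla_rep Y Z (region_sub Oz)))).
have /smooth_fieldP rY := sY.
apply: (Ck_mulmx oO); first exact: Ck_region.
apply: (CkD oO); first exact: (Ck_dapp oO (cZ k.+1) (rY k)).
apply: (Ck_mulmx oO _ (cZ k)).
have cLr v : Ck k (region W) (fun z => L z v) by exact: (Ck_region _ (cL v k)).
exact: (@Ck_linapp R d _ k _ L _ oO cLr (cY k)).
Qed.

Definition gauge_connection : connection M :=
  Connection gauge_linear gauge_add gauge_leibniz gauge_smooth.

Local Notation D := gauge_connection.

Section Tensors.
Variables (x : M) (W : set M) (Y Z T : M -> X).
Hypotheses (oW : open W) (Wx : W x).
Hypotheses (sY : smooth_field W Y) (sZ : smooth_field W Z) (sT : smooth_field W T).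
Local Notation p := (pt x).
Local Notation yh := (gauge_rep Y).
Local Notation zh := (gauge_rep Z).
Local Notation th := (gauge_rep T).

Let Op : region W p. Proof. exact: region_pt. Qed.
Let Up : U p. Proof. exact: pt_in. Qed.
Let dyh : differentiable yh p. Proof. exact: gauge_rep_differentiable oW sY Op. Qed.
Let dzh : differentiable zh p. Proof. exact: gauge_rep_differentiable oW sZ Op. Qed.
Let dF : differentiable F p. Proof. exact: (Ck_differentiable (cF 1%N) Up). Qed.

Lemma rep_gauge (A : M -> X) z : U z -> rep A z = F z *m gauge_rep A z.
Proof. by move=> Uz; rewrite /gauge_rep mulmxA FK' // mul1mx. Qed.

Lemma diff_rep (A : M -> X) v : differentiable (gauge_rep A) p ->
  'd (rep A) p v = 'd F p v *m gauge_rep A p + F p *m 'd (gauge_rep A) p v.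
Proof.
move=> dA; have [dP <-] := is_diff_mulmx dF dA.
have nE : {near p, (fun z => F z *m gauge_rep A z) =1 rep A}.
  by apply: (open_eq_near oU Up) => z /rep_gauge ->.
exact/esym/(congr1 (@^~ v) (near_eq_diff nE dP)).
Qed.

(** The bracket of the fields F y and F z with constant components y and z equal to
   those of Y and Z at x. *)
Definition gauge_bracket := 'd F p (Y x) *m zh p - 'd F p (Z x) *m yh p.

Lemma gauge_lie_bracket : lie_bracket Y Z x =
  gauge_bracket + F p *m ('d zh p (Y x) - 'd yh p (Z x)).
Proof.
rewrite lie_bracket_open.
apply: (etrans (f_equal2 (fun a b => a - b) (diff_rep (Y x) dzh) (diff_rep (Z x) dyh))).
have alg (a b c e : X) : a + F p *m b - (c + F p *m e) = a - c + F p *m (b - e).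
  by rewrite mulmxBr opprD addrACA.
exact: alg.
Qed.

Lemma gauge_torsion : torsion D Y Z x =
  F p *m (L p (yh p) *m zh p - L p (zh p) *m yh p) - gauge_bracket.
Proof.
have E (A : M -> X) : Finv p *m A x = gauge_rep A p by rewrite /gauge_rep rep_pt.
rewrite /torsion gauge_lie_bracket /cov /= /gauge_nabla !E.
rewrite opprD addrCA addrC; congr (_ - _).
rewrite -!mulmxBr; congr (_ *m _).
by apply/colP => i; rewrite !mxE; ring.
Qed.

(** dL + [L, L], evaluated on fields with constant components, whose bracket gives
   the last term; the derivatives of the components of Y, Z and T cancel. *)
Lemma gauge_curvature : curvature D Y Z T x = F p *m
  (('d (fun z => L z (zh p)) p (Y x) - 'd (fun z => L z (yh p)) p (Z x) +
    L p (yh p) *m L p (zh p) - L p (zh p) *m L p (yh p) -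
    L p (Finv p *m gauge_bracket)) *m th p).
Proof.
have E (A : M -> X) : Finv p *m A x = gauge_rep A p by rewrite /gauge_rep rep_pt.
have oO := region_open oW.
have cth := gauge_rep_smooth oW sT.
have dth z : region W z -> differentiable th z by exact: (Ck_differentiable (cth 1%N)).
have dth2 v : differentiable (fun z => 'd th z v) p.
  exact: (Ck_differentiable (Ck_diff v (cth 2%N))).
have dL v : differentiable (fun z => L z v) p by exact: (Ck_differentiable (cL v 1%N)).
have second (A B : M -> X) : smooth_field W A -> smooth_field W B ->
    cov D A (cov D B T) x = F p *m
    ('d (fun z => 'd th z (B x)) p (A x) + 'd th p ('d (rep B) p (A x)) +
     ('d (fun z => L z (gauge_rep B p)) p (A x) + L p ('d (gauge_rep B) p (A x))) *m th p +
     L p (gauge_rep B p) *m 'd th p (A x) +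
     L p (gauge_rep A p) *m ('d th p (B x) + L p (gauge_rep B p) *m th p)).
  move=> sA sB; rewrite {1}/cov /= /gauge_nabla E; congr (_ *m _).
  have dB := gauge_rep_differentiable oW sB Op.
  have /smooth_fieldP rB := sB.
  have drB : differentiable (rep B) p by exact: (Ck_differentiable (rB 1%N)).
  pose eta z := 'd th z (rep B z) + L z (gauge_rep B z) *m th z.
  have etaE z : U z -> gauge_rep (cov D B T) z = eta z.
    by move=> Uz; rewrite /gauge_rep /cov /= gauge_nabla_rep // mulmxA FK // mul1mx.
  have [d1 d1E] := is_diff_dapp drB dth2.
  have [d2 d2E] := @is_diff_linapp R d _ L _ p dB dL.
  have [d3 d3E] := is_diff_mulmx d2 (dth p Op).
  have nE : {near p, eta =1 gauge_rep (cov D B T)}.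
    by apply: (open_eq_near oU Up) => z /etaE.
  have deta := differentiableD d1 d3.
  have e1 := d1E (A x); rewrite rep_pt in e1.
  have e3 := etrans (d3E (A x)) (congr1 (fun t => t *m th p + _) (d2E (A x))).
  have e2 := congr1 (@^~ (A x)) (near_eq_diff nE deta).
  have e4 := etrans (congr1 (@^~ (A x)) (diffD d1 d3)) (f_equal2 +%R e1 e3).
  have e5 : gauge_rep (cov D B T) p = 'd th p (B x) + L p (gauge_rep B p) *m th p.
    exact: (etrans (etaE p Up)
      (congr1 (fun t => 'd th p t + L p (gauge_rep B p) *m th p) (rep_pt B x))).
  apply: (etrans (f_equal2 +%R (etrans (esym e2) e4) (congr1 (mulmx _) e5))).
  exact: (congr1 (+%R^~ _) (addrA _ _ _)).
have sym : 'd (fun z => 'd th z (Z x)) p (Y x) = 'd (fun z => 'd th z (Y x)) p (Z x).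
  exact: (schwarz_mx _ _ oO Op (cth 2%N)).
have eb : cov D (lie_bracket Y Z) T x = F p *m
    ('d th p ('d (rep Z) p (Y x)) - 'd th p ('d (rep Y) p (Z x)) +
     (L p (Finv p *m gauge_bracket) + (L p ('d zh p (Y x)) - L p ('d yh p (Z x)))) *m th p).
  have e1 : Finv p *m lie_bracket Y Z x =
      Finv p *m gauge_bracket + ('d zh p (Y x) - 'd yh p (Z x)).
    by rewrite gauge_lie_bracket mulmxDr mulmxA FK // mul1mx.
  have e2 := congr1 (L p) e1; rewrite (linearD (L p)) (linearB (L p)) in e2.
  have e3 : 'd th p (lie_bracket Y Z x) =
      'd th p ('d (rep Z) p (Y x)) - 'd th p ('d (rep Y) p (Z x)).
    apply: (etrans (congr1 ('d th p) (lie_bracket_open Y Z x))).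
    exact: (linearB ('d th p)).
  exact: (f_equal2 (fun a b => F p *m (a + b *m th p)) e3 e2).
apply: (etrans (f_equal2 (fun a b => a - b)
  (f_equal2 (fun a b => a - b) (second Y Z sY sZ) (second Z Y sZ sY)) eb)).
have alg (s1 s2 a1 a2 tY tZ t : X) (dL1 dL2 l1 l2 Lz Ly Lb : 'M[R]_d) : s1 = s2 ->
    F p *m (s1 + a1 + (dL1 + l1) *m t + Lz *m tY + Ly *m (tZ + Lz *m t)) -
    F p *m (s2 + a2 + (dL2 + l2) *m t + Ly *m tZ + Lz *m (tY + Ly *m t)) -
    F p *m (a1 - a2 + (Lb + (l1 - l2)) *m t) =
    F p *m ((dL1 - dL2 + Ly *m Lz - Lz *m Ly - Lb) *m t).
  move=> ->; rewrite -!mulmxBr; congr (_ *m _).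
  rewrite !mulmxDr !mulmxDl !mulNmx -!mulmxA.
  move: (dL1 *m t) (l1 *m t) (dL2 *m t) (l2 *m t) (Lb *m t) (Lz *m tY) (Ly *m tZ)
    (Ly *m (Lz *m t)) (Lz *m (Ly *m t)) => b1 b2 b3 b4 b5 b6 b7 b8 b9.
  by apply/colP => i; rewrite !mxE; ring.
exact: alg sym.
Qed.

End Tensors.

(** The connection form of a section F q of the frame bundle: q^-1 dq + q^-1 L q. *)
Lemma gauge_Lambda x W (s : M -> 'M[R]_d) u : open W -> W x ->
  (forall w, smooth_field W (fun y => s y *m w)) -> s x \in unitmx ->
  let q z := Finv z *m s (point_of Uz0 z) in
  differentiable q (pt x) /\
  q (pt x) *m Lambda D s x u =
    'd q (pt x) (s x *m u) + L (pt x) (q (pt x) *m u) *m q (pt x).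
Proof.
move=> oW Wx ss us q; have oO := region_open oW; have Ox := region_pt Wx.
have qE w : gauge_rep (fun y => s y *m w) = fun z => q z *m w.
  by apply/funext => z; rewrite /gauge_rep /rep mulmxA.
have dq : differentiable q (pt x).
  apply/differentiable_mxP => i j.
  have /differentiable_mxP/(_ i 0) := gauge_rep_differentiable oW (ss (delta_mx j 0)) Ox.
  by rewrite qE; under eq_fun do rewrite -colE mxE.
have sx : s (point_of Uz0 (pt x)) = s x by rewrite /coord point_of_val.
have qx : q (pt x) = Finv (pt x) *m s x by rewrite /q sx.
split=> //; apply/matrixP => i j.
suff E : q (pt x) *m Lambda D s x u *m (delta_mx j 0 : X) =
    ('d q (pt x) (s x *m u) + L (pt x) (q (pt x) *m u) *m q (pt x)) *m delta_mx j 0.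
  by have := congr1 (fun C : X => C i 0) E; rewrite -!colE [LHS]mxE [RHS]mxE.
have -> : q (pt x) *m Lambda D s x u *m (delta_mx j 0 : X) =
    Finv (pt x) *m D x (s x *m u) (fun y => s y *m delta_mx j 0).
  rewrite -mulmxA (_ : Lambda D s x u *m (delta_mx j 0 : X) =
    invmx (s x) *m D x (s x *m u) (fun y => s y *m delta_mx j 0)).
    by rewrite qx !mulmxA -(mulmxA _ _ (invmx _)) mulmxV // mulmx1.
  by rewrite -colE; apply/colP => l; rewrite !mxE.
rewrite /= /gauge_nabla mulmxA FK ?mul1mx; last exact: pt_in.
rewrite qE (mulmxA (Finv _)) -qx mulmxDl -mulmxA; congr (_ + _); last by rewrite mulmxA.
have [_ dE] := is_diff_mulmx dq (differentiable_cst (delta_mx j 0 : X) (pt x)).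
apply: (etrans (dE (s x *m u))); rewrite (diff_cst (delta_mx j 0 : X) (pt x)) /=.
by rewrite mulmx0 addr0.
Qed.

End GaugeConnection.

(** * The Fubini-Study metric in affine coordinates *)

Section FubiniStudyAlgebra.
Variables (R : realType) (n : nat).
Local Notation H := 'cV[R]_(n + n).
Local Notation J := (J0 R n).
Local Notation h := (@h0 R n).
Local Notation om := (@omega0 R n).
Implicit Types (X Y Z W z : H) (c rho : R).

(** The complex rank one map X |-> <X, w> z, for the hermitian product
   <X, w> = h0(X, w) - i omega0(X, w). *)
Definition herm_outer z w : 'M[R]_(n + n) := z *m w^T + J *m z *m (J *m w)^T.

(** Y |-> <X, z> Y + <Y, z> X, the complex bilinear form of a holomorphic projective
   change of connection. *)
Definition proj_form z X : 'M[R]_(n + n) :=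
  (h X z)%:M - om X z *: J + X *m z^T + J *m X *m (J *m z)^T.

(** With rho = 1 / (1 + c |z|^2), the matrix of the Fubini-Study metric at z in an affine
   chart: rho h0(X, Y) - c rho^2 Re (<X, z> <z, Y>). *)
Definition fs_gram c rho z : 'M[R]_(n + n) :=
  rho%:M - (c * rho ^+ 2) *: herm_outer z z.

(** The Christoffel symbols of the metric fs_gram. *)
Definition fs_gamma c rho z X := - (c * rho) *: proj_form z X.

Lemma outerE X Y Z : X *m Y^T *m Z = h Y Z *: X.
Proof.
rewrite -mulmxA (_ : Y^T *m Z = (h Y Z)%:M) ?mul_mx_scalar //.
by apply/matrixP => i j; rewrite !ord1 h0E !mxE eqxx mulr1n.
Qed.

Lemma herm_outerE z w X : herm_outer z w *m X = h X w *: z - om X w *: (J *m z).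
Proof.
by rewrite mulmxDl !outerE (h0C w X) -(omega0E w X) (omega0C X w) scaleNr.
Qed.

Lemma proj_formE z X Y : proj_form z X *m Y =
  h X z *: Y - om X z *: (J *m Y) + h Y z *: X - om Y z *: (J *m X).
Proof.
rewrite !mulmxDl mulNmx mul_scalar_mx -scalemxAl !outerE (h0C z Y) -(omega0E z Y).
by rewrite (omega0C Y z) scaleNr.
Qed.

Lemma fs_gammaE c rho z X Y : fs_gamma c rho z X *m Y = - (c * rho) *:
  (h X z *: Y - om X z *: (J *m Y) + h Y z *: X - om Y z *: (J *m X)).
Proof. by rewrite -scalemxAl proj_formE. Qed.

Lemma fs_gramE c rho z X Y : h X (fs_gram c rho z *m Y) =
  rho * h X Y - c * rho ^+ 2 * (h X z * h Y z + om X z * om Y z).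
Proof.
rewrite mulmxBl mul_scalar_mx -scalemxAl herm_outerE !h0Br !h0Zr h0Br !h0Zr h0Jr.
ring.
Qed.

Lemma proj_form_sym z X Y : proj_form z X *m Y = proj_form z Y *m X.
Proof.
rewrite !proj_formE; apply/colP => i; rewrite !mxE.
move: (\sum_j _) (\sum_j _) => a b; ring.
Qed.

Lemma herm_outer_J z w : herm_outer z w *m J = J *m herm_outer z w.
Proof.
apply: mulmx_ext => X; rewrite -!mulmxA !herm_outerE omega0Jl h0Jl h0Jr opprK.
by rewrite mulmxBr -!scalemxAr J0K scaleNr scalerN !opprK addrC.
Qed.

Lemma proj_form_J z X : proj_form z X *m J = J *m proj_form z X.
Proof.
apply: mulmx_ext => Y; rewrite -!mulmxA !proj_formE omega0Jl h0Jl h0Jr opprK.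
rewrite !mulmxDr !mulmxN -!scalemxAr !J0K.
apply/colP => i; rewrite !mxE; move: (\sum_j _) (\sum_j _) => a b; ring.
Qed.

(** The Fubini-Study metric is parallel: drho is the derivative of rho along W, so the
   left-hand side is the derivative of fs_gram. *)
Lemma fs_gram_parallel c rho z W : let drho := - (2 * c * rho ^+ 2 * h z W) in
  drho%:M - (2 * c * rho * drho) *: herm_outer z z -
    (c * rho ^+ 2) *: (herm_outer W z + herm_outer z W) =
  (fs_gamma c rho z W)^T *m fs_gram c rho z + fs_gram c rho z *m fs_gamma c rho z W.
Proof.
move=> drho; apply: mulmx_ext => Y; apply: h0_inj => X.
rewrite (h0C _ X) [RHS]h0C.
have -> : h X (((fs_gamma c rho z W)^T *m fs_gram c rho z +
    fs_gram c rho z *m fs_gamma c rho z W) *m Y) =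
    h (fs_gamma c rho z W *m X) (fs_gram c rho z *m Y) +
    h X (fs_gram c rho z *m (fs_gamma c rho z W *m Y)).
  by rewrite mulmxDl h0Dr -!mulmxA h0_trmx.
have alg (a b e : R) (C1 C2 C3 : 'M[R]_(n + n)) :
    (a%:M - b *: C1 - e *: (C2 + C3)) *m Y =
    a *: Y - b *: (C1 *m Y) - e *: (C2 *m Y + C3 *m Y).
  by rewrite !mulmxBl mul_scalar_mx -!scalemxAl mulmxDl.
rewrite !fs_gramE alg !herm_outerE.
rewrite !fs_gammaE !(h0Br, h0Dr, h0Nr, h0Zr) !h0Jr.
rewrite !(h0Dl, h0Nl, h0Zl, omega0Dl, omega0Nl, omega0Zl) !(h0Jl, omega0Jl) !h0Jr.
by rewrite /drho (h0C z W) (omega0C Y W) (h0C W Y); ring.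
Qed.

(** The left-hand side is the curvature d Gamma + [Gamma, Gamma]; the right-hand side is
   4 c times the tensor K of the metric g. *)
Lemma fs_curvature c rho z X Y T :
  let drho W := - (2 * c * rho ^+ 2 * h z W) in
  let dgamma W V := - (c * drho W) *: proj_form z V - (c * rho) *: proj_form W V in
  let g V V' := h V (fs_gram c rho z *m V') in
  (dgamma X Y - dgamma Y X + fs_gamma c rho z X *m fs_gamma c rho z Y -
     fs_gamma c rho z Y *m fs_gamma c rho z X) *m T =
  c *: (g Y T *: X - g X T *: Y + g (J *m Y) T *: (J *m X)
        - g (J *m X) T *: (J *m Y) - (2 * g (J *m X) Y) *: (J *m T)).
Proof.
move=> drho dgamma g; rewrite /g !fs_gramE.
have alg (a1 a2 b1 b2 : R) (A1 A2 B1 B2 G1 G2 : 'M[R]_(n + n)) :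
    (a1 *: A1 - b1 *: B1 - (a2 *: A2 - b2 *: B2) + G1 *m G2 - G2 *m G1) *m T =
    a1 *: (A1 *m T) - b1 *: (B1 *m T) - (a2 *: (A2 *m T) - b2 *: (B2 *m T)) +
    G1 *m (G2 *m T) - G2 *m (G1 *m T).
  by rewrite !(mulmxBl, mulmxDl) -!scalemxAl -!mulmxA.
rewrite alg !fs_gammaE !proj_formE.
have JE (a b e f : R) : J *m (- (c * rho) *: (a *: T - b *: (J *m T) + e *: X - f *: (J *m X))) =
   - (c * rho) *: (a *: (J *m T) + b *: T + e *: (J *m X) + f *: X).
  by rewrite -!scalemxAr !(mulmxDr, mulmxN) -!scalemxAr !J0K !scalerN !opprK.
have JE' (a b e f : R) : J *m (- (c * rho) *: (a *: T - b *: (J *m T) + e *: Y - f *: (J *m Y))) =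
   - (c * rho) *: (a *: (J *m T) + b *: T + e *: (J *m Y) + f *: Y).
  by rewrite -!scalemxAr !(mulmxDr, mulmxN) -!scalemxAr !J0K !scalerN !opprK.
rewrite !JE !JE'.
rewrite !(h0Dl, h0Nl, h0Zl, omega0Dl, omega0Nl, omega0Zl) !(h0Jl, omega0Jl, omega0J) !h0Jr.
rewrite /drho !(h0C z) (h0C Y X) (omega0C X Y) ?(h0C T X) ?(h0C T Y) ?(omega0C X T) ?(omega0C Y T).
move: (J *m X) (J *m Y) (J *m T) => JX JY JT.
by apply/colP => i; rewrite !mxE; ring.
Qed.

Lemma lincomb_mulmx a (A B : 'M[R]_(n + n)) (T : H) : (a *: A + B) *m T = a *: (A *m T) + B *m T.
Proof. by rewrite mulmxDl -scalemxAl. Qed.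

Lemma proj_form_linearr z : linear (proj_form z).
Proof.
move=> a X Y; apply: mulmx_ext => T; rewrite lincomb_mulmx !proj_formE.
rewrite h0Dl h0Zl omega0Dl omega0Zl mulmxDr -scalemxAr.
by move: (J *m X) (J *m Y) (J *m T) => JX JY JT; apply/colP => i; rewrite !mxE; ring.
Qed.

Lemma proj_form_linearl X : linear (proj_form^~ X).
Proof.
move=> a z w; apply: mulmx_ext => T; rewrite lincomb_mulmx !proj_formE.
rewrite !h0Dr !h0Zr !omega0Dr !omega0Zr.
by move: (J *m X) (J *m T) => JX JT; apply/colP => i; rewrite !mxE; ring.
Qed.

End FubiniStudyAlgebra.

(** * The homogeneous models: gauge and connection form *)

Section Model.
Variables (R : realType) (n : nat) (t1 t2 t3 c : R).
Hypotheses (t13 : t1 * t3 = 0) (ct1 : c * t1 = 0).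
Local Notation d := (n + n + 1)%N.
Local Notation H := 'cV[R]_(n + n).
Local Notation V := 'cV[R]_d.
Local Notation J := (J0 R n).
Local Notation h := (@h0 R n).
Local Notation om := (@omega0 R n).
Local Notation e := (evec R n).
Implicit Types (X Y Z : H) (u v w z p : V) (a b : R).

Lemma hpart_linear : linear (@hpart R n).
Proof. by move=> a u v; rewrite /hpart linearP. Qed.

Lemma epart_linear : linear (@epart R n : V -> R^o).
Proof. by move=> a u v; rewrite /epart linearP !mxE. Qed.

Lemma inH_tr_inH X Y : (inH X)^T *m inH Y = (h X Y)%:M.
Proof.
rewrite /inH tr_col_mx mul_row_col mulmx0 addr0.
by apply/matrixP => i j; rewrite !ord1 h0E !mxE eqxx mulr1n.
Qed.

Lemma inH_tr_e X : (inH X)^T *m e = 0.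
Proof. by rewrite /inH /evec tr_col_mx mul_row_col mulmx0 trmx0 mul0mx addr0. Qed.

Lemma e_tr_inH X : e^T *m inH X = 0.
Proof. by rewrite /inH /evec tr_col_mx mul_row_col mulmx0 trmx0 mul0mx addr0. Qed.

Lemma e_tr_e : e^T *m e = 1%:M.
Proof. by rewrite /evec tr_col_mx mul_row_col mulmx0 add0r trmx1 mul1mx. Qed.

(** Embeds gl(H_0) into gl(V); ext1 below is the corresponding embedding of GL(H_0). *)
Definition ext0 A : 'M[R]_d := block_mx A 0 0 0.

Lemma ext0_linear : linear ext0.
Proof.
by move=> a A B; rewrite /ext0 scale_block_mx add_block_mx !scaler0 !addr0.
Qed.

HB.instance Definition _ :=
  GRing.isLinear.Build R 'M[R]_(n + n) 'M[R]_d _ ext0 ext0_linear.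

Lemma ext0E A v : ext0 A *m v = inH (A *m hpart v).
Proof.
by rewrite {1}(hpartK v) mulmxDr block_inH -scalemxAr block0_e scaler0 addr0.
Qed.

Lemma mul_ext0 A B : ext0 A *m ext0 B = ext0 (A *m B).
Proof. by rewrite /ext0 mulmx_block !mulmx0 !mul0mx !addr0. Qed.

(** 1 + c |z|^2, where z is the component on H_0: for c nonzero its logarithm is,
   up to a constant factor, a Kaehler potential of the metric. *)
Definition fs_pot z : R^o := 1 + c * h (hpart z) (hpart z).
Definition rho z : R^o := (fs_pot z)^-1.
Definition domain : set V := [set z | 0 < fs_pot z].
Definition drho p w : R := - (2 * c * rho p ^+ 2 * h (hpart p) (hpart w)).

Lemma Ck_hpart k (A : set V) : open A -> Ck k A (@hpart R n).
Proof. exact: Ck_of_linear hpart_linear _ _. Qed.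

Lemma Ck_fs_pot k (A : set V) : open A -> Ck k A fs_pot.
Proof.
move=> oA; have /(Ck_mxP _ _ oA) ch := Ck_hpart k oA.
apply: (CkD oA (Ck_cst k A (1 : R^o)) (CkM oA (Ck_cst k A (c : R^o)) _)).
by apply: (Ck_sum _ oA) => i; exact: (CkM oA (ch i 0) (ch i 0)).
Qed.

Lemma open_domain : open domain.
Proof.
have c2 : continuous fs_pot.
  by move=> z; exact: (Ck_fs_pot 0 openT).
have -> : domain = fs_pot @^-1` [set x : R | 0 < x] by [].
by apply: open_comp => [z _|]; [exact: c2|exact: open_gt].
Qed.

Lemma domain0 : domain 0.
Proof. by rewrite /domain /= /fs_pot /hpart linear0 h00l mulr0 addr0. Qed.

Lemma fs_pot_neq0 z : domain z -> fs_pot z != 0.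
Proof. by move=> z0; rewrite gt_eqF. Qed.

Lemma Ck_rho k : Ck k domain rho.
Proof. exact: (CkV open_domain fs_pot_neq0 (Ck_fs_pot k open_domain)). Qed.

Lemma is_diff_fs_pot p : differentiable fs_pot p /\
  forall w, 'd fs_pot p w = 2 * c * h (hpart p) (hpart w).
Proof.
have [dh hE] := is_diff_of_linear hpart_linear p.
have trl : linear (fun z : V => (hpart z)^T) by move=> a u v; rewrite hpart_linear linearP.
have [dt tE] := is_diff_of_linear trl p.
have [dm mE] := is_diff_mulmx dt dh.
have dN : differentiable (fun z => ((hpart z)^T *m hpart z) 0 0 : R^o) p.
  by have /differentiable_mxP := dm; apply.
have dr : differentiable (fun z => 1 + c * ((hpart z)^T *m hpart z) 0 0 : R^o) p.
  exact: (differentiableD (differentiable_cst (1 : R^o) p)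
    (differentiableM_o (differentiable_cst (c : R^o) p) dN)).
have rE : fs_pot = fun z => 1 + c * ((hpart z)^T *m hpart z) 0 0.
  by apply/funext => z; rewrite /fs_pot h0E.
split; first by rewrite rE.
move=> w; rewrite rE.
have e1 := congr1 (@^~ w) (diffD (differentiable_cst (1 : R^o) p)
  (differentiableM_o (differentiable_cst (c : R^o) p) dN)).
apply: (etrans e1); rewrite /= (diff_cst (1 : R^o) p) add0r.
apply: (etrans (diffM_o w (differentiable_cst (c : R^o) p) dN)).
rewrite (diff_cst (c : R^o) p) mulr0 addr0 (diff_mx w 0 0 dm) mE hE tE.
by rewrite mxE -!h0E (h0C (hpart w)) -[cst c p]/c; ring.
Qed.

Lemma is_diff_rho p : domain p -> differentiable rho p /\ forall w, 'd rho p w = drho p w.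
Proof.
move=> Up; have [dr rE] := is_diff_fs_pot p; split.
  exact: (differentiableV_o dr (fs_pot_neq0 Up)).
move=> w; apply: (etrans (diffV_o w dr (fs_pot_neq0 Up))).
by rewrite rE /drho /rho exprVn; ring.
Qed.

(** A potential of - t3 times the Kaehler form of the metric. *)
Definition theta z X : R := - (t3 / 2 * rho z) * om (hpart z) X.

(** e |-> z, the infinitesimal dilation of H_0 along which the vertical field moves. *)
Definition dilation_part z : 'M[R]_d := inH (hpart z) *m e^T.

(** X |-> omega0(z, X) e, which tilts the horizontal hyperplane. *)
Definition contact_part z : 'M[R]_d := e *m (inH (J *m hpart z))^T.

(** The horizontal lifts X + theta(X) e of vectors of H_0 and the vertical field e - t1 z. *)
Definition model_gauge z : 'M[R]_d :=
  1%:M - t1 *: dilation_part z - (t3 / 2 * rho z) *: contact_part z.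
Local Notation F := model_gauge.
Definition model_gauge_inv z : 'M[R]_d :=
  1%:M + t1 *: dilation_part z + (t3 / 2 * rho z) *: contact_part z.

Local Notation Finv := model_gauge_inv.

Lemma dilation_partE z v : dilation_part z *m v = epart v *: inH (hpart z).
Proof.
rewrite /dilation_part -mulmxA {1}(hpartK v) mulmxDr e_tr_inH add0r -scalemxAr e_tr_e.
by rewrite scale_scalar_mx mulr1 mul_mx_scalar.
Qed.

Lemma contact_partE z v : contact_part z *m v = om (hpart z) (hpart v) *: e.
Proof.
rewrite /contact_part -mulmxA {1}(hpartK v) mulmxDr inH_tr_inH -scalemxAr inH_tr_e.
by rewrite scaler0 addr0 mul_mx_scalar.
Qed.

Lemma FE z v : F z *m v = inH (hpart v - (t1 * epart v) *: hpart z) +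
  (epart v + theta z (hpart v)) *: e.
Proof.
rewrite !mulmxBl mul1mx -!scalemxAl dilation_partE contact_partE {1}(hpartK v) inHB inHZ !scalerA.
by rewrite scalerDl /theta mulNr scaleNr [RHS]addrA; congr (_ - _); exact: addrAC.
Qed.

Lemma FinvE z v : Finv z *m v = inH (hpart v + (t1 * epart v) *: hpart z) +
  (epart v - theta z (hpart v)) *: e.
Proof.
rewrite !mulmxDl mul1mx -!scalemxAl dilation_partE contact_partE {1}(hpartK v) inHD inHZ !scalerA.
by rewrite scalerBl /theta mulNr scaleNr opprK [RHS]addrA; congr (_ + _); exact: addrAC.
Qed.

Let t1theta z X a : t1 * (a * theta z X) = 0.
Proof. by rewrite /theta; ring: t13. Qed.

(** The two corrections square to zero; one of their products vanishes because
   omega0(z, z) = 0, and the other carries the factor t1 t3. *)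
Lemma FK z : Finv z *m F z = 1%:M.
Proof.
apply: mulmx_ext => v; rewrite mul1mx -mulmxA FE FinvE hpart_inH epart_inH.
rewrite [in RHS](hpartK v) mulrDr -[theta z (hpart v)]mul1r t1theta addr0 subrK mul1r.
congr (_ + _ *: _); rewrite -[RHS]addr0 -addrA; congr (_ + _).
rewrite /theta !(omega0E _ (_ - _)) h0Br h0Zr -!omega0E omega0XX !mulr0 subr0.
by rewrite subrr.
Qed.

Lemma dilation_part_linear : linear dilation_part.
Proof. by move=> a u v; rewrite /dilation_part hpart_linear inHD inHZ mulmxDl scalemxAl. Qed.

Lemma contact_part_linear : linear contact_part.
Proof.
move=> a u v; rewrite /contact_part hpart_linear mulmxDr -scalemxAr inHD inHZ linearP /=.
by rewrite mulmxDr -scalemxAr.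
Qed.

Lemma Ck_F k : Ck k domain F.
Proof.
have oU := open_domain.
have cA := Ck_of_linear dilation_part_linear k oU; have cB := Ck_of_linear contact_part_linear k oU.
have cs : Ck k domain (fun z => - (t3 / 2 * rho z) : R^o).
  by apply: (CkN oU); exact: (CkM oU (Ck_cst k _ (t3 / 2 : R^o)) (Ck_rho k)).
apply: (Ck_ext oU _ (CkD oU (CkD oU (Ck_cst k _ 1%:M)
  (CkZ oU (Ck_cst k _ (- t1 : R^o)) cA)) (CkZ oU cs cB))) => z _.
by rewrite !scaleNr.
Qed.

Lemma Ck_Finv k : Ck k domain Finv.
Proof.
have oU := open_domain.
have cA := Ck_of_linear dilation_part_linear k oU; have cB := Ck_of_linear contact_part_linear k oU.
have cs : Ck k domain (fun z => t3 / 2 * rho z : R^o).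
  exact: (CkM oU (Ck_cst k _ (t3 / 2 : R^o)) (Ck_rho k)).
exact: (CkD oU (CkD oU (Ck_cst k _ 1%:M) (CkZ oU (Ck_cst k _ (t1 : R^o)) cA)) (CkZ oU cs cB)).
Qed.

Definition dtheta p w X : R :=
  - (t3 / 2) * (drho p w * om (hpart p) X + rho p * om (hpart w) X).

Lemma diff_F p w v : domain p ->
  'd F p w *m v = inH (- (t1 * epart v) *: hpart w) + dtheta p w (hpart v) *: e.
Proof.
move=> Up; have [dA AE] := is_diff_of_linear dilation_part_linear p.
have [dB BE] := is_diff_of_linear contact_part_linear p.
have [dr rE] := is_diff_rho Up.
have ds := differentiableM_o (differentiable_cst (t3 / 2 : R^o) p) dr.
have sE : 'd (fun z => t3 / 2 * rho z : R^o) p w = t3 / 2 * drho p w.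
  apply: (etrans (diffM_o w (differentiable_cst (t3 / 2 : R^o) p) dr)).
  by rewrite rE (diff_cst (t3 / 2 : R^o) p) mulr0 addr0.
have [dsB sBE] := is_diffZ ds dB.
have [dtA tAE] := is_diffZ (differentiable_cst (t1 : R^o) p) dA.
have d1 := differentiable_cst (1%:M : 'M[R]_d) p.
have e1 := congr1 (@^~ w) (diffB (differentiableB d1 dtA) dsB).
have e2 := congr1 (@^~ w) (diffB d1 dtA).
have e3 : 'd F p w = 0 - (0 *: dilation_part p + t1 *: dilation_part w) -
    ((t3 / 2 * drho p w) *: contact_part p + (t3 / 2 * rho p) *: contact_part w).
  apply: (etrans e1); apply: (f_equal2 (fun x y => x - y)).
    apply: (etrans e2); apply: (f_equal2 (fun x y => x - y)).
      by rewrite (diff_cst (1%:M : 'M[R]_d) p).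
    by apply: (etrans (tAE w)); rewrite (diff_cst (t1 : R^o) p) AE.
  by apply: (etrans (sBE w)); rewrite sE BE.
rewrite e3 scale0r !add0r mulmxBl mulNmx mulmxDl -!scalemxAl dilation_partE !contact_partE /dtheta.
rewrite !scaleNr inHN !inHZ !scalerA -scalerDl mulNr mulrDr !mulrA scaleNr.
by [].
Qed.

(** X + b e |-> Gamma(X) - t2 b J on H_0, for the Levi-Civita connection Gamma of the
   metric. *)
Definition connection_form z v : 'M[R]_d :=
  ext0 (fs_gamma c (rho z) (hpart z) (hpart v) - (t2 * epart v) *: J).

Lemma connection_form_linear z : linear (connection_form z).
Proof.
move=> a u v; rewrite /connection_form hpart_linear epart_linear /fs_gamma proj_form_linearr.
rewrite -linearP; congr ext0.
rewrite (_ : a *: epart u = a * epart u) //.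
move: (proj_form (hpart z) (hpart u)) (proj_form (hpart z) (hpart v)) => A B.
by apply/matrixP => i j; rewrite !mxE; ring.
Qed.

HB.instance Definition _ z :=
  GRing.isLinear.Build R V 'M[R]_d _ (connection_form z) (connection_form_linear z).

Definition model_form z : {linear V -> 'M[R]_d} := connection_form z.
Local Notation Lam := model_form.

Lemma LamE z v w : Lam z v *m w = inH (fs_gamma c (rho z) (hpart z) (hpart v) *m hpart w -
  (t2 * epart v) *: (J *m hpart w)).
Proof. apply: (etrans (ext0E _ _)); congr inH.
exact: (etrans (mulmxBl _ _ _) (congr1 (fun x => _ - x) (esym (scalemxAl _ _ _)))). Qed.

Lemma ext0_proj_form_linear X : linear (fun z => ext0 (proj_form (hpart z) X)).
Proof. by move=> a z w; rewrite hpart_linear proj_form_linearl linearP. Qed.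

Let ext0D A B : ext0 (A + B) = ext0 A + ext0 B. Proof. exact: linearD. Qed.
Let ext0B A B : ext0 (A - B) = ext0 A - ext0 B. Proof. exact: linearB. Qed.
Let ext0Z a A : ext0 (a *: A) = a *: ext0 A. Proof. exact: linearZ. Qed.

Let LamZ v z : Lam z v = - (c * rho z) *: ext0 (proj_form (hpart z) (hpart v)) +
  ext0 (- (t2 * epart v) *: J).
Proof. rewrite -ext0Z -ext0D; by congr ext0; congr (_ + _); rewrite scaleNr. Qed.

Lemma Ck_Lam k v : Ck k domain (fun z => Lam z v).
Proof.
have oU := open_domain.
have cl := Ck_of_linear (ext0_proj_form_linear (hpart v)) k oU.
have cs : Ck k domain (fun z => - (c * rho z) : R^o).
  by apply: (CkN oU); exact: (CkM oU (Ck_cst k _ (c : R^o)) (Ck_rho k)).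
apply: (Ck_ext oU _ (CkD oU (CkZ oU cs cl) (Ck_cst k _ (ext0 (- (t2 * epart v) *: J))))) => z _.
exact: esym (LamZ v z).
Qed.

Definition dgamma p X Y : 'M[R]_(n + n) :=
  - (c * - (2 * c * rho p ^+ 2 * h (hpart p) X)) *: proj_form (hpart p) Y
  - (c * rho p) *: proj_form X Y.

Lemma diff_Lam p w v : domain p ->
  'd (fun z => Lam z v) p w = ext0 (dgamma p (hpart w) (hpart v)).
Proof.
move=> Up; have [dl lE] := is_diff_of_linear (ext0_proj_form_linear (hpart v)) p.
have [dr rE] := is_diff_rho Up.
have dcr := differentiableM_o (differentiable_cst (- c : R^o) p) dr.
have crE : 'd (fun z => - c * rho z : R^o) p w = - c * drho p w.
  apply: (etrans (diffM_o w (differentiable_cst (- c : R^o) p) dr)).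
  by rewrite rE (diff_cst (- c : R^o) p) mulr0 addr0.
have [dm mE] := is_diffZ dcr dl.
have fE : (fun z => Lam z v) = fun z =>
    (- c * rho z) *: ext0 (proj_form (hpart z) (hpart v)) + ext0 (- (t2 * epart v) *: J).
  by apply/funext => z; rewrite LamZ mulNr.
rewrite fE; move: (ext0 (- (t2 * epart v) *: J)) => C {fE}.
have e1 := congr1 (@^~ w) (diffD dm (differentiable_cst C p)).
have e2 := congr1 (@^~ w) (diff_cst C p).
apply: (etrans e1); apply: (etrans (f_equal2 +%R (mE w) e2)).
apply: (etrans (addr0 _)); rewrite crE lE -!ext0Z -ext0D; congr ext0.
by rewrite /dgamma /drho mulNr mulrN !mulNr !scaleNr.
Qed.

(** * Torsion and curvature of the models *)

Definition gram z : 'M[R]_(n + n) := fs_gram c (rho z) (hpart z).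

(** The Fubini-Study metric at z. *)
Definition herm z X Y : R := h X (gram z *m Y).

Let hermE z X Y : herm z X Y =
  rho z * h X Y - c * rho z ^+ 2 * (h X (hpart z) * h Y (hpart z) + om X (hpart z) * om Y (hpart z)).
Proof. exact: fs_gramE. Qed.

Let sub_inH_e X Y Z a b k : X - Y = Z -> a - b = k ->
  inH X + a *: e - (inH Y + b *: e) = inH Z + k *: e.
Proof. by move=> <- <-; rewrite inHB scalerBl opprD addrACA. Qed.

(** The H_0-component comes from the dilation and the e-component from
   d theta = - t3 omega_g; the cross terms have the factor t1 t3. *)
Lemma model_bracket p y z : domain p ->
  'd F p (F p *m y) *m z - 'd F p (F p *m z) *m y =
  inH (t1 *: (epart y *: hpart z - epart z *: hpart y)) +
    (- (t3 * herm p (J *m hpart y) (hpart z))) *: e.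
Proof.
move=> Up; rewrite !diff_F // hermE /dtheta /drho !FE !hpart_inH.
move: (hpart y) (hpart z) (epart y) (epart z) (hpart p) (rho p) => Y Z b b' P r.
apply: sub_inH_e; first by apply/colP => i; rewrite !mxE; ring.
rewrite !(h0Dr, h0Nr, h0Zr) !(omega0Dl, omega0Nl, omega0Zl).
rewrite omega0Jl !h0Jl !h0Jr (h0C Y P) (h0C Z P) (omega0C P Z) (omega0C P Y) (omega0C Y Z).
by field: t13.
Qed.

Lemma thetaD z X Y : theta z (X + Y) = theta z X + theta z Y.
Proof. by rewrite /theta omega0Dr mulrDr. Qed.

Lemma thetaZ z a X : theta z (a *: X) = a * theta z X.
Proof. by rewrite /theta omega0Zr mulrCA. Qed.

Lemma F_inH_e z X a : F z *m (inH X + a *: e) =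
  inH (X - (t1 * a) *: hpart z) + (a + theta z X) *: e.
Proof. by rewrite FE hpart_inH epart_inH. Qed.

Lemma F_inH z X : F z *m inH X = inH X + theta z X *: e.
Proof. by have := F_inH_e z X 0; rewrite mulr0 !scale0r subr0 addr0 add0r. Qed.

(** Gamma is symmetric, so that L contributes the terms in t2 only. *)
Lemma model_torsion p y z : domain p ->
  F p *m (Lam p y *m z - Lam p z *m y) -
    ('d F p (F p *m y) *m z - 'd F p (F p *m z) *m y) =
  F p *m (inH (epart z *: (t1 *: hpart y + t2 *: (J *m hpart y)) -
               epart y *: (t1 *: hpart z + t2 *: (J *m hpart z))) +
          (t3 * herm p (J *m hpart y) (hpart z)) *: e).
Proof.
move=> Up; rewrite model_bracket // !LamE -inHB.
have sym : fs_gamma c (rho p) (hpart p) (hpart y) *m hpart z =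
    fs_gamma c (rho p) (hpart p) (hpart z) *m hpart y.
  exact: (etrans (esym (scalemxAl _ _ _)) (etrans (congr1 _ (proj_form_sym _ _ _)) (scalemxAl _ _ _))).
have thetaN X : theta p (- X) = - theta p X by rewrite -scaleN1r thetaZ mulN1r.
have t1th X : t1 * theta p X = 0 by rewrite -[theta p X]mul1r t1theta.
rewrite F_inH_e F_inH sym.
move: (fs_gamma c (rho p) (hpart p) (hpart z) *m hpart y) (herm p _ _) => W g.
apply: sub_inH_e.
  move: (hpart y) (hpart z) (hpart p) => Y Z P; move: (J *m Y) (J *m Z) => JY JZ.
  by apply/colP => i; rewrite !mxE; ring: t13.
rewrite !(thetaD, thetaN, thetaZ).
have tY := t1th (hpart y); have tZ := t1th (hpart z).
by rewrite tY tZ; ring.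
Qed.

(** The terms - t2 b J of L commute with Gamma, which is complex linear, and leave the
   commutator unchanged. *)
Let comm_shift (A B : 'M[R]_(n + n)) a b : A *m J = J *m A -> B *m J = J *m B ->
  (A - a *: J) *m (B - b *: J) - (B - b *: J) *m (A - a *: J) = A *m B - B *m A.
Proof.
move=> AJ BJ; rewrite !(mulmxBl, mulmxBr) -!scalemxAl -!scalemxAr AJ BJ !scalerA (mulrC b a).
move: (A *m B) (B *m A) (J *m A) (J *m B) (J *m J) => M1 M2 M3 M4 M5.
by apply/matrixP => i j; rewrite !mxE; ring.
Qed.

Let curv_alg (D1 D2 : 'M[R]_d) (A1 A2 Ly Lz N : 'M[R]_(n + n)) (L' : 'M[R]_d) w :
  D1 = ext0 A1 -> D2 = ext0 A2 -> L' = ext0 N ->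
  (D1 - D2 + ext0 Ly *m ext0 Lz - ext0 Lz *m ext0 Ly - L') *m w =
  inH ((A1 - A2 + Ly *m Lz - Lz *m Ly) *m hpart w - N *m hpart w).
Proof.
move=> -> -> ->; rewrite !mul_ext0 -ext0B -ext0D -!ext0B ext0E.
by rewrite mulmxBl.
Qed.

(** The curvature of the metric, minus the value t2 t3 omega_g J of L on the
   e-component of the bracket; since t1 c = 0, moving z along the vertical field does
   not change Gamma. *)
Lemma model_curvature p y z w : domain p ->
  ('d (fun x => Lam x z) p (F p *m y) - 'd (fun x => Lam x y) p (F p *m z) +
   Lam p y *m Lam p z - Lam p z *m Lam p y -
   Lam p (Finv p *m ('d F p (F p *m y) *m z - 'd F p (F p *m z) *m y))) *m w =
  inH (c *: (herm p (hpart z) (hpart w) *: hpart y - herm p (hpart y) (hpart w) *: hpart z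
        + herm p (J *m hpart z) (hpart w) *: (J *m hpart y)
        - herm p (J *m hpart y) (hpart w) *: (J *m hpart z)
        - (2 * herm p (J *m hpart y) (hpart z)) *: (J *m hpart w))
       - (t2 * t3 * herm p (J *m hpart y) (hpart z)) *: (J *m hpart w)).
Proof.
move=> Up.
have dW u v : dgamma p (hpart (F p *m u)) (hpart v) = dgamma p (hpart u) (hpart v).
  rewrite FE hpart_inH /dgamma h0Dr h0Nr h0Zr.
  have -> : proj_form (hpart u - (t1 * epart u) *: hpart p) (hpart v) =
      proj_form (hpart u) (hpart v) - (t1 * epart u) *: proj_form (hpart p) (hpart v).
    by rewrite addrC -scaleNr proj_form_linearl scaleNr addrC.
  move: (proj_form (hpart u) _) (proj_form _ _) => A B.
  by apply/matrixP => i j; rewrite !mxE; ring: ct1.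
have e1 := etrans (diff_Lam (F p *m y) z Up) (congr1 ext0 (dW y z)).
have e2 := etrans (diff_Lam (F p *m z) y Up) (congr1 ext0 (dW z y)).
have e3 : Lam p (Finv p *m ('d F p (F p *m y) *m z - 'd F p (F p *m z) *m y)) =
    ext0 ((t2 * t3 * herm p (J *m hpart y) (hpart z)) *: J).
  apply: (etrans (congr1 (fun x => Lam p (Finv p *m x)) (model_bracket y z Up))).
  rewrite FinvE [Lam p _]/(ext0 _) !(hpart_inH, epart_inH).
  have pz X : proj_form (hpart p) (t1 *: X) = t1 *: proj_form (hpart p) X.
    have := proj_form_linearr (hpart p) (t1 - 1) X X.
    by rewrite !scalerBl !scale1r !subrK.
  have gz X Y a : fs_gamma c (rho p) (hpart p) (t1 *: X + (t1 * a) *: Y) = 0.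
    rewrite -scalerA -scalerDr /fs_gamma pz scalerA.
    by rewrite mulrC mulrN mulrA [t1 * c]mulrC ct1 mul0r oppr0 scale0r.
  have t1th X : t1 * theta p X = 0 by rewrite -[theta p X]mul1r t1theta.
  rewrite gz sub0r thetaZ t1th subr0 -scaleNr; congr (ext0 (_ *: J)).
  by rewrite mulrN opprK mulrA.
have gJ X : fs_gamma c (rho p) (hpart p) X *m J = J *m fs_gamma c (rho p) (hpart p) X.
  exact: (etrans (esym (scalemxAl _ _ _)) (etrans (congr1 _ (proj_form_J _ _)) (scalemxAr _ _ _))).
apply: (etrans (curv_alg _ _ _ e1 e2 e3)); congr inH.
apply: (f_equal2 (fun a b : H => a - b)); last exact: esym (scalemxAl _ _ _).
rewrite -[X in X *m _]addrA (comm_shift _ _ (gJ (hpart y)) (gJ (hpart z))) addrA.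
exact: fs_curvature.
Qed.

(** * Unitary frames of the models *)

Definition herm_frames z : set 'M[R]_(n + n) :=
  [set Q | Q^T *m gram z *m Q = 1%:M /\ Q *m J = J *m Q].

Definition outer z : 'M[R]_(n + n) := herm_outer (hpart z) (hpart z).
Definition sqrt_pot z : R^o := Num.sqrt (fs_pot z).

(** The positive square root of the inverse of gram z, which gives a global smooth
   section of the unitary frames. *)
Definition sqrt_frame z : 'M[R]_(n + n) := sqrt_pot z *: (1%:M + (c / (1 + sqrt_pot z)) *: outer z).

Lemma outer_tr z : (outer z)^T = outer z.
Proof. by rewrite /outer /herm_outer linearD /= !trmx_mul !trmxK. Qed.

Lemma outer_outer z : outer z *m outer z = h (hpart z) (hpart z) *: outer z.
Proof.
apply: mulmx_ext => X; rewrite -mulmxA -scalemxAl !herm_outerE.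
rewrite !(h0Dl, h0Nl, h0Zl) !(omega0Dl, omega0Nl, omega0Zl) omega0XX !omega0Jl h0Jl h0Jr omega0XX.
move: (hpart z) => P; move: (J *m P) => JP.
by apply/colP => i; rewrite !mxE; ring.
Qed.

Lemma gramE z : gram z = (rho z)%:M - (c * rho z ^+ 2) *: outer z.
Proof. by []. Qed.

Lemma gram_tr z : (gram z)^T = gram z.
Proof. by rewrite gramE linearB linearZ /= tr_scalar_mx outer_tr. Qed.

Lemma outer_J z : outer z *m J = J *m outer z.
Proof. exact: herm_outer_J. Qed.

Lemma gram_J z : gram z *m J = J *m gram z.
Proof.
rewrite gramE mulmxBl mulmxBr -scalemxAl -scalemxAr outer_J.
by rewrite mul_scalar_mx mul_mx_scalar.
Qed.

Lemma sqrt_frame_frame z : domain z -> herm_frames z (sqrt_frame z).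
Proof.
move=> Uz; have r0 : 0 < fs_pot z := Uz.
have s0 : 0 < sqrt_pot z by rewrite sqrtr_gt0.
have sE : sqrt_pot z ^+ 2 = fs_pot z by rewrite sqr_sqrtr // ltW.
split; last first.
  rewrite -scalemxAl -scalemxAr mulmxDl mulmxDr mul1mx mulmx1.
  by rewrite -scalemxAl -scalemxAr outer_J.
have q0T : (sqrt_frame z)^T = sqrt_frame z by rewrite linearZ /= linearD /= trmx1 linearZ /= outer_tr.
have gE : gram z = rho z *: 1%:M - (c * rho z ^+ 2) *: outer z.
  by rewrite gramE scale_scalar_mx mulr1.
have alg (a b a' b' : R) : (a *: 1%:M + b *: outer z) *m (a' *: 1%:M + b' *: outer z) =
    (a * a') *: 1%:M + (a * b' + a' * b + b * b' * h (hpart z) (hpart z)) *: outer z.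
  rewrite mulmxDl !mulmxDr -!scalemxAl -!scalemxAr outer_outer mul1mx mulmx1.
  by rewrite mul1mx !scalerA -!addrA; congr (_ + _); rewrite -!scalerDl; congr (_ *: _); ring.
have q0E : sqrt_frame z = sqrt_pot z *: 1%:M + (sqrt_pot z * (c / (1 + sqrt_pot z))) *: outer z.
  by rewrite /sqrt_frame scalerDr scalerA.
rewrite q0T q0E gE -scaleNr !alg.
(* with a = c / (1 + s) and s^2 = 1 + c |z|^2 one has 2 a + a^2 |z|^2 = c, so that the
   square of the frame is s^2 (1 + c C) for C = outer z; this inverts gram z *)
have cN : c * h (hpart z) (hpart z) = sqrt_pot z ^+ 2 - 1 by rewrite sE /fs_pot addrC addKr.
have rE : rho z = (sqrt_pot z ^+ 2)^-1 by rewrite sE.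
have s1 : 1 + sqrt_pot z != 0 by rewrite gt_eqF // addr_gt0.
have sn0 : sqrt_pot z != 0 by rewrite gt_eqF.
rewrite rE; set a := (X in X *: 1%:M + _); set b := (X in _ + X *: _).
have -> : a = 1 by rewrite /a; field.
have -> : b = 0 by rewrite /b; field: cN; rewrite s1.
by rewrite scale1r scale0r addr0.
Qed.

Definition ext1 Q : 'M[R]_d := block_mx Q 0 0 1%:M.

Lemma mul_ext1 A B : ext1 A *m ext1 B = ext1 (A *m B).
Proof. by rewrite /ext1 mulmx_block !mulmx0 !mul0mx !addr0 !add0r mulmx1. Qed.

Lemma ext11 : ext1 1%:M = 1%:M.
Proof. by rewrite /ext1 -scalar_mx_block. Qed.

Lemma ext1_ext0 Q : ext1 Q = ext0 Q + block_mx 0 0 0 1%:M.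
Proof. by rewrite /ext1 /ext0 add_block_mx !addr0 !add0r. Qed.

Lemma ext1E Q X a : ext1 Q *m (inH X + a *: e) = inH (Q *m X) + a *: e.
Proof. by rewrite mulmxDr block_inH -scalemxAr block1_e. Qed.

Lemma ext0_e A : ext0 A *m e = 0. Proof. exact: block0_e. Qed.

Lemma Ck_outer k : Ck k domain outer.
Proof.
have oU := open_domain.
have lJ : linear (fun z => J *m hpart z) by move=> a u v; rewrite hpart_linear mulmxDr -scalemxAr.
have tr (f : V -> H) : linear f -> linear (fun z => (f z)^T).
  by move=> lf a u v; rewrite lf linearP.
apply: (CkD oU); apply: (Ck_mulmx oU).
- exact: (Ck_of_linear hpart_linear).
- exact: (Ck_of_linear (tr _ hpart_linear)).
- exact: (Ck_of_linear lJ).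
- exact: (Ck_of_linear (tr _ lJ)).
Qed.

Lemma Ck_ext1_sqrt_frame k : Ck k domain (fun z => ext1 (sqrt_frame z)).
Proof.
have oU := open_domain.
have cs : Ck k domain sqrt_pot by exact: (Ck_sqrt oU _ (Ck_fs_pot k oU)).
have cs1 : Ck k domain (fun z => c / (1 + sqrt_pot z) : R^o).
  apply: (CkM oU (Ck_cst k _ (c : R^o))); apply: (CkV oU).
    by move=> z _; rewrite gt_eqF // ltr_pwDl // sqrtr_ge0.
  exact: (CkD oU (Ck_cst k _ (1 : R^o)) cs).
have cq : Ck k domain sqrt_frame.
  exact: (CkZ oU cs (CkD oU (Ck_cst k _ 1%:M) (CkZ oU cs1 (Ck_outer k)))).
have ci : Ck k domain (fun z => ext0 (sqrt_frame z)).
  pose Li : {linear 'M[R]_(n + n) -> 'M[R]_d} := ext0.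
  exact: (Ck_lin (@mx_linear_continuous R _ _ 'M[R]_d Li) oU cq).
apply: (Ck_ext oU _ (CkD oU ci (Ck_cst k _ (block_mx 0 0 0 1%:M)))) => z _.
by rewrite ext1_ext0.
Qed.

Local Notation M := (open_manifold open_domain domain0).
Local Notation pt := (coord (oU := open_domain) (Uz0 := domain0)).

Definition model_connection : connection M :=
  gauge_connection open_domain domain0 Ck_F Ck_Finv (fun v k => Ck_Lam k v) (fun z _ => FK z).
Local Notation D := model_connection.

Let ptU (x : M) : domain (pt x). Proof. exact: pt_in. Qed.

Definition unitary_frames (x : M) : set 'M[R]_d :=
  [set F (pt x) *m ext1 Q | Q in herm_frames (pt x)].

Let FK' z : F z *m Finv z = 1%:M. Proof. exact: mulmx1C (FK z). Qed.

Lemma F_unit z : F z \in unitmx. Proof. by have [] := mulmx1_unit (FK' z). Qed.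

Lemma ext1_unit z Q : herm_frames z Q -> ext1 Q \in unitmx.
Proof.
move=> [QS _]; have := mul_ext1 (Q^T *m gram z) Q; rewrite QS ext11.
by move=> /mulmx1_unit[].
Qed.

Lemma herm_framesMr z Q A : herm_frames z Q -> Un A -> herm_frames z (Q *m A).
Proof.
move=> [QS QJ] [AA AJ]; split; last by rewrite -mulmxA AJ mulmxA QJ mulmxA.
have -> : (Q *m A)^T *m gram z *m (Q *m A) = A^T *m (Q^T *m gram z *m Q) *m A.
  by rewrite trmx_mul !mulmxA.
by rewrite QS mulmx1.
Qed.

Lemma herm_frames_ratio z Q Q' : herm_frames z Q -> herm_frames z Q' ->
  exists2 A, Un A & Q' = Q *m A.
Proof.
move=> [QS QJ] [QS' QJ']; have QS1 := mulmx1C QS.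
have QtJ : Q^T *m J = J *m Q^T.
  by have := congr1 trmx QJ; rewrite !trmx_mul tr_J0 mulNmx mulmxN => /oppr_inj ->.
exists (Q^T *m gram z *m Q'); last by rewrite !mulmxA in QS1 *; rewrite QS1 mul1mx.
split; last by rewrite -!mulmxA QJ' (mulmxA _ J) gram_J !mulmxA QtJ.
have -> : (Q^T *m gram z *m Q')^T *m (Q^T *m gram z *m Q') =
    Q'^T *m gram z *m (Q *m (Q^T *m gram z)) *m Q'.
  by rewrite !trmx_mul trmxK gram_tr !mulmxA.
by rewrite QS1 mulmx1.
Qed.

(** Two unitary frames differ by the unitary matrix Q^T g Q. *)
Lemma unitary_frames_Gstructure : Gstructure (@Un1 R n) unitary_frames.
Proof.
split.
- by move=> x p [Q hQ <-]; rewrite unitmx_mul F_unit (ext1_unit hQ).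
- move=> x _ [Q hQ <-]; apply/seteqP; split=> _ [Q' hQ' <-] /=.
    have [A UA ->] := herm_frames_ratio hQ hQ'.
    by exists (ext1 A); [exists A|rewrite -mulmxA mul_ext1].
  case: hQ' => A UA <-; exists (Q *m A); first exact: herm_framesMr.
  by rewrite -mulmxA -mul_ext1.
- move=> x; exists setT, (fun y => F (pt y) *m ext1 (sqrt_frame (pt y))); split=> //; split.
  + exact: openT.
  + by move=> y _; exists (sqrt_frame (pt y)) => //; exact: sqrt_frame_frame.
  + move=> w; apply/smooth_fieldP => k.
    have oO : open (region (oU := open_domain) (Uz0 := domain0) setT) := region_open openT.
    have sub : region (oU := open_domain) (Uz0 := domain0) setT `<=` domain by move=> z [].
    have c1 := Ck_mulmx open_domain (Ck_mulmx open_domain (Ck_F k) (Ck_ext1_sqrt_frame k))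
      (Ck_cst k domain w).
    refine (Ck_ext oO _ (Ck_sub sub c1)).
    by move=> z [Uz _]; rewrite /rep /coord val_point_of.
Qed.

(** * The characteristic tensors of the models *)

Definition torsion_tensor u v : V :=
  inH (epart v *: (t1 *: hpart u + t2 *: (J *m hpart u)) -
       epart u *: (t1 *: hpart v + t2 *: (J *m hpart v))) +
  (t3 * om (hpart u) (hpart v)) *: e.

(** K4 X Y is the endomorphism Z |-> 4 K X Y Z. *)
Definition K4 X Y : 'M[R]_(n + n) :=
  X *m Y^T - Y *m X^T + J *m X *m (J *m Y)^T - J *m Y *m (J *m X)^T - (2 * om X Y) *: J.

Definition curvature_tensor u v : 'M[R]_d :=
  ext0 (c *: K4 (hpart u) (hpart v) - (t2 * t3 * om (hpart u) (hpart v)) *: J).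

Lemma K4E X Y Z : K4 X Y *m Z = 4 *: K X Y Z.
Proof.
rewrite /K4 /K 2!mulmxBl 2!mulmxDl !mulNmx -!scalemxAl !outerE scalerA mulfV ?pnatr_eq0 //.
by rewrite scale1r -!omega0E.
Qed.

Lemma curvature_tensorE u v w : curvature_tensor u v *m w =
  inH ((4 * c) *: K (hpart u) (hpart v) (hpart w)
  - (t2 * t3 * om (hpart u) (hpart v)) *: (J *m hpart w)).
Proof. by rewrite ext0E mulmxBl -!scalemxAl K4E scalerA (mulrC c). Qed.

Lemma epartZD a u v : epart (a *: u + v) = a * epart u + epart v.
Proof. exact: epart_linear. Qed.

Lemma inH_e_linear a X Y b b' : a *: (inH X + b *: e) + (inH Y + b' *: e) =
  inH (a *: X + Y) + (a * b + b') *: e.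
Proof. by rewrite inHD inHZ scalerDr scalerA scalerDl addrACA. Qed.

Lemma torsion_tensor_linear u a v w : torsion_tensor u (a *: v + w) =
  a *: torsion_tensor u v + torsion_tensor u w.
Proof.
rewrite /torsion_tensor hpart_linear epartZD mulmxDr -scalemxAr omega0Dr omega0Zr inH_e_linear.
congr (inH _ + _ *: _); last by ring.
move: (hpart u) (hpart v) (hpart w) => X Y Z; move: (J *m X) (J *m Y) (J *m Z) => JX JY JZ.
by apply/colP => i; rewrite !mxE; ring.
Qed.

Lemma torsion_tensorC u v : torsion_tensor v u = - torsion_tensor u v.
Proof. by rewrite /torsion_tensor omega0C mulrN scaleNr [RHS]opprD -inHN opprB. Qed.

Lemma K4_linear X : linear (K4 X).
Proof.
move=> a Y Z; apply: mulmx_ext => T; rewrite lincomb_mulmx !K4E /K.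
rewrite mulmxDr -scalemxAr h0Dl h0Zl !(omega0Dl, omega0Dr, omega0Zl, omega0Zr).
move: (J *m X) (J *m Y) (J *m Z) (J *m T) => JX JY JZ JT.
by apply/colP => i; rewrite !mxE; ring.
Qed.

Lemma K4C X Y : K4 Y X = - K4 X Y.
Proof.
rewrite /K4 omega0C mulrN scaleNr opprK !opprD !opprK.
move: (_ *m _) (_ *m _) (_ *m _) (_ *m _) => A B A' B'.
by apply/matrixP => i j; rewrite !mxE; ring.
Qed.

Lemma curvature_tensor_linear u : linear (curvature_tensor u).
Proof.
move=> a v w; rewrite /curvature_tensor hpart_linear K4_linear omega0Dr omega0Zr -linearP; congr ext0.
move: (K4 _ _) (K4 _ _) => A B.
by apply/matrixP => i j; rewrite !mxE; ring.
Qed.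

Lemma curvature_tensorC u v : curvature_tensor v u = - curvature_tensor u v.
Proof.
have ext0N A : - ext0 A = ext0 (- A) by rewrite linearN.
rewrite /curvature_tensor K4C omega0C ext0N; congr ext0.
by rewrite mulrN scaleNr scalerN opprD opprK.
Qed.

Let alt_bilinear (E : lmodType R) (B : V -> V -> E) : (forall u, linear (B u)) ->
  (forall u v, B v u = - B u v) ->
  bilinear_for (GRing.Scale.Law.clone _ _ *:%R _) (GRing.Scale.Law.clone _ _ *:%R _) B.
Proof.
move=> lB BC; split=> [v|u] a x y; last exact: lB.
by rewrite /= BC lB opprD -scalerN -!BC.
Qed.

HB.instance Definition _ := bilinear_isBilinear.Build R V V V _ _ torsion_tensor
  (alt_bilinear torsion_tensor_linear torsion_tensorC).
HB.instance Definition _ := bilinear_isBilinear.Build R V V 'M[R]_d _ _ curvature_tensor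
  (alt_bilinear curvature_tensor_linear curvature_tensorC).

Definition model_T0 : {bilinear V -> V -> V} := torsion_tensor.
Definition model_R0 : {bilinear V -> V -> 'M[R]_d} := curvature_tensor.
Definition model_I0 : {linear V -> 'M[R]_d} := \0.
Local Notation T0 := model_T0.
Local Notation R0 := model_R0.
Local Notation I0 := model_I0.

Lemma T0_parameters : torsion_parameters T0 t1 t2 t3.
Proof.
have hH X : hpart (inH X) = X by rewrite -[inH X]addr0 -(scale0r e) hpart_inH.
have eH X : epart (inH X) = 0 by rewrite -[inH X]addr0 -(scale0r e) epart_inH.
have he : hpart e = 0 by rewrite -[e]add0r -inH0 -[e]scale1r hpart_inH.
have ee : epart e = 1 by rewrite -[e]add0r -inH0 -[e]scale1r epart_inH.
move=> X Y; split; rewrite [T0 _ _]/(torsion_tensor _ _) /torsion_tensor.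
  by rewrite !hH !eH !scale0r subr0 inH0 add0r.
by rewrite hH eH he ee scale1r scale0r subr0 /omega0 h00r mulr0 scale0r addr0.
Qed.

Lemma R0_formulas : curvature_formulas R0 t2 t3 (4 * c).
Proof.
have hH X : hpart (inH X) = X by rewrite -[inH X]addr0 -(scale0r e) hpart_inH.
have he : hpart e = 0 by rewrite -[e]add0r -inH0 -[e]scale1r hpart_inH.
have Ke X Y : K X Y 0 = 0.
  by rewrite /K /omega0 !h00r !mulmx0 !scaler0 !scale0r !subr0 !addr0 scaler0.
have K0 X Z : K X 0 Z = 0.
  rewrite /K /omega0 mulmx0 !h00l h00r mulr0 !scale0r !scaler0.
  by rewrite !subr0 !addr0 scaler0.
move=> X Y Z; rewrite [R0 _ _]/(curvature_tensor _ _) [R0 _ _]/(curvature_tensor _ _); split.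
- apply: mulmx_ext => w; rewrite curvature_tensorE he K0 mul0mx /omega0 h00r mulr0 scale0r scaler0.
  by rewrite subr0 inH0.
- by rewrite curvature_tensorE he Ke mulmx0 !scaler0 subr0 inH0.
- by rewrite curvature_tensorE !hH.
Qed.

Lemma herm_frame z Q X Y : herm_frames z Q -> herm z (Q *m X) (Q *m Y) = h X Y.
Proof. by move=> [QS _]; rewrite /herm h0_trmx !mulmxA QS mul1mx. Qed.

Lemma herm_frameJ z Q X Y : herm_frames z Q -> herm z (J *m (Q *m X)) (Q *m Y) = om X Y.
Proof. by move=> hQ; rewrite mulmxA -hQ.2 -mulmxA herm_frame. Qed.

Lemma hpart_ext1 Q u : hpart (ext1 Q *m u) = Q *m hpart u.
Proof. by rewrite {1}(hpartK u) ext1E hpart_inH. Qed.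

Lemma epart_ext1 Q u : epart (ext1 Q *m u) = epart u.
Proof. by rewrite {1}(hpartK u) ext1E epart_inH. Qed.

Lemma gauge_rep_frame (x : M) Q u (Y : M -> V) : Y x = F (pt x) *m ext1 Q *m u ->
  gauge_rep Finv Y (pt x) = ext1 Q *m u.
Proof. by move=> Yx; rewrite /gauge_rep rep_pt Yx !mulmxA FK mul1mx. Qed.

Lemma model_torsion_frame (x : M) (p : 'M[R]_d) u v (Y Z : M -> V) : unitary_frames x p ->
  smooth_field_near x Y -> smooth_field_near x Z -> Y x = p *m u -> Z x = p *m v ->
  torsion D Y Z x = p *m T0 u v.
Proof.
move=> [Q hQ <-] [W [oW Wx sY]] [W' [oW' Wx' sZ]] Yx Zx.
apply: (etrans (gauge_torsion _ _ _ _ (openI oW oW') (conj Wx Wx')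
  (smooth_field_sub (@subIsetl _ W W') sY) (smooth_field_sub (@subIsetr _ W W') sZ))).
rewrite /gauge_bracket (gauge_rep_frame Yx) (gauge_rep_frame Zx) Yx Zx -!mulmxA.
apply: (etrans (model_torsion (ext1 Q *m u) (ext1 Q *m v) (ptU x))); congr (_ *m _).
rewrite !hpart_ext1 !epart_ext1 herm_frameJ // [T0 u v]/(torsion_tensor u v) /torsion_tensor ext1E.
congr (inH _ + _).
by rewrite mulmxBr -!scalemxAr !mulmxDr -!scalemxAr !(mulmxA _ J) hQ.2 !mulmxA.
Qed.

Lemma model_curvature_frame (x : M) (p : 'M[R]_d) u v w (Y Z T : M -> V) : unitary_frames x p ->
  smooth_field_near x Y -> smooth_field_near x Z -> smooth_field_near x T ->
  Y x = p *m u -> Z x = p *m v -> T x = p *m w ->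
  curvature D Y Z T x = p *m (R0 u v *m w).
Proof.
move=> [Q hQ <-] [W [oW Wx sY]] [W' [oW' Wx' sZ]] [W2 [oW2 Wx2 sT]] Yx Zx Tx.
have oO := openI (openI oW oW') oW2.
have sY' := smooth_field_sub (subset_trans (@subIsetl _ _ W2) (@subIsetl _ W W')) sY.
have sZ' := smooth_field_sub (subset_trans (@subIsetl _ _ W2) (@subIsetr _ W W')) sZ.
have sT' := smooth_field_sub (@subIsetr _ (W `&` W') W2) sT.
apply: (etrans (gauge_curvature _ _ _ _ oO (conj (conj Wx Wx') Wx2) sY' sZ' sT')).
rewrite /gauge_bracket (gauge_rep_frame Yx) (gauge_rep_frame Zx) (gauge_rep_frame Tx).
rewrite Yx Zx -!(mulmxA (F (pt x)) (ext1 Q)).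
apply: (etrans (congr1 (mulmx _)
  (model_curvature (ext1 Q *m u) (ext1 Q *m v) (ext1 Q *m w) (ptU x)))).
congr (_ *m _).
rewrite !hpart_ext1 !herm_frameJ // !herm_frame //.
rewrite [R0 u v]/(curvature_tensor u v) curvature_tensorE block_inH.
have QJ X : J *m (Q *m X) = Q *m (J *m X) by rewrite !mulmxA hQ.2.
congr inH; rewrite !QJ /K scalerA (_ : 4 * c * 4^-1 = c); last by field.
by rewrite mulmxBr -!scalemxAr !(mulmxBr, mulmxDr) -!scalemxAr.
Qed.

(** * Inner torsion of the models *)

Let linear_trmx (f : V -> H) : linear f -> linear (fun z => (f z)^T).
Proof. by move=> lf a u v; rewrite lf linearP. Qed.

Lemma diff_outer p : differentiable outer p /\ forall w, 'd outer p w =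
  herm_outer (hpart w) (hpart p) + herm_outer (hpart p) (hpart w).
Proof.
have lJ : linear (fun z => J *m hpart z) by move=> a u v; rewrite hpart_linear mulmxDr -scalemxAr.
have [d1 E1] := is_diff_of_linear hpart_linear p.
have [d2 E2] := is_diff_of_linear (linear_trmx hpart_linear) p.
have [d3 E3] := is_diff_of_linear lJ p.
have [d4 E4] := is_diff_of_linear (linear_trmx lJ) p.
have [d12 E12] := is_diff_mulmx d1 d2; have [d34 E34] := is_diff_mulmx d3 d4.
split; first exact: differentiableD d12 d34.
move=> w; apply: (etrans (congr1 (@^~ w) (diffD d12 d34))).
have e12 := etrans (E12 w) (f_equal2
  (fun (A : H) (B : 'rV[R]_(n + n)) => A *m (hpart p)^T + hpart p *m B)
  (congr1 (@^~ w) E1) (congr1 (@^~ w) E2)).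
have e34 := etrans (E34 w) (f_equal2
  (fun (A : H) (B : 'rV[R]_(n + n)) => A *m (J *m hpart p)^T + J *m hpart p *m B)
  (congr1 (@^~ w) E3) (congr1 (@^~ w) E4)).
exact: (etrans (f_equal2 +%R e12 e34) (addrACA _ _ _ _)).
Qed.

Definition dgram p X : 'M[R]_(n + n) :=
  let dr := - (2 * c * rho p ^+ 2 * h (hpart p) X) in
  dr%:M - (2 * c * rho p * dr) *: outer p -
    (c * rho p ^+ 2) *: (herm_outer X (hpart p) + herm_outer (hpart p) X).

Lemma diff_gram p : domain p ->
  differentiable gram p /\ forall w, 'd gram p w = dgram p (hpart w).
Proof.
move=> Up; have [dr rE] := is_diff_rho Up; have [dC oE] := diff_outer p.
have [d1 E1] := is_diffZ dr (differentiable_cst (1%:M : 'M[R]_(n + n)) p).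
have d2 := differentiableM_o dr dr.
have d3 := differentiableM_o (differentiable_cst (c : R^o) p) d2.
have E3 w : 'd (fun z => c * (rho z * rho z) : R^o) p w = 2 * c * rho p * drho p w.
  apply: (etrans (diffM_o w (differentiable_cst (c : R^o) p) d2)).
  apply: (etrans (congr1 (fun x => c * x + _) (diffM_o w dr dr))).
  by rewrite rE (diff_cst (c : R^o) p) mulr0 addr0; ring.
have [d4 E4] := is_diffZ d3 dC.
have gE : gram = (fun z => rho z *: 1%:M) - (fun z => (c * (rho z * rho z)) *: outer z).
  by apply/funext => z; rewrite gramE expr2 -[(rho z)%:M]scalemx1.
rewrite gE; split; first exact: differentiableB d1 d4.
move=> w; apply: (etrans (congr1 (@^~ w) (diffB d1 d4))).
have e1 := f_equal2 (fun (a : R) (B : 'M[R]_(n + n)) => a *: 1%:M + rho p *: B) (rE w)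
  (congr1 (@^~ w) (diff_cst (1%:M : 'M[R]_(n + n)) p)).
have e4 := f_equal2
  (fun (a : R) (B : 'M[R]_(n + n)) => a *: outer p + (c * (rho p * rho p)) *: B) (E3 w) (oE w).
apply: (etrans (f_equal2 (fun A B : 'M[R]_(n + n) => A - B) (etrans (E1 w) e1) (etrans (E4 w) e4))).
by rewrite /= scaler0 addr0 /dgram scale_scalar_mx mulr1 opprD addrA -expr2.
Qed.

(** The metric is parallel for L in all directions.  In the vertical direction its
   derivative, along - t1 z, vanishes because t1 c = 0, and J is skew for it. *)
Lemma gram_parallel p y : let A := fs_gamma c (rho p) (hpart p) (hpart y) - (t2 * epart y) *: J in
  dgram p (hpart (F p *m y)) = A^T *m gram p + gram p *m A.
Proof.
move=> A; rewrite FE hpart_inH.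
have oN X Y : herm_outer (X - (t1 * epart y) *: Y) (hpart p) =
    herm_outer X (hpart p) - (t1 * epart y) *: herm_outer Y (hpart p).
  apply: mulmx_ext => T; rewrite mulmxBl -scalemxAl !herm_outerE.
  rewrite mulmxBr -scalemxAr; move: (J *m X) (J *m Y) => JX JY.
  by apply/colP => i; rewrite !mxE; ring.
have oN' X Y : herm_outer (hpart p) (X - (t1 * epart y) *: Y) =
    herm_outer (hpart p) X - (t1 * epart y) *: herm_outer (hpart p) Y.
  apply: mulmx_ext => T; rewrite mulmxBl -scalemxAl !herm_outerE.
  rewrite h0Br h0Zr !(omega0E T) !h0Br !h0Zr -!omega0E; move: (J *m _) => JP.
  by apply/colP => i; rewrite !mxE; ring.
have -> : dgram p (hpart y - (t1 * epart y) *: hpart p) = dgram p (hpart y).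
  rewrite /dgram oN oN' h0Br h0Zr.
  have es (x x' : R) : 2 * c * rho p ^+ 2 * (x - t1 * epart y * x') = 2 * c * rho p ^+ 2 * x.
    by ring: ct1.
  rewrite es; congr (_ - _).
  move: (herm_outer _ _) (herm_outer _ _) (herm_outer _ _) => B1 B2 B3.
  have cb : c * rho p ^+ 2 * (t1 * epart y) = 0 by ring: ct1.
  by rewrite addrACA -opprD scalerBr -[in X in _ - X]scalerDr scalerA cb scale0r subr0.
apply: (etrans (fs_gram_parallel c (rho p) (hpart p) (hpart y))).
have skew (B : 'M[R]_(n + n)) a :
    (B - a *: J)^T *m gram p + gram p *m (B - a *: J) = B^T *m gram p + gram p *m B.
  have -> : (B - a *: J)^T = B^T + a *: J.
    by rewrite [LHS]linearB /= [X in _ - X]linearZ /= tr_J0 scalerN opprK.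
  move: (gram_J p); move: (gram p) => S SJ; rewrite mulmxDl mulmxBr -scalemxAl -scalemxAr SJ.
  by rewrite addrACA subrr addr0.
exact: esym (skew _ _).
Qed.

(** The metric extended by the length 1 of e, so that frames of V are treated at once. *)
Let gramV z : 'M[R]_d := ext0 (gram z) + block_mx 0 0 0 1%:M.

Let diff_gramV p : domain p ->
  differentiable gramV p /\ forall w, 'd gramV p w = ext0 (dgram p (hpart w)).
Proof.
move=> Up; have [dg gE] := diff_gram Up.
pose Li : {linear 'M[R]_(n + n) -> 'M[R]_d} := ext0.
have [di iE] := is_diff_linear_comp Li dg.
pose C : 'M[R]_d := block_mx 0 0 0 1%:M.
have dC := differentiable_cst C p; split; first exact: differentiableD di dC.
move=> w; apply: (etrans (congr1 (@^~ w) (diffD di dC))).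
apply: (etrans (f_equal2 +%R (iE w) (congr1 (@^~ w) (diff_cst C p)))).
by apply: (etrans (addr0 _)); exact: (congr1 ext0 (gE w)).
Qed.

Let gramVE z : gramV z = ext1 (gram z). Proof. by rewrite ext1_ext0. Qed.

Let mul_ext0_ext1 A B : ext0 A *m ext1 B = ext0 (A *m B).
Proof. by rewrite /ext0 /ext1 mulmx_block !mulmx0 !mul0mx !addr0. Qed.

Let mul_ext1_ext0 A B : ext1 B *m ext0 A = ext0 (B *m A).
Proof. by rewrite /ext0 /ext1 mulmx_block !mulmx0 !mul0mx !addr0. Qed.

Let tr_ext1 A : (ext1 A)^T = ext1 A^T.
Proof. by rewrite /ext1 tr_block_mx !trmx0 trmx1. Qed.

Let tr_ext0 A : (ext0 A)^T = ext0 A^T.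
Proof. by rewrite /ext0 tr_block_mx !trmx0. Qed.

(** If q turns a metric G, parallel for L, into the standard one and commutes with the
   parallel endomorphism J, then q^-1 dq + q^-1 L q is skew and commutes with J. *)
Let connection_form_un0 (q dq N L G dG : 'M[R]_d) : q \in unitmx -> q *m N = dq + L *m q ->
  q *m e = e -> dq *m e = 0 -> L *m e = 0 ->
  q *m ext0 J = ext0 J *m q -> dq *m ext0 J = ext0 J *m dq -> L *m ext0 J = ext0 J *m L ->
  q^T *m G *m q = 1%:M ->
  dG = L^T *m G + G *m L ->
  dq^T *m (G *m q) + q^T *m (dG *m q + G *m dq) = 0 -> un0 N.
Proof.
move=> uq qN qe dqe Le qJ dqJ LJ qG -> dqG.
have qinj m (A B : 'M[R]_(d, m)) : q *m A = q *m B -> A = B.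
  by move=> /(congr1 (mulmx (invmx q))); rewrite !mulKmx.
apply/un0P; split.
- have E : (q *m N)^T *m G *m q + q^T *m G *m (q *m N) = 0.
    have -> : (q *m N)^T = dq^T + q^T *m L^T by rewrite qN [LHS]linearD /= trmx_mul.
    rewrite -dqG qN !(mulmxDl, mulmxDr) -!mulmxA -!addrA.
    by congr (_ + (_ + _)); exact: addrC.
  apply/eqP; rewrite -addr_eq0; apply/eqP; rewrite -E trmx_mul.
  have -> : N^T *m q^T *m G *m q = N^T *m (q^T *m G *m q) by rewrite !mulmxA.
  by rewrite (mulmxA _ q N) qG mulmx1 mul1mx.
- apply: qinj; rewrite !mulmxA qN mulmxDl dqJ -[J0V _ _]/(ext0 J) qJ.
  by rewrite -(mulmxA L) qJ !mulmxA LJ -!mulmxA qN mulmxDr.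
- by apply: qinj; rewrite mulmxA qN mulmxDl dqe add0r -mulmxA qe Le mulmx0.
Qed.

(** A section of P is F q with q the unitary frames of the metric, extended by e; the
   equations of these frames are differentiated along the section. *)
Lemma model_Lambda (x : M) (W : set M) (s : M -> 'M[R]_d) u :
  local_section unitary_frames W s -> W x -> un0 (Lambda D s x u).
Proof.
move=> [oW Ps ss] Wx; set N := Lambda D s x u.
pose q z := Finv z *m s (point_of domain0 z).
pose p := pt x; pose w := s x *m u.
have us : s x \in unitmx.
  by have [+ _ _] := unitary_frames_Gstructure; apply; exact: Ps Wx.
have [dq qN] := gauge_Lambda Ck_F Ck_Finv (fun v k => Ck_Lam k v) (fun z _ => FK z) u oW Wx ss us.
rewrite -/p -/q -/w in dq qN.
have Up : domain p := ptU x.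
pose O := region (oU := open_domain) (Uz0 := domain0) W.
have oO : open O := region_open oW.
have Op : O p := region_pt Wx.
have qE z : O z -> exists2 Q, herm_frames z Q & q z = ext1 Q.
  move=> [Uz Wz]; have [Q hQ sE] := Ps _ Wz.
  have ptz : pt (point_of domain0 z) = z by exact: val_point_of.
  rewrite ptz in hQ sE; exists Q => //.
  by rewrite /q -sE mulmxA FK mul1mx.
have [Q hQ qp] := qE p Op.
have uq : q p \in unitmx by rewrite qp; exact: ext1_unit hQ.
have qinj (A B : 'M[R]_d) : q p *m A = q p *m B -> A = B.
  by move=> /(congr1 (mulmx (invmx (q p)))); rewrite !mulKmx.
pose A := fs_gamma c (rho p) (hpart p) (hpart (q p *m u)) - (t2 * epart (q p *m u)) *: J.
have qN' : q p *m N = 'd q p w + ext0 A *m q p by exact: qN.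
have wE : w = F p *m (q p *m u).
  have := FK' p; rewrite /w /q /p (_ : s (point_of domain0 (pt x)) = s x); last first.
    by rewrite /coord point_of_val.
  by rewrite !mulmxA => ->; rewrite mul1mx.
have dqe : 'd q p w *m e = 0.
  pose Le : {linear 'M[R]_d -> V} := mulmxr e.
  have [_ LE] := is_diff_linear_comp Le dq.
  apply: (etrans (esym (LE w))); apply: (@diff_eq_cst R d V O (fun z => Le (q z)) e p w oO Op).
  by move=> z /qE[Q' _ qz]; rewrite [Le _]/(q z *m e) qz; exact: block1_e.
have dqJ : 'd q p w *m ext0 J = ext0 J *m 'd q p w.
  pose LJ : {linear 'M[R]_d -> 'M[R]_d} := mulmxr (ext0 J) \- mulmx (ext0 J).
  have [_ LE] := is_diff_linear_comp LJ dq.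
  apply/eqP; rewrite -subr_eq0; apply/eqP; apply: (etrans (esym (LE w))).
  apply: (@diff_eq_cst R d 'M[R]_d O (fun z => LJ (q z)) 0 p w oO Op).
  move=> z /qE[Q' [_ Q'J] qz].
  have E : q z *m ext0 J = ext0 J *m q z by rewrite qz mul_ext0_ext1 mul_ext1_ext0 Q'J.
  exact: (etrans (congr1 (fun B => B - ext0 J *m q z) E) (subrr _)).
have dqG : ('d q p w)^T *m (gramV p *m q p) +
    (q p)^T *m ('d gramV p w *m q p + gramV p *m 'd q p w) = 0.
  pose Lt : {linear 'M[R]_d -> 'M[R]_d} := @trmx R d d.
  have [dt tE] := is_diff_linear_comp Lt dq.
  have [dg _] := diff_gramV Up.
  have [dgq gqE] := is_diff_mulmx dg dq.
  have [_ fE] := is_diff_mulmx dt dgq.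
  have e1 := f_equal2 (fun A B : 'M[R]_d => A *m (gramV p *m q p) + (q p)^T *m B) (tE w) (gqE w).
  apply: (etrans (esym e1)); apply: (etrans (esym (fE w))).
  apply: (@diff_eq_cst R d 'M[R]_d O _ 1%:M p w oO Op) => z /qE[Q' [Q'S _] qz].
  have E : (q z)^T *m (gramV z *m q z) = 1%:M.
    by rewrite qz gramVE tr_ext1 !mul_ext1 mulmxA Q'S ext11.
  exact: E.
have AJ : ext0 A *m ext0 J = ext0 J *m ext0 A.
  rewrite !mul_ext0; congr ext0; rewrite mulmxBl mulmxBr -scalemxAl -scalemxAr.
  by rewrite proj_form_J -!scalemxAl -!scalemxAr.
have GA : 'd gramV p w = (ext0 A)^T *m gramV p + gramV p *m ext0 A.
  have [_ gE] := diff_gramV Up; apply: (etrans (gE w)); rewrite wE gram_parallel.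
  by rewrite gramVE tr_ext0 mul_ext0_ext1 mul_ext1_ext0 -ext0D.
have qe : q p *m e = e by rewrite qp; exact: block1_e.
have qJ : q p *m ext0 J = ext0 J *m q p.
  by rewrite qp mul_ext0_ext1 mul_ext1_ext0 hQ.2.
have qG : (q p)^T *m gramV p *m q p = 1%:M.
  by rewrite qp gramVE tr_ext1 !mul_ext1 hQ.1 ext11.
exact: (connection_form_un0 uq qN' qe dqe (ext0_e A) qJ dqJ AJ qG GA dqG).
Qed.

Let un_conj (A B : 'M[R]_(n + n)) : Un A -> un B -> un (A *m B *m A^T).
Proof.
move=> [AA AJ] [BT BJ]; have AtJ : A^T *m J = J *m A^T.
  by have := congr1 trmx AJ; rewrite !trmx_mul tr_J0 mulNmx mulmxN => /oppr_inj ->.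
split; first by rewrite !trmx_mul trmxK BT mulNmx mulmxN mulmxA.
by rewrite -!mulmxA AtJ (mulmxA B) BJ !mulmxA AJ.
Qed.

(** The frames s x and p differ by an element of U(n), under whose conjugation the Lie
   algebra is stable; so it does not matter which of them defines the congruence. *)
Lemma model_inner_torsion (x : M) (p : 'M[R]_d) u (W : set M) (s : M -> 'M[R]_d) :
  unitary_frames x p -> local_section unitary_frames W s -> W x ->
  [set Ad p A | A in @un0 R n] (inner_torsion D s x (p *m u) - Ad p (I0 u)).
Proof.
move=> Pp ls Wx; have [_ Ps _] := ls; have [up orb _] := unitary_frames_Gstructure.
have := Ps _ Wx; rewrite (orb x p Pp) => -[a [A UA <-] sx].
rewrite [Ad p (I0 u)](_ : _ = 0) ?subr0; last by rewrite /Ad [I0 u]/(0) mulmx0 mul0mx.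
have [B uB NE] := model_Lambda (invmx (s x) *m (p *m u)) ls Wx.
exists (ext0 (A *m B *m A^T)); first by exists (A *m B *m A^T) => //; exact: un_conj.
rewrite /inner_torsion -NE -sx /Ad.
have aa : ext1 A^T *m ext1 A = 1%:M by rewrite mul_ext1 UA.1 ext11.
have E : ext1 A^T *m invmx p *m (p *m ext1 A) = 1%:M.
  by rewrite -mulmxA mulKmx //; exact: up Pp.
have [_ upa] := mulmx1_unit E.
have ia : invmx (p *m ext1 A) = ext1 A^T *m invmx p by rewrite -[LHS]mul1mx -E mulmxK.
have -> : ext0 (A *m B *m A^T) = ext1 A *m block_mx B 0 0 0 *m ext1 A^T.
  by rewrite mul_ext1_ext0 mul_ext0_ext1.
by rewrite -[block_mx A 0 0 1%:M]/(ext1 A) ia !mulmxA.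
Qed.

Lemma model_homogeneous :
  infinitesimally_homogeneous D (@un0 R n) unitary_frames T0 R0 I0.
Proof.
split.
- move=> u; have alt0 (E : lmodType R) (v : E) : v = - v -> v = 0.
    move=> /eqP; rewrite -addr_eq0 -mulr2n -scaler_nat scaler_eq0 pnatr_eq0 /=.
    by move=> /eqP.
  by split; apply: alt0; [exact: torsion_tensorC|exact: curvature_tensorC].
- by move=> x p u v Y Z; exact: model_torsion_frame.
- by move=> x p u v w Y Z T; exact: model_curvature_frame.
- by move=> x p u W s; exact: model_inner_torsion.
Qed.

Lemma model_occurs : occurs n t1 t2 t3 (4 * c).
Proof.
exists M, D, unitary_frames, T0, R0, I0; split.
- exact: unitary_frames_Gstructure.
- exact: model_homogeneous.
- by move=> u; exists 0; [split; rewrite ?trmx0 ?oppr0 ?mulmx0 ?mul0mx|exact: block_mx0].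
- exact: T0_parameters.
- exact: R0_formulas.
Qed.

End Model.

(** * The classification *)

Theorem corollary4p15 (R : realType) (n : nat) (n_ge1 : (1 <= n)%N) :
  (forall (M : manifold R (n + n + 1)) (D : connection M)
          (P : M -> set 'M[R]_(n + n + 1))
          (T0 : {bilinear 'cV[R]_(n + n + 1) -> 'cV[R]_(n + n + 1) -> 'cV[R]_(n + n + 1)})
          (R0 : {bilinear 'cV[R]_(n + n + 1) -> 'cV[R]_(n + n + 1) -> 'M[R]_(n + n + 1)})
          (I0 : {linear 'cV[R]_(n + n + 1) -> 'M[R]_(n + n + 1)})
          (t1 t2 t3 : R),
      Gstructure (@Un1 R n) P ->
      infinitesimally_homogeneous D (@un0 R n) P T0 R0 I0 ->
      (forall u, un0 (I0 u)) ->
      torsion_parameters T0 t1 t2 t3 ->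
      t1 * t3 = 0 /\
      exists k : R,
        [/\ k * t1 = 0,
            curvature_formulas R0 t2 t3 k &
            t1 != 0 -> [/\ t3 = 0, k = 0 & flat D]]) /\
  (forall t1 t2 t3 k : R, t1 * t3 = 0 -> k * t1 = 0 -> occurs n t1 t2 t3 k).
Proof.
split=> [M D P T0 R0 I0 t1 t2 t3 PG hom I00 T0t|t1 t2 t3 k t13 kt1].
  exact: (infinitesimally_homogeneous_constraints n_ge1 PG hom I00 T0t).
(* the metric with parameter c has holomorphic sectional curvature 4 c *)
rewrite (_ : k = 4 * (k / 4)); last by field.
by apply: model_occurs => //; rewrite mulrAC kt1 mul0r.
Qed.
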